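(* Let $H:\Sigma\to\mathbb{R}$ be a double-well type potential and, for $\beta>0$, let $\mu_\beta$ be its Gibbs measure at temperature $\beta^{-1}$. Assume $H_\infty^0\le H_\infty^1$. \begin{enumerate} \item If $\tfrac12(H_\infty^1+H_\infty^0)>H_{min}^1+H_\infty^0$, then $\mu_\beta\to\delta_{1^\infty}$ weak$^*$ as $\beta\to+\infty$. \item If $H_{min}^1+H_\infty^0\ge \tfrac12(H_\infty^1+H_\infty^0)>0$, then $$\lim_{\beta\to+\infty}\mu_\beta=\frac{1}{1+c^2}\,\delta_{0^\infty}+\frac{c^2}{1+c^2}\,\delta_{1^\infty}\quad(\text{weak}^* ),$$ where $c$ is the number defined in the context. \item There exists a double-well type potential $H$ with $a_n^0=a_n^1=0$ for all $n$ and $H_\infty^0=H_\infty^1=0$, which is Lipschitz continuous with respect to the metric $d(x,y)=2^{-\min\{i\,:\,x_i\neq y_i\}}$, and a sequence $\beta_k\to+\infty$ such that $\mu_{\beta_{2k}}\to\delta_{0^\infty}$ and $\mu_{\beta_{2k+1}}\to\delta_{1^\infty}$ weak$^*$ as $k\to+\infty$ (so $\mu_\beta$ does not converge as $\beta\to+\infty$). \end{enumerate}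
   Context: $\Sigma:=\{0,1\}^{\mathbb N}$ with the product topology, $\sigma:\Sigma\to\Sigma$ the left shift $\sigma(x_0,x_1,\dots)=(x_1,x_2,\dots)$. A cylinder $[i_0\dots i_{n-1}]$ is the set of $x\in\Sigma$ with $x_j=i_j$ for $0\le j\le n-1$; $0^n$ denotes $n$ consecutive zeros, $0^\infty,1^\infty$ the two fixed points. Write $x\stackrel{n}{=}y$ if $x,y$ lie in the same cylinder of length $n$; $\mathrm{var}(H,n):=\sup\{|H(x)-H(y)|: x\stackrel{n}{=}y\}$, and $H$ has summable variation if $\sum_{n\ge1}\mathrm{var}(H,n)<\infty$. A double-well type potential is a continuous nonnegative $H:\Sigma\to\mathbb R$ with summable variation for which there are nonnegative sequences $(a_n^0),(a_n^1)$ and strictly positive sequences $(b_n^0),(b_n^1)$ ($n\ge1$) with: $H=a_n^0$ on $[00^n1]$, $H=a_n^1$ on $[11^n0]$, $H=b_n^0$ on $[01^n0]$, $H=b_n^1$ on $[10^n1]$; $\sum_n n a_n^0<\infty$, $\sum_n na_n^1<\infty$; $\sum_{k\ge1}\sup_{n\ge0}|b_k^0-b_{k+n}^0|<\infty$ and $\sum_{k\ge1}\sup_{n\ge0}|b_k^1-b_{k+n}^1|<\infty$. Set $H_n^0:=b_n^0+\sum_{k=1}^{n-1}a_k^1$, $H_n^1:=b_n^1+\sum_{k=1}^{n-1}a_k^0$, $H_{min}^0:=\inf_{n\ge1}H_n^0$, $H_{min}^1:=\inf_{n\ge1}H_n^1$, $H_\infty^0:=\lim_n b_n^0+\sum_{n\ge1}a_n^1$,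 $H_\infty^1:=\lim_n b_n^1+\sum_{n\ge1}a_n^0$. Coincidence number: $\kappa:=\mathrm{card}\{n\ge1: \tfrac12(H_\infty^1+H_\infty^0)=H_n^1+H_\infty^0\}$, and $c:=\frac{\kappa+\sqrt{\kappa^2+4}}{2}$ (largest root of $X^2=\kappa X+1$). Gibbs measure: for $\beta>0$ the transfer operator on $C^0(\Sigma)$ is $\mathcal L_\beta[\Phi](x)=e^{-\beta H(0x)}\Phi(0x)+e^{-\beta H(1x)}\Phi(1x)$ (where $ix=(i,x_0,x_1,\dots)$). For $H$ of summable variation there is a unique positive continuous $\Phi_\beta$ with $\max\Phi_\beta=1$ and $\mathcal L_\beta\Phi_\beta=\lambda_\beta\Phi_\beta$ for some $\lambda_\beta>0$, and a unique Borel probability $\nu_\beta$ with $\mathcal L_\beta^*\nu_\beta=\lambda_\beta\nu_\beta$; the Gibbs measure is $\mu_\beta:=\Phi_\beta\nu_\beta/\int\Phi_\beta\,d\nu_\beta$, a $\sigma$-invariant probability. *)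

(* Defs.v *)
From Stdlib Require Import Reals List.
Open Scope R_scope.

Definition Sigma := nat -> bool.

Definition agree (n : nat) (x y : Sigma) : Prop :=
  forall j, (j < n)%nat -> x j = y j.

Definition scons (b : bool) (x : Sigma) : Sigma :=
  fun n => match n with O => b | S m => x m end.

Definition zero_inf : Sigma := fun _ => false.
Definition one_inf : Sigma := fun _ => true.

Definition continuous_S (f : Sigma -> R) : Prop :=
  forall x eps, 0 < eps -> exists n, forall y, agree n x y -> Rabs (f x - f y) < eps.

Fixpoint psum (a : nat -> R) (m : nat) : R :=
  match m with O => 0 | S m' => psum a m' + a (S m') end.

Definition summable (v : nat -> R) : Prop :=
  (forall n, (1 <= n)%nat -> 0 <= v n) /\ exists M, forall N, psum v N <= M.

(* sum_n var(H,n) < infinity, var(H,n) = sup{|H x - H y| : x =^n y} *)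
Definition summable_variation (H : Sigma -> R) : Prop :=
  exists v, summable v /\
    forall n x y, (1 <= n)%nat -> agree n x y -> Rabs (H x - H y) <= v n.

Definition in_00n1 (n : nat) (x : Sigma) : Prop :=
  (forall j, (j <= n)%nat -> x j = false) /\ x (S n) = true.
Definition in_11n0 (n : nat) (x : Sigma) : Prop :=
  (forall j, (j <= n)%nat -> x j = true) /\ x (S n) = false.
Definition in_01n0 (n : nat) (x : Sigma) : Prop :=
  x O = false /\ (forall j, (1 <= j <= n)%nat -> x j = true) /\ x (S n) = false.
Definition in_10n1 (n : nat) (x : Sigma) : Prop :=
  x O = true /\ (forall j, (1 <= j <= n)%nat -> x j = false) /\ x (S n) = true.

(* sum_{k>=1} sup_{n>=0} |b_k - b_{k+n}| < infinity *)
Definition tail_summable (b : nat -> R) : Prop :=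
  exists w, summable w /\
    forall k n, (1 <= k)%nat -> Rabs (b k - b (k + n)%nat) <= w k.

Definition double_well (H : Sigma -> R) (a0 a1 b0 b1 : nat -> R) : Prop :=
  continuous_S H /\ (forall x, 0 <= H x) /\ summable_variation H /\
  (forall n, (1 <= n)%nat -> 0 <= a0 n /\ 0 <= a1 n /\ 0 < b0 n /\ 0 < b1 n) /\
  (forall n x, (1 <= n)%nat -> in_00n1 n x -> H x = a0 n) /\
  (forall n x, (1 <= n)%nat -> in_11n0 n x -> H x = a1 n) /\
  (forall n x, (1 <= n)%nat -> in_01n0 n x -> H x = b0 n) /\
  (forall n x, (1 <= n)%nat -> in_10n1 n x -> H x = b1 n) /\
  summable (fun n => INR n * a0 n) /\ summable (fun n => INR n * a1 n) /\
  tail_summable b0 /\ tail_summable b1.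

(* H_n^1 := b_n^1 + sum_{k=1}^{n-1} a_k^0   (used with b = b1, a = a0);
   likewise H_n^0 with b = b0, a = a1 *)
Definition Hn (b a : nat -> R) (n : nat) : R := b n + psum a (n - 1).

Definition is_Hinf (b a : nat -> R) (h : R) : Prop :=
  exists lb sa, Un_cv b lb /\ Un_cv (psum a) sa /\ h = lb + sa.

Definition is_inf_n1 (u : nat -> R) (m : R) : Prop :=
  (forall n, (1 <= n)%nat -> m <= u n) /\
  (forall m', (forall n, (1 <= n)%nat -> m' <= u n) -> m' <= m).

Definition has_card (P : nat -> Prop) (k : nat) : Prop :=
  exists l, NoDup l /\ (forall n, In n l <-> P n) /\ length l = k.

Definition c_of (kappa : nat) : R :=
  (INR kappa + sqrt (INR kappa ^ 2 + 4)) / 2.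

Definition transfer (H : Sigma -> R) (beta : R) (f : Sigma -> R) (x : Sigma) : R :=
  exp (- beta * H (scons false x)) * f (scons false x)
  + exp (- beta * H (scons true x)) * f (scons true x).

(* Borel probability measures on the compact metric space Sigma, represented
   (Riesz) as positive normalized linear functionals on C^0(Sigma). *)
Definition is_prob_functional (nu : (Sigma -> R) -> R) : Prop :=
  (forall f g, continuous_S f -> continuous_S g ->
     nu (fun x => f x + g x) = nu f + nu g) /\
  (forall r f, continuous_S f -> nu (fun x => r * f x) = r * nu f) /\
  (forall f, continuous_S f -> (forall x, 0 <= f x) -> 0 <= nu f) /\
  nu (fun _ => 1) = 1.

Definition is_eigenfunction (H : Sigma -> R) (beta : R) (Phi : Sigma -> R) (lam : R) : Prop :=
  continuous_S Phi /\ (forall x, 0 < Phi x) /\ (forall x, Phi x <= 1) /\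
  (exists x, Phi x = 1) /\ 0 < lam /\
  (forall x, transfer H beta Phi x = lam * Phi x).

Definition is_eigenmeasure (H : Sigma -> R) (beta : R) (lam : R) (nu : (Sigma -> R) -> R) : Prop :=
  is_prob_functional nu /\
  forall f, continuous_S f -> nu (transfer H beta f) = lam * nu f.

Definition is_gibbs (H : Sigma -> R) (beta : R) (mu : (Sigma -> R) -> R) : Prop :=
  exists Phi lam nu, is_eigenfunction H beta Phi lam /\ is_eigenmeasure H beta lam nu /\
    forall f, continuous_S f -> mu f = nu (fun x => Phi x * f x) / nu Phi.

Definition gibbs_converges (H : Sigma -> R) (target : (Sigma -> R) -> R) : Prop :=
  forall f, continuous_S f -> forall eps, 0 < eps ->
    exists B, forall beta mu, B < beta -> is_gibbs H beta mu ->
      Rabs (mu f - target f) < eps.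

Definition gibbs_seq_converges (H : Sigma -> R) (beta : nat -> R) (sel : nat -> nat)
    (target : (Sigma -> R) -> R) : Prop :=
  forall f, continuous_S f -> forall eps, 0 < eps ->
    exists N, forall k mu, (N <= k)%nat -> is_gibbs H (beta (sel k)) mu ->
      Rabs (mu f - target f) < eps.

(* Lipschitz for d(x,y) = 2^{-min{i : x_i <> y_i}} (d(x,x) = 0) *)
Definition lipschitz_S (H : Sigma -> R) : Prop :=
  exists K, forall x y m, agree m x y -> x m <> y m ->
    Rabs (H x - H y) <= K * (/ 2) ^ m.

(* Main.v *)
(* Let p i n and M i n be the nu- and mu-masses of the cylinder i^n(not i), and put s = 1/lambda.
   The conformality of nu gives p by recursion, and with
     S_i = sum_n exp(-beta H_n^i) s^n,   T_i = sum_n n exp(-beta H_n^i) s^n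
   it closes up to S_0 S_1 = 1, which determines lambda. The eigenfunction is constant on each
   cylinder i^n(not i), and the differences M i n - M i (n+1) are proportional to the terms of
   S_(not i); hence mu[0] = T_1 / (T_1 + S_1^2 T_0). Summability makes S_i and T_i close to
   geometric sums exp(-beta Hinf_i) sum_n s^n and exp(-beta Hinf_i) sum_n n s^n, up to the finitely
   many levels H_n^1 that attain the relevant minimum, and the limit follows.
   For part 3, levels that decrease to 0 in steps make S_i a geometric sum starting at a cut
   N_i(beta); the mass goes to (not i)^infinity for the i with the larger cut, and the two cuts
   are made to overtake each other. *)

Require Import Defs.
From Stdlib Require Import Reals Ranalysis5 List Arith Lra Lia.
From Stdlib Require Import Classical ClassicalEpsilon FunctionalExtensionality.
From Coquelicot Require Import Coquelicot.
Open Scope R_scope.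

(** * Sums indexed from 1 *)

(** Both selection statements come from one limit theorem with a reference level m: m = Hmin_1 gives
    theta = 0 and all mass at 1^inf, while m = (Hinf_1 - Hinf_0) / 2 gives theta = 1 and the
    mixture. The difficulty is that s tends to 1, where the geometric sums blow up, so every error
    must be bounded uniformly in s. Levels are therefore compared with their limits through a
    distance with finite sum, and the decay of 1 - s is extracted from S_0 S_1 = 1 together with
    lower bounds m_0 and m of the levels, m_0 + m > 0. Measures are functionals on continuous
    functions, so countable additivity has to be replaced: the word i^n has mass at most s^n, and
    this controls the remainder of each series over runs. Convergence quantifies over all Gibbs
    functionals and would be void if there were none. For the example one is constructed: s is a
    root of S_0 S_1 = 1, the eigenfunction is made of rescaled tails of S_i, and the eigenmeasure is
    a limit of images of an atomic functional under the dual operator. *)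

Definition hassum (u : nat -> R) (l : R) : Prop := is_lim_seq (psum u) l.

Lemma psum_ext (u v : nat -> R) (N : nat) :
  (forall n, (1 <= n)%nat -> u n = v n) -> psum u N = psum v N.
Proof.
  intros E. induction N as [|N IH]; simpl; [reflexivity|].
  rewrite IH, E by lia. reflexivity.
Qed.

Lemma psum_le (u v : nat -> R) (N : nat) :
  (forall n, (1 <= n)%nat -> u n <= v n) -> psum u N <= psum v N.
Proof.
  intros E. induction N as [|N IH]; simpl; [lra|].
  specialize (E (S N) ltac:(lia)). lra.
Qed.

Lemma psum_nonneg (u : nat -> R) (N : nat) :
  (forall n, (1 <= n)%nat -> 0 <= u n) -> 0 <= psum u N.
Proof.
  intros E. induction N as [|N IH]; simpl; [lra|].
  specialize (E (S N) ltac:(lia)). lra.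
Qed.

Lemma psum_monotone (u : nat -> R) (N M : nat) :
  (forall n, (1 <= n)%nat -> 0 <= u n) -> (N <= M)%nat -> psum u N <= psum u M.
Proof.
  intros E L. induction L as [|M L IH]; simpl; [lra|].
  specialize (E (S M) ltac:(lia)). lra.
Qed.

Lemma psum_plus (u v : nat -> R) (N : nat) :
  psum (fun n => u n + v n) N = psum u N + psum v N.
Proof. induction N as [|N IH]; simpl; [lra|]. rewrite IH. lra. Qed.

Lemma psum_scal (c : R) (u : nat -> R) (N : nat) :
  psum (fun n => c * u n) N = c * psum u N.
Proof. induction N as [|N IH]; simpl; [lra|]. rewrite IH. lra. Qed.

Lemma psum_abs_le (u v : nat -> R) (N : nat) :
  (forall n, (1 <= n)%nat -> Rabs (u n) <= v n) -> Rabs (psum u N) <= psum v N.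
Proof.
  intros E. induction N as [|N IH]; simpl; [rewrite Rabs_R0; lra|].
  specialize (E (S N) ltac:(lia)).
  eapply Rle_trans; [apply Rabs_triang|lra].
Qed.

Lemma hassum_ext (u v : nat -> R) (l : R) :
  (forall n, (1 <= n)%nat -> u n = v n) -> hassum u l -> hassum v l.
Proof.
  intros E. apply is_lim_seq_ext. intros N. apply psum_ext, E.
Qed.

Lemma lim_unique (u : nat -> R) (l l' : R) : is_lim_seq u l -> is_lim_seq u l' -> l = l'.
Proof.
  intros A B. apply is_lim_seq_unique in A, B. rewrite A in B. injection B. auto.
Qed.

Lemma hassum_unique (u : nat -> R) (l l' : R) : hassum u l -> hassum u l' -> l = l'.
Proof. apply lim_unique. Qed.

Lemma hassum_plus (u v : nat -> R) (l l' : R) :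
  hassum u l -> hassum v l' -> hassum (fun n => u n + v n) (l + l').
Proof.
  intros A B. eapply is_lim_seq_ext; [intros N; symmetry; apply psum_plus|].
  apply is_lim_seq_plus'; assumption.
Qed.

Lemma hassum_scal (c : R) (u : nat -> R) (l : R) :
  hassum u l -> hassum (fun n => c * u n) (c * l).
Proof.
  intros A. eapply is_lim_seq_ext; [intros N; symmetry; apply psum_scal|].
  apply (is_lim_seq_scal_l _ c l A).
Qed.

Lemma hassum_minus (u v : nat -> R) (l l' : R) :
  hassum u l -> hassum v l' -> hassum (fun n => u n - v n) (l - l').
Proof.
  intros A B. replace (l - l') with (l + (-1) * l') by ring.
  eapply hassum_ext; [|apply hassum_plus; [apply A|apply (hassum_scal (-1)), B]].
  intros; simpl; ring.
Qed.

Lemma lim_le_const (u : nat -> R) (l c : R) :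
  is_lim_seq u l -> (forall n, u n <= c) -> l <= c.
Proof.
  intros A B. apply (is_lim_seq_le u (fun _ => c) l c B A), is_lim_seq_const.
Qed.

Lemma lim_ge_const (u : nat -> R) (l c : R) :
  is_lim_seq u l -> (forall n, c <= u n) -> c <= l.
Proof.
  intros A B. apply (is_lim_seq_le (fun _ => c) u c l B); [apply is_lim_seq_const|apply A].
Qed.

Lemma hassum_le (u v : nat -> R) (l l' : R) :
  (forall n, (1 <= n)%nat -> u n <= v n) -> hassum u l -> hassum v l' -> l <= l'.
Proof.
  intros E A B. apply (is_lim_seq_le (psum u) (psum v) l l'); auto.
  intros N. apply psum_le, E.
Qed.

Lemma psum_le_sum (u : nat -> R) (l : R) (N : nat) :
  (forall n, (1 <= n)%nat -> 0 <= u n) -> hassum u l -> psum u N <= l.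
Proof.
  intros E A. apply (is_lim_seq_le_loc (fun _ => psum u N) (psum u) (psum u N) l).
  - exists N. intros M L. apply psum_monotone; assumption.
  - apply is_lim_seq_const.
  - exact A.
Qed.

Lemma term_le_sum (u : nat -> R) (l : R) (n : nat) :
  (forall n, (1 <= n)%nat -> 0 <= u n) -> hassum u l -> (1 <= n)%nat -> u n <= l.
Proof.
  intros E A L. apply Rle_trans with (psum u n); [|apply psum_le_sum; assumption].
  destruct n as [|n]; [lia|]. simpl. pose proof (psum_nonneg u n E). lra.
Qed.

Lemma hassum_exists (u : nat -> R) (M : R) :
  (forall n, (1 <= n)%nat -> 0 <= u n) -> (forall N, psum u N <= M) -> exists l, hassum u l.
Proof.
  intros E B. destruct (ex_finite_lim_seq_incr (psum u) M) as [l A].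
  - intros n. apply psum_monotone; auto.
  - exact B.
  - exists l. exact A.
Qed.

Lemma hassum_compare (u v : nat -> R) (l : R) :
  (forall n, (1 <= n)%nat -> 0 <= u n <= v n) -> hassum v l -> exists l', hassum u l'.
Proof.
  intros E A. apply (hassum_exists u l).
  - intros n L. apply E, L.
  - intros N. apply Rle_trans with (psum v N).
    + apply psum_le. intros n L. apply E, L.
    + apply psum_le_sum; [|exact A]. intros n L. specialize (E n L). lra.
Qed.

Lemma hassum_dist (u v d : nat -> R) (l l' D : R) :
  hassum u l -> hassum v l' ->
  (forall n, (1 <= n)%nat -> Rabs (u n - v n) <= d n) -> (forall N, psum d N <= D) ->
  Rabs (l - l') <= D.
Proof.
  intros A B E F. pose proof (hassum_minus u v l l' A B) as C.
  apply (is_lim_seq_abs) in C. simpl in C.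
  apply (lim_le_const _ _ D C). intros N.
  eapply Rle_trans; [|apply (F N)]. apply psum_abs_le, E.
Qed.

Lemma hassum_abs_exists (u v : nat -> R) (l : R) :
  (forall n, (1 <= n)%nat -> Rabs (u n) <= v n) -> hassum v l -> exists l', hassum u l'.
Proof.
  intros E A.
  destruct (hassum_compare (fun n => u n + v n) (fun n => 2 * v n) (2 * l)) as [l' B].
  - intros n L. specialize (E n L). apply Rabs_le_between in E. lra.
  - apply hassum_scal, A.
  - exists (l' - l). eapply hassum_ext; [|apply (hassum_minus _ _ _ _ B A)].
    intros; simpl; ring.
Qed.

Lemma hassum_shift (u : nat -> R) (l : R) :
  hassum u l -> hassum (fun n => u (S n)) (l - u 1%nat).
Proof.
  intros A. unfold hassum.
  apply is_lim_seq_ext with (fun N => psum u (S N) - u 1%nat).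
  - intros N. induction N as [|N IH]; [simpl; lra|].
    cbn [psum] in *. lra.
  - apply is_lim_seq_minus'; [|apply is_lim_seq_const].
    apply (is_lim_seq_incr_1 (psum u)), A.
Qed.

Lemma psum_zero (N : nat) : psum (fun _ => 0) N = 0.
Proof. induction N as [|N IH]; simpl; lra. Qed.

Lemma hassum_zero : hassum (fun _ => 0) 0.
Proof.
  apply is_lim_seq_ext with (fun _ => 0); [|apply is_lim_seq_const].
  intros N. symmetry. apply psum_zero.
Qed.

Lemma pow_unit (s : R) (n : nat) : 0 < s < 1 -> 0 < s ^ n <= 1.
Proof.
  intros Hs. split; [apply pow_lt; lra|].
  induction n as [|n IH]; simpl; [lra|]. pose proof (pow_lt s n). nra.
Qed.

Lemma psum_geom (s : R) (N : nat) : (1 - s) * psum (fun n => s ^ n) N = s - s * s ^ N.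
Proof. induction N as [|N IH]; simpl in *; [ring|]. rewrite Rmult_plus_distr_l, IH. ring. Qed.

Lemma hassum_geom (s : R) : 0 < s < 1 -> hassum (fun n => s ^ n) (s / (1 - s)).
Proof.
  intros Hs. apply is_lim_seq_ext with (fun N => (s - s * s ^ N) / (1 - s)).
  - intros N. rewrite <- psum_geom. field. lra.
  - apply is_lim_seq_div'; [|apply is_lim_seq_const|lra].
    replace s with (s - s * 0) at 1 by ring.
    apply is_lim_seq_minus'; [apply is_lim_seq_const|].
    apply (is_lim_seq_scal_l _ s 0), is_lim_seq_geom. rewrite Rabs_pos_eq; lra.
Qed.

(** Powers of s decrease, so n s^n is at most s + ... + s^n, which is at most 1 / (1 - s). *)
Lemma n_pow_bound (s : R) (n : nat) : 0 < s < 1 -> INR n * s ^ n * (1 - s) <= 1.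
Proof.
  intros Hs.
  assert (A : INR n * s ^ n <= psum (fun n => s ^ n) n).
  { induction n as [|n IH]; [simpl; lra|].
    rewrite S_INR. cbn [psum pow]. pose proof (pow_unit s n Hs). pose proof (pos_INR n).
    assert (0 <= INR n * s ^ n) by (apply Rmult_le_pos; lra).
    assert (INR n * s ^ n * s <= INR n * s ^ n * 1) by (apply Rmult_le_compat_l; lra). lra. }
  pose proof (psum_geom s n). pose proof (pow_unit s n Hs). nra.
Qed.

(** Write s^n as the square of (sqrt s)^n: one factor absorbs n by [n_pow_bound], the other tends to
    0. *)
Lemma n_pow_lim (s : R) : 0 < s < 1 -> is_lim_seq (fun n => INR n * s ^ n) 0.
Proof.
  intros Hs.
  assert (Hr : 0 < sqrt s < 1).
  { split; [apply sqrt_lt_R0; lra|]. rewrite <- sqrt_1. apply sqrt_lt_1; lra. }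
  assert (E : forall n, s ^ n = sqrt s ^ n * sqrt s ^ n).
  { intros n. rewrite <- Rpow_mult_distr, sqrt_sqrt by lra. reflexivity. }
  apply is_lim_seq_le_le with (fun _ => 0) (fun n => / (1 - sqrt s) * sqrt s ^ n).
  - intros n. pose proof (n_pow_bound (sqrt s) n Hr). pose proof (pow_unit _ n Hr).
    pose proof (pos_INR n). rewrite E. split; [apply Rmult_le_pos; nra|].
    rewrite <- Rmult_assoc. apply Rmult_le_compat_r; [lra|].
    apply Rmult_le_reg_r with (1 - sqrt s); [lra|]. rewrite Rinv_l; lra.
  - apply is_lim_seq_const.
  - replace 0 with (/ (1 - sqrt s) * 0) by ring.
    apply (is_lim_seq_scal_l _ _ 0), is_lim_seq_geom. rewrite Rabs_pos_eq; lra.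
Qed.

Lemma hassum_n_geom (s : R) : 0 < s < 1 ->
  hassum (fun n => INR n * s ^ n) (s / (1 - s) / (1 - s)).
Proof.
  intros Hs.
  apply is_lim_seq_ext with
    (fun N => (psum (fun n => s ^ n) N - s * (INR N * s ^ N)) / (1 - s)).
  - intros N.
    assert (E : (1 - s) * psum (fun n => INR n * s ^ n) N
                = psum (fun n => s ^ n) N - s * (INR N * s ^ N)).
    { induction N as [|N IH]; [simpl; ring|].
      cbn [psum pow]. rewrite Rmult_plus_distr_l, IH, S_INR. ring. }
    rewrite <- E. field. lra.
  - apply is_lim_seq_div'; [|apply is_lim_seq_const|lra].
    replace (s / (1 - s)) with (s / (1 - s) - s * 0) by ring.
    apply is_lim_seq_minus'; [apply hassum_geom, Hs|].
    apply (is_lim_seq_scal_l _ s 0), n_pow_lim, Hs.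
Qed.

Lemma exp_le_compat (x y : R) : x <= y -> exp x <= exp y.
Proof. intros [L| ->]; [left; apply exp_increasing, L|apply Rle_refl]. Qed.

(** * Continuous functions and positive functionals on the shift space *)

Lemma agree_le (n m : nat) (x y : Sigma) : (n <= m)%nat -> agree m x y -> agree n x y.
Proof. intros L A j J. apply A. lia. Qed.

Lemma agree_sym (n : nat) (x y : Sigma) : agree n x y -> agree n y x.
Proof. intros A j J. symmetry. apply A, J. Qed.

Lemma agree_trans (n : nat) (x y z : Sigma) : agree n x y -> agree n y z -> agree n x z.
Proof. intros A B j J. rewrite A by assumption. apply B, J. Qed.

Lemma agree_scons (n : nat) (i : bool) (x y : Sigma) :
  agree n x y -> agree (S n) (scons i x) (scons i y).
Proof. intros A [|j] J; simpl; [reflexivity|]. apply A. lia. Qed.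

(* Counterexamples at every depth inside a cylinder persist inside one of its two halves; following
   these halves leads to a point around which the property never holds. *)
Lemma sigma_compact (G : nat -> Sigma -> Prop) :
  (forall n m x y, (n <= m)%nat -> agree n x y -> G n x -> G m y) ->
  (forall x, exists n, G n x) -> exists N, forall x, G N x.
Proof.
  intros Mon Loc. apply NNPP. intros No.
  set (bad := fun (n : nat) (x : Sigma) => forall N, exists y, agree n x y /\ ~ G N y).
  assert (Step : forall n x, bad n x -> exists x', agree n x x' /\ bad (S n) x').
  { intros n x Bx. apply NNPP. intros No'.
    assert (K : forall i, exists N, forall y, agree n x y -> y n = i -> G N y).
    { intros i. apply NNPP. intros C. apply No'.
      exists (fun j => if Nat.eqb j n then i else x j). split.
      - intros j J. destruct (Nat.eqb_spec j n); [lia|reflexivity].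
      - intros N. apply NNPP. intros C'. apply C. exists N. intros y A Y.
        apply NNPP. intros NG. apply C'. exists y. split; [|exact NG].
        intros j J. destruct (Nat.eqb_spec j n); [congruence|]. apply A. lia. }
    (* Depths that are good on the two halves add up to a depth that is good on the whole cylinder,
       against badness. *)
    destruct (K false) as [N0 K0]. destruct (K true) as [N1 K1].
    destruct (Bx (N0 + N1)%nat) as [y [A NG]]. apply NG.
    destruct (y n) eqn:Y; [apply (Mon N1 _ y y)|apply (Mon N0 _ y y)]; auto; try lia;
      intros j _; reflexivity. }
  assert (B0 : bad 0%nat zero_inf).
  { intros N. apply NNPP. intros C. apply No. exists N. intros x.
    apply NNPP. intros NG. apply C. exists x. split; [intros j J; lia|exact NG]. }
  set (X := nat_rect (fun n => {x | bad n x}) (exist _ zero_inf B0)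
    (fun n p => let q := constructive_indefinite_description _ (Step n _ (proj2_sig p)) in
                exist _ (proj1_sig q) (proj2 (proj2_sig q)))).
  assert (XS : forall n, agree n (proj1_sig (X n)) (proj1_sig (X (S n)))).
  { intros n. simpl. destruct constructive_indefinite_description as [z Z]. apply Z. }
  assert (XL : forall n m, (n <= m)%nat -> agree n (proj1_sig (X n)) (proj1_sig (X m))).
  { intros n m L. induction L as [|m L IH]; [intros j J; reflexivity|].
    apply agree_trans with (1 := IH), (agree_le n m); auto. }
  (* Stage n fixes only the letters below n, so letter j has to be read at stage j + 1. *)
  set (z := fun j => proj1_sig (X (S j)) j).
  destruct (Loc z) as [n Gz]. destruct (proj2_sig (X n) n) as [y [A NG]].
  apply NG, (Mon n n z y); auto.
  apply agree_trans with (proj1_sig (X n)); [|exact A].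
  intros j J. apply (XL (S j) n); lia.
Qed.

Lemma continuous_S_uniform (f : Sigma -> R) (eps : R) : continuous_S f -> 0 < eps ->
  exists N, forall x y, agree N x y -> Rabs (f x - f y) < eps.
Proof.
  intros Cf He.
  destruct (sigma_compact (fun n x => forall y z, agree n x y -> agree n x z ->
    Rabs (f y - f z) < eps)) as [N HN].
  - intros n m x y L A G u v U V.
    apply G; apply agree_trans with (1 := A); eapply agree_le; eauto.
  - intros x. destruct (Cf x (eps / 2)) as [n Hn]; [lra|]. exists n. intros y z Y Z.
    apply Hn in Y, Z. apply Rabs_def2 in Y, Z. apply Rabs_def1; lra.
  - exists N. intros x y A. apply (HN x); [intros j J; reflexivity|exact A].
Qed.

(** The compactness lemma has a single parameter; the same n serves as length of the cylinder and as
    bound for f on it. *)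
Lemma continuous_S_bounded (f : Sigma -> R) : continuous_S f ->
  exists F, 0 < F /\ forall x, Rabs (f x) <= F.
Proof.
  intros Cf.
  destruct (sigma_compact (fun n x => forall y, agree n x y -> Rabs (f y) <= INR n)) as [N HN].
  - intros n m x y L A G z Z. apply Rle_trans with (INR n); [|apply le_INR, L].
    apply G, agree_trans with (1 := A), (agree_le n m); auto.
  - intros x. destruct (Cf x 1) as [n Hn]; [lra|].
    destruct (INR_unbounded (Rabs (f x) + 1)) as [p Hp].
    exists (n + p)%nat. intros y Y. rewrite plus_INR. pose proof (pos_INR n).
    specialize (Hn y ltac:(apply (agree_le n (n + p)); [lia|exact Y])).
    pose proof (Rabs_triang (f y - f x) (f x)) as T. rewrite Rabs_minus_sym in T.
    replace (f y - f x + f x) with (f y) in T by ring. lra.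
  - exists (INR N + 1). split; [pose proof (pos_INR N); lra|].
    intros x. specialize (HN x x ltac:(intros j J; reflexivity)). lra.
Qed.

(** As for boundedness, n is both the length of the cylinder and, through 1 / (n + 1), the lower
    bound on it. *)
Lemma continuous_S_pos (f : Sigma -> R) : continuous_S f -> (forall x, 0 < f x) ->
  exists c, 0 < c /\ forall x, c <= f x.
Proof.
  intros Cf Pf.
  destruct (sigma_compact (fun n x => forall y, agree n x y -> / (INR n + 1) <= f y)) as [N HN].
  - intros n m x y L A G z Z. apply Rle_trans with (/ (INR n + 1)).
    + pose proof (pos_INR n). apply Rinv_le_contravar; [lra|]. apply le_INR in L. lra.
    + apply G, agree_trans with (1 := A), (agree_le n m); auto.
  - intros x. destruct (Cf x (f x / 2)) as [n Hn]; [specialize (Pf x); lra|].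
    destruct (INR_unbounded (/ (f x / 2))) as [p Hp].
    exists (n + p)%nat. intros y Y. specialize (Pf x).
    specialize (Hn y ltac:(apply (agree_le n (n + p)); [lia|exact Y])).
    apply Rabs_def2 in Hn. apply Rle_trans with (f x / 2); [|lra].
    rewrite <- (Rinv_inv (f x / 2)). pose proof (pos_INR n).
    apply Rinv_le_contravar; [apply Rinv_0_lt_compat; lra|]. rewrite plus_INR. lra.
  - exists (/ (INR N + 1)). pose proof (pos_INR N).
    split; [apply Rinv_0_lt_compat; lra|]. intros x. apply HN with x. intros j J; reflexivity.
Qed.

(** This form lets continuity of sums, products and compositions be imported from limits of real
    sequences. *)
Lemma continuous_S_seq (f : Sigma -> R) : continuous_S f <->
  forall x y, (forall n, agree n x (y n)) -> is_lim_seq (fun n => f (y n)) (f x).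
Proof.
  split.
  - intros Cf x y A. apply is_lim_seq_spec. intros eps.
    destruct (Cf x eps (cond_pos eps)) as [N HN]. exists N. intros n L.
    rewrite Rabs_minus_sym. apply HN, (agree_le N n); auto.
  - intros Sf x eps He. apply NNPP. intros C.
    assert (K : forall n, exists y, agree n x y /\ ~ Rabs (f x - f y) < eps).
    { intros n. apply NNPP. intros C'. apply C. exists n. intros y A.
      apply NNPP. intros C2. apply C'. exists y. auto. }
    apply choice in K. destruct K as [y Hy].
    specialize (Sf x y (fun n => proj1 (Hy n))). apply is_lim_seq_spec in Sf.
    destruct (Sf (mkposreal eps He)) as [N HN]. specialize (HN N (Nat.le_refl N)).
    apply (proj2 (Hy N)). rewrite Rabs_minus_sym. exact HN.
Qed.

Lemma continuous_S_const (c : R) : continuous_S (fun _ => c).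
Proof. intros x eps He. exists 0%nat. intros y _. rewrite Rminus_diag, Rabs_R0. exact He. Qed.

Lemma continuous_S_plus (f g : Sigma -> R) :
  continuous_S f -> continuous_S g -> continuous_S (fun x => f x + g x).
Proof.
  rewrite !continuous_S_seq. intros F G x y A. apply is_lim_seq_plus'; auto.
Qed.

Lemma continuous_S_mult (f g : Sigma -> R) :
  continuous_S f -> continuous_S g -> continuous_S (fun x => f x * g x).
Proof.
  rewrite !continuous_S_seq. intros F G x y A. apply is_lim_seq_mult'; auto.
Qed.

Lemma continuous_S_scal (c : R) (f : Sigma -> R) :
  continuous_S f -> continuous_S (fun x => c * f x).
Proof. intros F. apply continuous_S_mult; [apply continuous_S_const|exact F]. Qed.

Lemma continuous_S_comp (h : R -> R) (f : Sigma -> R) :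
  (forall t, continuity_pt h t) -> continuous_S f -> continuous_S (fun x => h (f x)).
Proof.
  rewrite !continuous_S_seq. intros Ch F x y A.
  apply is_lim_seq_continuous; auto.
Qed.

Lemma continuous_S_scons (i : bool) (f : Sigma -> R) :
  continuous_S f -> continuous_S (fun x => f (scons i x)).
Proof.
  intros F x eps He. destruct (F (scons i x) eps He) as [n Hn]. exists n.
  intros y A. apply Hn, (agree_le n (S n)), agree_scons; auto.
Qed.

Lemma continuous_S_local (n : nat) (f : Sigma -> R) :
  (forall x y, agree n x y -> f x = f y) -> continuous_S f.
Proof.
  intros E x eps He. exists n. intros y A. rewrite (E x y A), Rminus_diag, Rabs_R0. exact He.
Qed.

Lemma continuous_S_transfer (H : Sigma -> R) (beta : R) (f : Sigma -> R) :
  continuous_S H -> continuous_S f -> continuous_S (transfer H beta f).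
Proof.
  intros CH Cf. unfold transfer.
  apply continuous_S_plus;
    (apply continuous_S_mult;
      [apply (continuous_S_comp exp); [apply derivable_continuous, derivable_exp|];
       apply continuous_S_scal|]; apply continuous_S_scons; assumption).
Qed.

(** * Indicators of the run cylinders *)

Definition indic (b : bool) : R := if b then 1 else 0.

Definition shift (x : Sigma) : Sigma := fun n => x (S n).

(* [run i n] is the cylinder of the word i^n followed by the other letter. *)
Fixpoint run (i : bool) (n : nat) (x : Sigma) : bool :=
  match n with
  | O => Bool.eqb (x O) (negb i)
  | S m => andb (Bool.eqb (x O) i) (run i m (shift x))
  end.

Fixpoint const_word (i : bool) (n : nat) (x : Sigma) : bool :=
  match n with
  | O => true
  | S m => andb (Bool.eqb (x O) i) (const_word i m (shift x))
  end.

Definition const_pt (i : bool) : Sigma := fun _ => i.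

Lemma agree_shift (n : nat) (x y : Sigma) : agree (S n) x y -> agree n (shift x) (shift y).
Proof. intros A j J. apply A. lia. Qed.

Lemma run_agree (i : bool) (n : nat) (x y : Sigma) : agree (S n) x y -> run i n x = run i n y.
Proof.
  revert x y. induction n as [|n IH]; intros x y A; simpl; rewrite (A 0%nat) by lia; auto.
  f_equal. apply IH, agree_shift, A.
Qed.

Lemma const_word_agree (i : bool) (n : nat) (x y : Sigma) :
  agree n x y -> const_word i n x = const_word i n y.
Proof.
  revert x y. induction n as [|n IH]; intros x y A; simpl; auto.
  rewrite (A 0%nat) by lia. f_equal. apply IH, agree_shift, A.
Qed.

Lemma run_spec (i : bool) (n : nat) (x : Sigma) :
  run i n x = true <-> (forall j, (j < n)%nat -> x j = i) /\ x n = negb i.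
Proof.
  revert x. induction n as [|n IH]; intros x; simpl.
  - rewrite Bool.eqb_true_iff. split; [|tauto]. intros E. split; [intros; lia|exact E].
  - rewrite Bool.andb_true_iff, Bool.eqb_true_iff, IH. unfold shift. split.
    + intros [A [B C]]. split; [|exact C]. intros [|j] J; [exact A|]. apply B. lia.
    + intros [A B]. repeat split; [apply A; lia| |exact B]. intros j J. apply A. lia.
Qed.

Lemma const_word_spec (i : bool) (n : nat) (x : Sigma) :
  const_word i n x = true <-> agree n (const_pt i) x.
Proof.
  revert x. induction n as [|n IH]; intros x; simpl.
  - split; [intros _ j J; lia|reflexivity].
  - rewrite Bool.andb_true_iff, Bool.eqb_true_iff, IH. split.
    + intros [A B] [|j] J; [symmetry; exact A|]. exact (B j ltac:(lia)).
    + intros A. split; [symmetry; apply A; lia|]. intros j J. exact (A (S j) ltac:(lia)).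
Qed.

Lemma const_word_S (i : bool) (n : nat) (x : Sigma) :
  indic (const_word i n x) = indic (run i n x) + indic (const_word i (S n) x).
Proof.
  revert x. induction n as [|n IH]; intros x.
  - simpl. destruct (x 0%nat), i; simpl; lra.
  - specialize (IH (shift x)). simpl in *. destruct (Bool.eqb (x 0%nat) i); simpl in *; lra.
Qed.

(** Finite additivity only sees finitely many runs. The last term is the remainder of all later
    series over runs, and its mass will be shown to be at most s^(N+1). *)
Lemma const_word_split (i : bool) (N : nat) (x : Sigma) :
  indic (Bool.eqb (x O) i) = psum (fun n => indic (run i n x)) N + indic (const_word i (S N) x).
Proof.
  induction N as [|N IH].
  - simpl. rewrite Bool.andb_true_r. lra.
  - rewrite IH. cbn [psum]. rewrite (const_word_S i (S N)). lra.
Qed.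

Lemma continuous_S_run (i : bool) (n : nat) : continuous_S (fun x => indic (run i n x)).
Proof. apply (continuous_S_local (S n)). intros x y A. f_equal. apply run_agree, A. Qed.

Lemma continuous_S_const_word (i : bool) (n : nat) :
  continuous_S (fun x => indic (const_word i n x)).
Proof. apply (continuous_S_local n). intros x y A. f_equal. apply const_word_agree, A. Qed.

Lemma continuous_S_first (i : bool) : continuous_S (fun x => indic (Bool.eqb (x O) i)).
Proof. apply (continuous_S_local 1). intros x y A. rewrite (A 0%nat) by lia. reflexivity. Qed.

Lemma continuous_S_psum (u : nat -> Sigma -> R) (N : nat) :
  (forall n, continuous_S (u n)) -> continuous_S (fun x => psum (fun n => u n x) N).
Proof.
  intros C. induction N as [|N IH]; simpl; [apply continuous_S_const|].
  apply (continuous_S_plus _ (u (S N))); auto.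
Qed.

Lemma indic_bounds (b : bool) : 0 <= indic b <= 1.
Proof. destruct b; simpl; lra. Qed.

Create HintDb cont.
#[export] Hint Resolve continuous_S_const continuous_S_plus continuous_S_mult continuous_S_scal
  continuous_S_run continuous_S_const_word continuous_S_first continuous_S_psum
  continuous_S_transfer : cont.

(** * Positive normalized functionals *)

Section Functional.
Context (nu : (Sigma -> R) -> R) (P : is_prob_functional nu).

Lemma prob_minus (f g : Sigma -> R) : continuous_S f -> continuous_S g ->
  nu (fun x => f x - g x) = nu f - nu g.
Proof.
  intros F G. destruct P as [Add [Sc _]].
  replace (fun x => f x - g x) with (fun x => f x + (-1) * g x)
    by (apply functional_extensionality; intros; lra).
  rewrite Add, Sc by auto with cont. ring.
Qed.

Lemma prob_le (f g : Sigma -> R) : continuous_S f -> continuous_S g ->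
  (forall x, f x <= g x) -> nu f <= nu g.
Proof.
  intros F G L.
  assert (A : 0 <= nu (fun x => g x + (-1) * f x)).
  { apply P; auto with cont. intros x. specialize (L x). lra. }
  destruct P as [Add [Sc _]]. rewrite Add, Sc in A by auto with cont. lra.
Qed.

Lemma prob_const (c : R) : nu (fun _ => c) = c.
Proof.
  destruct P as [_ [Sc [_ N]]].
  replace (fun _ : Sigma => c) with (fun _ : Sigma => c * 1)
    by (apply functional_extensionality; intros; lra).
  rewrite Sc, N by auto with cont. ring.
Qed.

Lemma prob_psum (u : nat -> Sigma -> R) (N : nat) : (forall n, continuous_S (u n)) ->
  nu (fun x => psum (fun n => u n x) N) = psum (fun n => nu (u n)) N.
Proof.
  intros C. induction N as [|N IH]; simpl; [apply prob_const|].
  rewrite <- IH. apply (proj1 P); auto with cont.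
Qed.

Lemma prob_abs_le (f g : Sigma -> R) : continuous_S f -> continuous_S g ->
  (forall x, Rabs (f x) <= g x) -> Rabs (nu f) <= nu g.
Proof.
  intros F G L.
  assert (A : nu f <= nu g).
  { apply prob_le; auto. intros x. specialize (L x). apply Rabs_le_between in L. lra. }
  assert (B : nu (fun x => (-1) * f x) <= nu g).
  { apply prob_le; auto with cont. intros x. specialize (L x). apply Rabs_le_between in L. lra. }
  destruct P as [_ [Sc _]]. rewrite Sc in B by auto. apply Rabs_le. lra.
Qed.
End Functional.

(* Mass can leave the two fixed points only through the cylinders i^n(not i). *)
Lemma close_to_fixed_points (f : Sigma -> R) (w eps : R) : continuous_S f -> 0 < eps ->
  exists delta, 0 < delta /\ forall mu, is_prob_functional mu ->
    Rabs (mu (fun x => indic (Bool.eqb (x O) false)) - w) < delta ->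
    (forall i n, (1 <= n)%nat -> mu (fun x => indic (run i n x)) < delta) ->
    Rabs (mu f - (w * f zero_inf + (1 - w) * f one_inf)) < eps.
Proof.
  intros Cf He.
  destruct (continuous_S_bounded f Cf) as [F [Fp HF]].
  destruct (Cf zero_inf (eps / 4) ltac:(lra)) as [N0 H0].
  destruct (Cf one_inf (eps / 4) ltac:(lra)) as [N1 H1].
  set (N := (N0 + N1)%nat). pose proof (pos_INR N).
  (* The errors add up to at most eps/4 + 2F(2N+1) delta: 2N short runs and the defect in the mass
     of [0], each weighted by 2F, a bound for differences of values of f. The remaining unit is
     slack. *)
  set (K := 2 * F * (2 * INR N + 2)).
  assert (Kp : 0 < K) by (unfold K; apply Rmult_lt_0_compat; lra).
  exists (eps / 4 / K). split; [apply Rdiv_lt_0_compat; lra|].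
  intros mu P W Rn. pose proof P as [Add [Sc _]].
  set (m0 := mu (fun x => indic (Bool.eqb (x O) false))) in *.
  assert (m1 : mu (fun x => indic (Bool.eqb (x O) true)) = 1 - m0).
  { unfold m0. rewrite <- (prob_const mu P 1) at 1.
    rewrite <- (prob_minus mu P) by auto with cont. f_equal.
    apply functional_extensionality. intros x. destruct (x O); simpl; lra. }
  (* The comparison function takes the value of f at the fixed point that shares the first
     letter. *)
  set (g := fun x : Sigma => f zero_inf * indic (Bool.eqb (x O) false)
                             + f one_inf * indic (Bool.eqb (x O) true)).
  assert (Cg : continuous_S g) by (unfold g; auto with cont).
  assert (Mg : mu g = f zero_inf * m0 + f one_inf * (1 - m0)).
  { unfold g. rewrite Add, !Sc, m1 by auto with cont. reflexivity. }
  (* A continuous majorant of the distance between f and g: eps/4 where the first run is longer than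
     N, at least 2F where it is shorter. *)
  set (e := fun x : Sigma => eps / 4 + (2 * F * psum (fun n => indic (run false n x)) N
                                       + 2 * F * psum (fun n => indic (run true n x)) N)).
  assert (Ce : continuous_S e).
  { unfold e. apply continuous_S_plus; [apply continuous_S_const|].
    apply continuous_S_plus; apply continuous_S_scal;
    (apply (continuous_S_psum (fun n x => indic (run _ n x))); intros; apply continuous_S_run). }
  assert (Me : mu e <= eps / 4 + 2 * F * (INR N * (eps / 4 / K)) + 2 * F * (INR N * (eps / 4 / K))).
  { unfold e.
    assert (Cps : forall i, continuous_S (fun x => psum (fun n => indic (run i n x)) N)).
    { intros i. apply (continuous_S_psum (fun n x => indic (run i n x))).
      intros; apply continuous_S_run. }
    assert (B : forall i, mu (fun x => psum (fun n => indic (run i n x)) N) <= INR N * (eps / 4 / K)).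
    { intros i. rewrite (prob_psum mu P (fun n x => indic (run i n x)))
        by (intros; apply continuous_S_run).
      clearbody N. clear - Rn. generalize dependent (eps / 4 / K). intros dl Rn.
      induction N as [|N IH]; [simpl; lra|].
      rewrite S_INR. cbn [psum]. specialize (Rn i (S N) ltac:(lia)). lra. }
    rewrite Add by auto with cont. rewrite Add by auto with cont.
    rewrite !Sc, (prob_const mu P) by auto with cont.
    pose proof (B false). pose proof (B true). nra. }
  assert (D : Rabs (mu (fun x => f x - g x)) <= mu e).
  { apply (prob_abs_le mu P); auto.
    { apply (continuous_S_plus f (fun x => - g x)); auto.
      replace (fun x => - g x) with (fun x => (-1) * g x)
        by (apply functional_extensionality; intros; lra). auto with cont. }
    intros x.
    assert (E : forall i, x O = i ->
      indic (const_word i (S N) x) = 1 \/ 1 <= psum (fun n => indic (run i n x)) N).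
    { intros i Ei. pose proof (const_word_split i N x) as Sp. rewrite Ei in Sp.
      rewrite Bool.eqb_reflx in Sp. simpl indic at 1 in Sp.
      destruct (const_word i (S N) x); simpl in Sp |- *; [left; reflexivity|right; lra]. }
    assert (Pp : forall i, 0 <= psum (fun n => indic (run i n x)) N).
    { intros i. apply psum_nonneg. intros; apply indic_bounds. }
    unfold e, g. pose proof (Pp false). pose proof (Pp true).
    assert (Pq : forall i, 0 <= 2 * F * psum (fun n => indic (run i n x)) N)
      by (intros i; apply Rmult_le_pos; [lra|apply Pp]).
    pose proof (Pq false). pose proof (Pq true).
    pose proof (HF x). pose proof (HF zero_inf). pose proof (HF one_inf).
    destruct (x O) eqn:X0; simpl Bool.eqb; unfold indic at 1 2.
    - destruct (E true eq_refl) as [C|C].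
      + assert (A : agree N1 one_inf x).
        { apply (agree_le N1 (S N)); [unfold N; lia|].
          apply (const_word_spec true). destruct const_word; [reflexivity|simpl in C; lra]. }
        apply H1 in A. rewrite Rabs_minus_sym in A.
        replace (f x - (f zero_inf * 0 + f one_inf * 1)) with (f x - f one_inf) by ring. lra.
      + assert (2 * F * 1 <= 2 * F * psum (fun n => indic (run true n x)) N)
          by (apply Rmult_le_compat_l; lra).
        replace (f x - (f zero_inf * 0 + f one_inf * 1)) with (f x + - f one_inf) by ring.
        eapply Rle_trans; [apply Rabs_triang|]. rewrite Rabs_Ropp. lra.
    - destruct (E false eq_refl) as [C|C].
      + assert (A : agree N0 zero_inf x).
        { apply (agree_le N0 (S N)); [unfold N; lia|].
          apply (const_word_spec false). destruct const_word; [reflexivity|simpl in C; lra]. }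
        apply H0 in A. rewrite Rabs_minus_sym in A.
        replace (f x - (f zero_inf * 1 + f one_inf * 0)) with (f x - f zero_inf) by ring. lra.
      + assert (2 * F * 1 <= 2 * F * psum (fun n => indic (run false n x)) N)
          by (apply Rmult_le_compat_l; lra).
        replace (f x - (f zero_inf * 1 + f one_inf * 0)) with (f x + - f zero_inf) by ring.
        eapply Rle_trans; [apply Rabs_triang|]. rewrite Rabs_Ropp. lra. }
  rewrite (prob_minus mu P) in D by auto. rewrite Mg in D.
  set (dl := eps / 4 / K) in *.
  assert (KK : K * dl = eps / 4) by (unfold dl; field; lra).
  assert (V : Rabs ((m0 - w) * (f zero_inf - f one_inf)) <= dl * (2 * F)).
  { rewrite Rabs_mult. apply Rmult_le_compat; try apply Rabs_pos; [lra|].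
    eapply Rle_trans; [apply Rabs_triang|]. rewrite Rabs_Ropp.
    pose proof (HF zero_inf). pose proof (HF one_inf). lra. }
  unfold K in KK.
  apply Rabs_le_between in D. apply Rabs_le_between in V.
  apply Rabs_def1; nra.
Qed.

(** * Masses of the Gibbs measure *)

(** Indexing the wells by their letter lets each statement be proved once for both. The conditions
    describe the effect of prepending a letter, which is what the transfer operator does; of the
    summability assumptions only the vanishing at the fixed points is kept. *)
Definition block_potential (H : Sigma -> R) (a b : bool -> nat -> R) : Prop :=
  continuous_S H /\ (forall x, 0 <= H x) /\ (forall i, H (const_pt i) = 0) /\
  (forall i n, (1 <= n)%nat -> 0 <= a i n /\ 0 <= b i n) /\
  (forall i n x, (1 <= n)%nat -> run i n x = true -> H (scons i x) = a i n) /\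
  (forall i n x, (1 <= n)%nat -> run (negb i) n x = true -> H (scons i x) = b i n).

(** The potential collected when a run of the letter not i is built up from length 1 to length n and
    then closed by prepending i. *)
Definition level (a b : bool -> nat -> R) (i : bool) (n : nat) : R :=
  Hn (b i) (a (negb i)) n.

(** There is one factor s for each of the n letters prepended: n - 1 to lengthen the run and one to
    close it. *)
Definition weight (a b : bool -> nat -> R) (beta s : R) (i : bool) (n : nat) : R :=
  exp (- beta * level a b i n) * s ^ n.

Definition norm_transfer (H : Sigma -> R) (beta s : R) (f : Sigma -> R) (x : Sigma) : R :=
  s * transfer H beta f x.

Lemma transfer_split (H : Sigma -> R) (beta : R) (f : Sigma -> R) (x : Sigma) (i : bool) :
  transfer H beta f x = exp (- beta * H (scons i x)) * f (scons i x)
    + exp (- beta * H (scons (negb i) x)) * f (scons (negb i) x).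
Proof. unfold transfer. destruct i; simpl; ring. Qed.

Lemma run_scons (i : bool) (n : nat) (x : Sigma) : run i (S n) (scons i x) = run i n x.
Proof. simpl. rewrite Bool.eqb_reflx. reflexivity. Qed.

Lemma run_scons_neg (i : bool) (n : nat) (x : Sigma) : run i (S n) (scons (negb i) x) = false.
Proof. destruct i; reflexivity. Qed.

Lemma run_first (i : bool) (n : nat) (x : Sigma) : (1 <= n)%nat -> run i n x = true -> x O = i.
Proof. intros L A. apply run_spec in A. apply A. lia. Qed.

Lemma run_neg_1 (i : bool) (n : nat) (x : Sigma) : (1 <= n)%nat -> run i n x = true ->
  run (negb i) 1 (scons (negb i) x) = true.
Proof.
  intros L A. rewrite run_scons. simpl. rewrite (run_first i n x L A).
  destruct i; reflexivity.
Qed.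

(* Points of one cylinder i^n(not i) have the same Birkhoff sums along all preimages, so the
   oscillation of an iterate on such a cylinder is that of f on much smaller cylinders. *)
Lemma iterate_oscillation (H : Sigma -> R) (a b : bool -> nat -> R) (beta s eps : R)
    (Phi f : Sigma -> R) (N : nat) :
  block_potential H a b -> 0 < s ->
  (forall x, norm_transfer H beta s Phi x = Phi x) ->
  (forall x y, agree N x y -> Rabs (f x - f y) <= eps * Phi x) ->
  forall k x y i n, (1 <= n)%nat -> run i n x = true -> run i n y = true ->
    agree (N - k) x y ->
    Rabs (Nat.iter k (norm_transfer H beta s) f x - Nat.iter k (norm_transfer H beta s) f y)
      <= eps * Phi x.
Proof.
  intros [_ [_ [_ [_ [HA HB]]]]] Hs EP Hf k.
  induction k as [|k IH]; intros x y i n L X Y A.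
  - apply Hf. replace N with (N - 0)%nat by lia. exact A.
  - simpl. rewrite <- (EP x). unfold norm_transfer at 1 3 5.
    rewrite !(transfer_split _ _ _ _ i).
    assert (Ag : forall l, agree (N - k) (scons l x) (scons l y)).
    { intros l. apply (agree_le _ (S (N - S k))); [lia|]. apply agree_scons, A. }
    rewrite (HA i n x L X), (HA i n y L Y).
    assert (X' : run (negb (negb i)) n x = true) by (rewrite Bool.negb_involutive; exact X).
    assert (Y' : run (negb (negb i)) n y = true) by (rewrite Bool.negb_involutive; exact Y).
    rewrite (HB _ n x L X'), (HB _ n y L Y').
    pose proof (IH (scons i x) (scons i y) i (S n) ltac:(lia)
      ltac:(rewrite run_scons; exact X) ltac:(rewrite run_scons; exact Y) (Ag i)) as I1.
    pose proof (IH (scons (negb i) x) (scons (negb i) y) (negb i) 1%nat ltac:(lia)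
      (run_neg_1 i n x L X) (run_neg_1 i n y L Y) (Ag (negb i))) as I2.
    pose proof (exp_pos (- beta * a i n)). pose proof (exp_pos (- beta * b (negb i) n)).
    set (A1 := exp (- beta * a i n)) in *. set (B1 := exp (- beta * b (negb i) n)) in *.
    apply Rabs_le_between in I1. apply Rabs_le_between in I2.
    assert (J : forall c u v, 0 < c -> - v <= u <= v -> - (s * c * v) <= s * c * u <= s * c * v).
    { intros c u v Hc [U V]. assert (0 < s * c) by (apply Rmult_lt_0_compat; lra). nra. }
    apply (J A1) in I1; [|assumption]. apply (J B1) in I2; [|assumption].
    apply Rabs_le. lra.
Qed.

(** * Masses and eigenfunction of an arbitrary Gibbs functional *)

Section Gibbs.
Context (H : Sigma -> R) (a b : bool -> nat -> R) (beta lam : R)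
  (Phi : Sigma -> R) (nu : (Sigma -> R) -> R).
Context (HP : block_potential H a b) (Hbeta : 0 < beta)
  (Eig : is_eigenfunction H beta Phi lam) (Mea : is_eigenmeasure H beta lam nu).

Let s := / lam.
Let CH : continuous_S H := proj1 HP.
Let HA := proj1 (proj2 (proj2 (proj2 (proj2 HP)))).
Let HB := proj2 (proj2 (proj2 (proj2 (proj2 HP)))).
Let Pnu : is_prob_functional nu := proj1 Mea.
Let p (i : bool) (n : nat) : R := nu (fun x => indic (run i n x)).
Let q (i : bool) (n : nat) : R := nu (fun x => indic (const_word i n x)).

(** At the fixed point 0^inf the potential vanishes: one preimage is the point itself with weight 1,
    and the other one contributes a positive amount. *)
Lemma eigenvalue_gt_1 : 1 < lam.
Proof.
  destruct Eig as [_ [Pos [_ [_ [_ E]]]]].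
  specialize (E (const_pt false)). rewrite (transfer_split _ _ _ _ false) in E.
  replace (scons false (const_pt false)) with (const_pt false) in E
    by (apply functional_extensionality; intros [|n]; reflexivity).
  rewrite (proj1 (proj2 (proj2 HP))), Rmult_0_r, exp_0 in E.
  pose proof (exp_pos (- beta * H (scons (negb false) (const_pt false)))) as X.
  pose proof (Pos (scons (negb false) (const_pt false))) as Y.
  pose proof (Pos (const_pt false)) as Z.
  pose proof (Rmult_lt_0_compat _ _ X Y). nra.
Qed.

Lemma inv_eigenvalue_bounds : 0 < s < 1.
Proof.
  pose proof eigenvalue_gt_1. unfold s. split; [apply Rinv_0_lt_compat; lra|].
  rewrite <- Rinv_1. apply Rinv_lt_contravar; lra.
Qed.

Let Hs := inv_eigenvalue_bounds.

Lemma s_lam : s * lam = 1.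
Proof. pose proof eigenvalue_gt_1. unfold s. field. lra. Qed.

Lemma exp_potential_bounds (x : Sigma) : 0 < exp (- beta * H x) <= 1.
Proof.
  split; [apply exp_pos|]. rewrite <- exp_0. pose proof (proj1 (proj2 HP) x) as E.
  apply exp_le_compat. nra.
Qed.

Lemma measure_transfer (f : Sigma -> R) : continuous_S f -> nu f = s * nu (transfer H beta f).
Proof.
  intros C. rewrite (proj2 Mea f C), <- Rmult_assoc, s_lam. ring.
Qed.

Lemma run_mass_step (i : bool) (n : nat) : (1 <= n)%nat ->
  p i (S n) = s * exp (- beta * a i n) * p i n.
Proof.
  intros L. unfold p. rewrite measure_transfer by auto with cont. rewrite Rmult_assoc.
  f_equal. rewrite <- (proj1 (proj2 Pnu)) by auto with cont.
  f_equal. apply functional_extensionality. intros x.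
  rewrite (transfer_split _ _ _ _ i), run_scons, run_scons_neg.
  destruct (run i n x) eqn:E; simpl; [rewrite (HA i n x L E)|]; ring.
Qed.

(** The potential is nonnegative, so each further letter costs at least a factor s. This geometric
    decay takes the place of countable additivity. *)
Lemma const_word_mass (i : bool) (n : nat) : 0 <= q i n <= s ^ n.
Proof.
  split.
  - apply Pnu; [auto with cont|]. intros x. apply indic_bounds.
  - induction n as [|n IH].
    + unfold q. simpl. rewrite (prob_const nu Pnu). lra.
    + apply Rle_trans with (s * q i n); [|simpl; apply Rmult_le_compat_l; lra].
      unfold q at 1. rewrite measure_transfer by auto with cont.
      apply Rmult_le_compat_l; [lra|]. apply (prob_le nu Pnu); auto with cont.
      intros x. rewrite (transfer_split _ _ _ _ i). simpl.
      rewrite Bool.eqb_reflx. replace (Bool.eqb (negb i) i) with false by (destruct i; reflexivity).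
      pose proof (exp_potential_bounds (scons i x)).
      change (shift (scons i x)) with x.
      simpl. pose proof (indic_bounds (const_word i n x)). nra.
Qed.

Lemma geometric_tail_lim (c : R) (u : nat -> R) :
  (forall n, Rabs (u n - c) <= s ^ n) -> is_lim_seq u c.
Proof.
  intros E. pose proof Hs as Hs'.
  apply is_lim_seq_le_le with (fun n => c - s ^ n) (fun n => c + s ^ n).
  - intros n. specialize (E n). apply Rabs_le_between in E. lra.
  - replace (Finite c) with (Finite (c - 0)) by (f_equal; ring).
    apply is_lim_seq_minus'; [apply is_lim_seq_const|].
    apply is_lim_seq_geom. rewrite Rabs_pos_eq; lra.
  - replace (Finite c) with (Finite (c + 0)) by (f_equal; ring).
    apply is_lim_seq_plus'; [apply is_lim_seq_const|].
    apply is_lim_seq_geom. rewrite Rabs_pos_eq; lra.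
Qed.

(** Conformality is tested on the indicator of the word i(not i). A point x contributes through ix
    exactly if it starts with not i, and [const_word_split] sorts such points by their first run, up
    to a word of mass at most s^(N+1). *)
Lemma run_mass_1 (i : bool) :
  hassum (fun n => exp (- beta * b i n) * p (negb i) n) (lam * p i 1).
Proof.
  apply geometric_tail_lim. intros N.
  set (j := negb i).
  set (L := fun x => psum (fun n => exp (- beta * b i n) * indic (run j n x)) N).
  assert (CL : continuous_S L).
  { apply (continuous_S_psum (fun n x => exp (- beta * b i n) * indic (run j n x))).
    auto with cont. }
  assert (NL : nu L = psum (fun n => exp (- beta * b i n) * p j n) N).
  { unfold L. rewrite (prob_psum nu Pnu (fun n x => exp (- beta * b i n) * indic (run j n x)))
      by auto with cont.
    apply psum_ext. intros n _. apply (proj1 (proj2 Pnu)). auto with cont. }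
  assert (TE : forall x, transfer H beta (fun x => indic (run i 1 x)) x
                 = L x + exp (- beta * H (scons i x)) * indic (const_word j (S N) x)).
  { intros x. rewrite (transfer_split _ _ _ _ i), run_scons, run_scons_neg.
    change (run i 0 x) with (Bool.eqb (x O) j). rewrite (const_word_split j N x).
    unfold L. rewrite Rmult_plus_distr_l, <- psum_scal. simpl (indic false).
    rewrite (psum_ext (fun n => exp (- beta * H (scons i x)) * indic (run j n x))
               (fun n => exp (- beta * b i n) * indic (run j n x))); [ring|].
    intros n Ln. destruct (run j n x) eqn:E; simpl; [rewrite (HB i n x Ln E)|]; ring. }
  unfold p at 2. rewrite <- (proj2 Mea) by auto with cont. rewrite <- NL.
  assert (CT : continuous_S (transfer H beta (fun x => indic (run i 1 x))))
    by (apply continuous_S_transfer; auto with cont).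
  rewrite Rabs_minus_sym, <- (prob_minus nu Pnu) by auto.
  apply Rle_trans with (q j (S N)).
  - apply (prob_abs_le nu Pnu); auto with cont.
    + apply (continuous_S_plus _ (fun x => - L x)); auto.
      replace (fun x => - L x) with (fun x => (-1) * L x)
        by (apply functional_extensionality; intros; lra). auto with cont.
    + intros x. rewrite TE. pose proof (exp_potential_bounds (scons i x)).
      pose proof (indic_bounds (const_word j (S N) x)).
      replace (L x + exp (- beta * H (scons i x)) * indic (const_word j (S N) x) - L x)
        with (exp (- beta * H (scons i x)) * indic (const_word j (S N) x)) by ring.
      rewrite Rabs_pos_eq by (apply Rmult_le_pos; lra). nra.
  - eapply Rle_trans; [apply const_word_mass|]. simpl. pose proof (pow_unit s N Hs). nra.
Qed.

(** The factor [lam * s ^ n] is s^(n-1), one s for each of the n - 1 lengthenings; in this shape the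
    powers match those of [weight]. *)
Lemma run_mass_formula (i : bool) (n : nat) : (1 <= n)%nat ->
  p i n = p i 1%nat * exp (- beta * psum (a i) (n - 1)) * (lam * s ^ n).
Proof.
  intros L. induction L as [|n L IH].
  - simpl. rewrite Rmult_0_r, exp_0. transitivity (p i 1 * (s * lam)); [|ring].
    rewrite s_lam. ring.
  - rewrite run_mass_step by exact L. rewrite IH. destruct n as [|n]; [lia|].
    replace (S (S n) - 1)%nat with (S n) by lia. replace (S n - 1)%nat with n by lia.
    cbn [psum pow]. rewrite Rmult_plus_distr_l, exp_plus. ring.
Qed.

Lemma level_nonneg (i : bool) (n : nat) : (1 <= n)%nat -> 0 <= level a b i n.
Proof.
  intros L. pose proof (proj1 (proj2 (proj2 (proj2 HP)))) as Pos.
  unfold level, Hn. pose proof (proj2 (Pos i n L)).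
  pose proof (psum_nonneg (a (negb i)) (n - 1) (fun k Lk => proj1 (Pos (negb i) k Lk))). lra.
Qed.

Lemma weight_bounds (i : bool) (n : nat) : (1 <= n)%nat ->
  0 < weight a b beta s i n <= s ^ n.
Proof.
  intros L. unfold weight. pose proof (pow_unit s n Hs).
  pose proof (exp_pos (- beta * level a b i n)).
  assert (exp (- beta * level a b i n) <= 1).
  { rewrite <- exp_0. apply exp_le_compat. pose proof (level_nonneg i n L). nra. }
  split; [apply Rmult_lt_0_compat; lra|nra].
Qed.

Lemma weights_summable (i : bool) : exists S T,
  hassum (weight a b beta s i) S /\ hassum (fun n => INR n * weight a b beta s i n) T /\
  0 < S /\ 0 < T.
Proof.
  destruct (hassum_compare (weight a b beta s i) (fun n => s ^ n) (s / (1 - s))) as [S HS].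
  { intros n L. pose proof (weight_bounds i n L). lra. }
  { apply hassum_geom, Hs. }
  destruct (hassum_compare (fun n => INR n * weight a b beta s i n) (fun n => INR n * s ^ n)
    (s / (1 - s) / (1 - s))) as [T HT].
  { intros n L. pose proof (weight_bounds i n L). pose proof (pos_INR n).
    split; [apply Rmult_le_pos|apply Rmult_le_compat_l]; lra. }
  { apply hassum_n_geom, Hs. }
  exists S, T. repeat split; auto.
  - apply Rlt_le_trans with (weight a b beta s i 1); [apply weight_bounds; lia|].
    apply term_le_sum with (2 := HS); [|lia]. intros n L. pose proof (weight_bounds i n L). lra.
  - apply Rlt_le_trans with (INR 1 * weight a b beta s i 1).
    + simpl INR. pose proof (weight_bounds i 1 ltac:(lia)). lra.
    + apply (term_le_sum (fun n => INR n * weight a b beta s i n)) with (2 := HT); [|lia].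
      intros n L. pose proof (weight_bounds i n L). pose proof (pos_INR n).
      apply Rmult_le_pos; lra.
Qed.

(** Inserting the closed form of the masses into [run_mass_1] turns each term into a multiple of a
    weight. Applied to i and to not i in turn, this gives S_0 S_1 = 1. *)
Lemma run_mass_relation (i : bool) (S : R) : hassum (weight a b beta s i) S ->
  p i 1 = p (negb i) 1 * S.
Proof.
  intros HS. pose proof eigenvalue_gt_1.
  apply Rmult_eq_reg_l with lam; [|lra].
  apply hassum_unique with (1 := run_mass_1 i).
  rewrite <- Rmult_assoc.
  eapply hassum_ext; [|apply hassum_scal, HS].
  intros n L. simpl. rewrite (run_mass_formula (negb i) n L). unfold weight, level, Hn.
  rewrite Rmult_plus_distr_l, exp_plus. ring.
Qed.

Lemma first_letter_mass (i : bool) : hassum (p i) (nu (fun x => indic (Bool.eqb (x O) i))).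
Proof.
  apply geometric_tail_lim. intros N. rewrite Rabs_minus_sym.
  assert (C : continuous_S (fun x => psum (fun n => indic (run i n x)) N)).
  { apply (continuous_S_psum (fun n x => indic (run i n x))). auto with cont. }
  rewrite <- (prob_psum nu Pnu (fun n x => indic (run i n x))), <- (prob_minus nu Pnu)
    by auto with cont.
  replace (fun x : Sigma => _) with (fun x => indic (const_word i (S N) x)).
  - pose proof (const_word_mass i (S N)) as Q. rewrite Rabs_pos_eq by apply Q.
    eapply Rle_trans; [apply Q|]. simpl. pose proof (pow_unit s N Hs). nra.
  - apply functional_extensionality. intros x. rewrite (const_word_split i N x). ring.
Qed.

(** If one of these masses vanished, so would the other by [run_mass_relation], hence those of all
    runs and of both cylinders [0] and [1], against total mass 1. *)
Lemma run_mass_1_pos (i : bool) : 0 < p i 1.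
Proof.
  assert (N : forall j, 0 <= p j 1).
  { intros j. apply Pnu; [auto with cont|]. intros; apply indic_bounds. }
  destruct (weights_summable i) as [Si [_ [Hi [_ [Pi _]]]]].
  destruct (weights_summable (negb i)) as [Sj [_ [Hj [_ [Pj _]]]]].
  apply run_mass_relation in Hi, Hj. rewrite Bool.negb_involutive in Hj.
  destruct (N i) as [|E]; [assumption|]. exfalso.
  assert (Z : forall j, p j 1 = 0).
  { intros j. destruct (Bool.bool_dec j i) as [->|D]; [auto|].
    replace j with (negb i) by (destruct i, j; auto; congruence). rewrite Hj, <- E. ring. }
  assert (Z' : forall j, nu (fun x => indic (Bool.eqb (x O) j)) = 0).
  { intros j. apply hassum_unique with (1 := first_letter_mass j).
    apply hassum_ext with (2 := hassum_zero). intros n L.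
    rewrite (run_mass_formula j n L), Z. ring. }
  pose proof (prob_const nu Pnu 1) as One.
  replace (fun _ : Sigma => 1)
    with (fun x : Sigma => indic (Bool.eqb (x O) false) + indic (Bool.eqb (x O) true)) in One
    by (apply functional_extensionality; intros x; destruct (x O); simpl; lra).
  rewrite (proj1 Pnu), !Z' in One by auto with cont. lra.
Qed.

(** A chosen point of each run cylinder, used to name the common value of functions constant
    there. *)
Definition run_pt (i : bool) (n : nat) : Sigma := fun j => if Nat.ltb j n then i else negb i.

Lemma run_run_pt (i : bool) (n : nat) : run i n (run_pt i n) = true.
Proof.
  apply run_spec. unfold run_pt. split.
  - intros j J. destruct (Nat.ltb_spec j n); [reflexivity|lia].
  - rewrite Nat.ltb_irrefl. reflexivity.
Qed.

Let phi (i : bool) (n : nat) : R := Phi (run_pt i n).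

Lemma eigenfunction_norm (x : Sigma) : norm_transfer H beta s Phi x = Phi x.
Proof.
  unfold norm_transfer. destruct Eig as [_ [_ [_ [_ [_ E]]]]].
  rewrite E, <- Rmult_assoc, s_lam. ring.
Qed.

(** [Phi] is fixed by all iterates of the normalized operator, while an iterate of high order
    oscillates arbitrarily little on a run cylinder by [iterate_oscillation]. *)
Lemma eigenfunction_run (i : bool) (n : nat) (x : Sigma) :
  (1 <= n)%nat -> run i n x = true -> Phi x = phi i n.
Proof.
  intros L X. destruct Eig as [CP [Pos [Le _]]].
  assert (It : forall k, Nat.iter k (norm_transfer H beta s) Phi = Phi).
  { induction k as [|k IH]; [reflexivity|]. simpl. rewrite IH.
    apply functional_extensionality, eigenfunction_norm. }
  destruct (continuous_S_pos Phi CP Pos) as [c [Hc Bc]].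
  apply cond_eq. intros eps He. fold (phi i n).
  (* The oscillation lemma needs a bound relative to [Phi], hence the factor c, a lower bound of
     [Phi]. *)
  destruct (continuous_S_uniform Phi (eps / 2 * c) CP) as [N HN].
  { apply Rmult_lt_0_compat; lra. }
  assert (Os : Rabs (Nat.iter N (norm_transfer H beta s) Phi x
    - Nat.iter N (norm_transfer H beta s) Phi (run_pt i n)) <= eps / 2 * Phi x).
  { apply (iterate_oscillation H a b beta s (eps / 2) Phi Phi N HP (proj1 Hs))
      with (i := i) (n := n); auto.
    - apply eigenfunction_norm.
    - intros y z A. apply HN in A. specialize (Bc y). nra.
    - apply run_run_pt.
    - intros j J. lia. }
  rewrite It in Os. specialize (Le x). unfold phi. nra.
Qed.

Lemma eigenfunction_step (i : bool) (n : nat) : (1 <= n)%nat ->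
  phi i n = s * (exp (- beta * a i n) * phi i (S n)
                 + exp (- beta * b (negb i) n) * phi (negb i) 1).
Proof.
  intros L. unfold phi at 1. rewrite <- eigenfunction_norm. unfold norm_transfer.
  pose proof (run_run_pt i n) as R.
  rewrite (transfer_split _ _ _ _ i), (HA i n _ L R).
  rewrite (HB (negb i) n) by (rewrite ?Bool.negb_involutive; assumption).
  rewrite (eigenfunction_run i (S n) (scons i (run_pt i n)))
    by (try lia; rewrite run_scons; exact R).
  rewrite (eigenfunction_run (negb i) 1 (scons (negb i) (run_pt i n)))
    by (try lia; apply (run_neg_1 i n); assumption).
  reflexivity.
Qed.

Let M (i : bool) (n : nat) : R := nu (fun x => Phi x * indic (run i n x)).
Let C (i : bool) : R := phi (negb i) 1 * p i 1.

Lemma run_gibbs_mass (i : bool) (n : nat) : (1 <= n)%nat -> M i n = phi i n * p i n.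
Proof.
  intros L. unfold M, p. rewrite <- (proj1 (proj2 Pnu)) by auto with cont.
  f_equal. apply functional_extensionality. intros x.
  destruct (run i n x) eqn:E; simpl; [rewrite (eigenfunction_run i n x L E)|]; ring.
Qed.

(** In [eigenfunction_step] the term with the longer run, multiplied by the mass, is exactly M i
    (n+1) by [run_mass_step]. What remains comes from the preimage that starts with the other
    letter. *)
Lemma run_gibbs_mass_step (i : bool) (n : nat) : (1 <= n)%nat ->
  M i n - M i (S n) = C i * weight a b beta s (negb i) n.
Proof.
  intros L. rewrite !run_gibbs_mass by lia. rewrite (run_mass_step i n L).
  rewrite (eigenfunction_step i n L), (run_mass_formula i n L).
  unfold weight, level, Hn, C. rewrite Bool.negb_involutive.
  rewrite (Rmult_plus_distr_l (- beta)), exp_plus.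
  assert (E : s * (lam * s ^ n) = s ^ n) by (rewrite <- Rmult_assoc, s_lam; ring).
  match goal with |- ?l = ?r =>
    replace l with (phi (negb i) 1 * p i 1 * (exp (- beta * b (negb i) n)
      * exp (- beta * psum (a i) (n - 1)) * (s * (lam * s ^ n)))) by ring end.
  rewrite E. ring.
Qed.

Lemma run_gibbs_mass_bounds (i : bool) (n : nat) : 0 <= M i n <= s ^ n.
Proof.
  destruct Eig as [CP [Pos [Le _]]]. split.
  - apply Pnu; [auto with cont|]. intros x. specialize (Pos x).
    pose proof (indic_bounds (run i n x)). nra.
  - eapply Rle_trans; [|apply (const_word_mass i n)].
    apply (prob_le nu Pnu); auto with cont. intros x.
    rewrite (const_word_S i n x). specialize (Pos x). specialize (Le x).
    pose proof (indic_bounds (run i n x)). pose proof (indic_bounds (const_word i (S n) x)). nra.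
Qed.

(** Summing [run_gibbs_mass_step] over n telescopes to M (not i) 1, since the masses tend to 0; the
    positive factor p (not i) 1 then cancels. *)
Lemma eigenfunction_relation (i : bool) (S : R) : hassum (weight a b beta s i) S ->
  phi (negb i) 1 = phi i 1 * S.
Proof.
  intros HS. pose proof (run_mass_1_pos (negb i)) as Pp.
  apply Rmult_eq_reg_r with (p (negb i) 1); [|lra].
  replace (phi i 1 * S * p (negb i) 1) with (C (negb i) * S)
    by (unfold C; rewrite Bool.negb_involutive; ring).
  rewrite <- run_gibbs_mass by lia.
  apply hassum_unique with (2 := hassum_scal (C (negb i)) _ _ HS).
  apply is_lim_seq_ext with (fun N => M (negb i) 1 - M (negb i) (1 + N)).
  - induction n as [|n IH]; [simpl; ring|].
    cbn [psum]. rewrite <- IH.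
    pose proof (run_gibbs_mass_step (negb i) (1 + n) ltac:(lia)) as E.
    rewrite Bool.negb_involutive in E. simpl in E |- *. lra.
  - apply geometric_tail_lim. intros n. simpl.
    pose proof (run_gibbs_mass_bounds (negb i) (1 + n)) as B.
    match goal with |- Rabs ?e <= _ => replace e with (- M (negb i) (1 + n)) by (simpl; ring) end.
    rewrite Rabs_Ropp, Rabs_pos_eq by apply B.
    eapply Rle_trans; [apply B|]. simpl. pose proof (pow_unit s n Hs). nra.
Qed.

(** Summation by parts: the sum of M i n equals the sum of n (M i n - M i (n+1)), which is C i T.
    The boundary term N M i (N+1) vanishes by the geometric decay; the factors [/ s] and [s] around
    it cancel. *)
Lemma first_letter_gibbs_mass (i : bool) (T : R) :
  hassum (fun n => INR n * weight a b beta s (negb i) n) T ->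
  nu (fun x => Phi x * indic (Bool.eqb (x O) i)) = C i * T.
Proof.
  intros HT. destruct Eig as [CP [Pos [Le _]]].
  apply hassum_unique with (2 := hassum_scal (C i) _ _ HT).
  apply is_lim_seq_ext with (fun N => psum (M i) N - / s * (INR N * M i (S N) * s)).
  { intros N. pose proof Hs. replace (/ s * (INR N * M i (S N) * s)) with (INR N * M i (S N))
      by (field; lra).
    induction N as [|N IH]; [simpl; ring|].
    cbn [psum]. rewrite <- IH, S_INR.
    pose proof (run_gibbs_mass_step i (S N) ltac:(lia)) as E.
    replace (C i * ((INR N + 1) * weight a b beta s (negb i) (S N)))
      with ((INR N + 1) * (M i (S N) - M i (S (S N)))) by (rewrite E; ring). ring. }
  replace (nu _) with (nu (fun x => Phi x * indic (Bool.eqb (x O) i)) - / s * 0) by ring.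
  apply is_lim_seq_minus'.
  - apply geometric_tail_lim. intros N. rewrite Rabs_minus_sym.
    assert (Cp : continuous_S (fun x => psum (fun n => Phi x * indic (run i n x)) N)).
    { apply (continuous_S_psum (fun n x => Phi x * indic (run i n x))). auto with cont. }
    unfold M.
    rewrite <- (prob_psum nu Pnu (fun n x => Phi x * indic (run i n x))), <- (prob_minus nu Pnu)
      by auto with cont.
    eapply Rle_trans; [|eapply Rle_trans; [apply (const_word_mass i (S N))|]].
    + apply (prob_abs_le nu Pnu); auto with cont.
      * apply (continuous_S_plus _ (fun x => - psum (fun n => Phi x * indic (run i n x)) N));
          auto with cont.
        replace (fun x => - psum (fun n => Phi x * indic (run i n x)) N)
          with (fun x => (-1) * psum (fun n => Phi x * indic (run i n x)) N)
          by (apply functional_extensionality; intros; lra). auto with cont.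
      * intros x. rewrite psum_scal, (const_word_split i N x).
        match goal with |- Rabs ?e <= _ =>
          replace e with (Phi x * indic (const_word i (S N) x)) by ring end.
        specialize (Pos x). specialize (Le x). pose proof (indic_bounds (const_word i (S N) x)).
        rewrite Rabs_pos_eq by nra. nra.
    + simpl. pose proof (pow_unit s N Hs). nra.
  - apply (is_lim_seq_scal_l _ (/ s) 0).
    apply is_lim_seq_le_le with (fun _ => 0) (fun N => INR N * s ^ N);
      [|apply is_lim_seq_const|apply n_pow_lim, Hs].
    intros N. pose proof (run_gibbs_mass_bounds i (S N)) as B. pose proof (pos_INR N).
    pose proof (pow_unit s N Hs). simpl in B. split.
    + apply Rmult_le_pos; [apply Rmult_le_pos|]; lra.
    + rewrite Rmult_assoc. apply Rmult_le_compat_l; [lra|]. nra.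
Qed.
End Gibbs.

(** All that the asymptotics need to know about a Gibbs functional. The ratio S / T is the inverse
    of a mean run length, so the last bound says that no single run keeps mass when that mean
    diverges. *)
Lemma gibbs_masses (H : Sigma -> R) (a b : bool -> nat -> R) (beta : R) (mu : (Sigma -> R) -> R) :
  block_potential H a b -> 0 < beta -> is_gibbs H beta mu ->
  is_prob_functional mu /\ exists (s : R) (S T : bool -> R), 0 < s < 1 /\
    (forall i, hassum (weight a b beta s i) (S i) /\
               hassum (fun n => INR n * weight a b beta s i n) (T i) /\ 0 < S i /\ 0 < T i) /\
    S false * S true = 1 /\
    mu (fun x => indic (Bool.eqb (x O) false)) = T true / (T true + S true ^ 2 * T false) /\
    forall i n, (1 <= n)%nat -> forall j, mu (fun x => indic (run i n x)) <= S j / T j.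
Proof.
  intros HP Hb [Phi [lam [nu [Eig [Mea Emu]]]]].
  pose proof (proj1 Mea) as Pnu. pose proof Eig as [CP [Pos [Le _]]].
  destruct (continuous_S_pos Phi CP Pos) as [c [Hc Bc]].
  assert (NP : 0 < nu Phi).
  { apply Rlt_le_trans with c; [exact Hc|]. rewrite <- (prob_const nu Pnu c).
    apply (prob_le nu Pnu); auto with cont. }
  split.
  { destruct Pnu as [Add [Sc [Nn On]]]. split; [|split; [|split]].
    - intros f g F G. rewrite !Emu by auto with cont.
      replace (fun x => Phi x * (f x + g x)) with (fun x => Phi x * f x + Phi x * g x)
        by (apply functional_extensionality; intros; ring).
      rewrite Add by auto with cont. field. lra.
    - intros r f F. rewrite !Emu by auto with cont.
      replace (fun x => Phi x * (r * f x)) with (fun x => r * (Phi x * f x))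
        by (apply functional_extensionality; intros; ring).
      rewrite Sc by auto with cont. field. lra.
    - intros f F Nf. rewrite Emu by auto with cont. apply Rdiv_le_0_compat; [|exact NP].
      apply Nn; auto with cont. intros x. apply Rmult_le_pos; [|apply Nf].
      specialize (Pos x). lra.
    - rewrite Emu by auto with cont.
      replace (fun x => Phi x * 1) with Phi by (apply functional_extensionality; intros; ring).
      field. lra. }
  assert (Ex : forall i, exists ST : R * R,
    hassum (weight a b beta (/ lam) i) (fst ST) /\
    hassum (fun n => INR n * weight a b beta (/ lam) i n) (snd ST) /\ 0 < fst ST /\ 0 < snd ST).
  { intros i. destruct (weights_summable H a b beta lam Phi HP Hb Eig i) as [Si [Ti E]].
    exists (Si, Ti). exact E. }
  apply choice in Ex. destruct Ex as [ST HST].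
  exists (/ lam), (fun i => fst (ST i)), (fun i => snd (ST i)).
  split; [apply (inv_eigenvalue_bounds H a b beta lam Phi HP Eig)|].
  split; [exact HST|].
  destruct (HST false) as [S0 [T0 [PS0 PT0]]]. destruct (HST true) as [S1 [T1 [PS1 PT1]]].
  set (s0 := fst (ST false)) in *. set (s1 := fst (ST true)) in *.
  set (t0 := snd (ST false)) in *. set (t1 := snd (ST true)) in *.
  pose proof (run_mass_relation H a b beta lam Phi nu HP Hb Eig Mea false s0 S0) as R0.
  pose proof (run_mass_relation H a b beta lam Phi nu HP Hb Eig Mea true s1 S1) as R1.
  pose proof (run_mass_1_pos H a b beta lam Phi nu HP Hb Eig Mea false) as P0.
  pose proof (run_mass_1_pos H a b beta lam Phi nu HP Hb Eig Mea true) as P1.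
  pose proof (eigenfunction_relation H a b beta lam Phi nu HP Hb Eig Mea true s1 S1) as F1.
  pose proof (first_letter_gibbs_mass H a b beta lam Phi nu HP Hb Eig Mea false t1 T1) as G0.
  pose proof (first_letter_gibbs_mass H a b beta lam Phi nu HP Hb Eig Mea true t0 T0) as G1.
  cbv zeta beta in *. simpl negb in *.
  set (p0 := nu (fun x => indic (run false 1 x))) in *.
  set (p1 := nu (fun x => indic (run true 1 x))) in *.
  set (f1 := Phi (run_pt true 1)) in *. rewrite F1 in G1.
  assert (E1 : s0 * s1 = 1).
  { apply Rmult_eq_reg_l with p0; [|lra]. rewrite R0 at 2. rewrite R1. ring. }
  assert (Hf1 : 0 < f1) by apply Pos.
  assert (NE : nu Phi = f1 * p0 * (t1 + s1 ^ 2 * t0)).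
  { replace (nu Phi) with (nu (fun x => Phi x * indic (Bool.eqb (x O) false)
                                        + Phi x * indic (Bool.eqb (x O) true))).
    - rewrite (proj1 Pnu), G0, G1, R1 by auto with cont. ring.
    - f_equal. apply functional_extensionality. intros x. destruct (x O); simpl; ring. }
  assert (0 < s1 ^ 2 * t0) by (apply Rmult_lt_0_compat; [apply pow_lt|]; lra).
  split; [exact E1|]. split.
  { rewrite Emu, G0, NE by auto with cont. field. repeat split; lra. }
  intros i n L j.
  (* The masses M i n decrease in n, and M i 1 is the same number f1 p0 s1 for both letters. *)
  assert (B : nu (fun x => Phi x * indic (run i n x)) <= f1 * p0 * s1).
  { apply Rle_trans with (nu (fun x => Phi x * indic (run i 1 x))).
    - induction L as [|n L IH]; [lra|]. eapply Rle_trans; [|exact IH].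
      pose proof (run_gibbs_mass_step H a b beta lam Phi nu HP Eig Mea i n L) as St.
      pose proof (weight_bounds H a b beta lam Phi HP Hb Eig (negb i) n L) as W.
      assert (0 <= Phi (run_pt (negb i) 1) * nu (fun x => indic (run i 1 x))
                   * weight a b beta (/ lam) (negb i) n); [|lra].
      apply Rmult_le_pos; [apply Rmult_le_pos|]; [| |lra].
      + left. apply Pos.
      + apply Pnu; auto with cont. intros; apply indic_bounds.
    - rewrite (run_gibbs_mass H a b beta lam Phi nu HP Eig Mea i 1) by lia.
      destruct i; fold p0 p1 f1; [rewrite R1; right; ring|]. rewrite F1. right; ring. }
  rewrite Emu by auto with cont. rewrite NE.
  (* Dropping either summand of the denominator gives s1 / t1 or 1 / (s1 t0), and the latter is s0 /
     t0 because s0 s1 = 1. *)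
  assert (K : s1 / (t1 + s1 ^ 2 * t0) <= fst (ST j) / snd (ST j)).
  { destruct j; fold s0 s1 t0 t1.
    - apply Rmult_le_compat_l; [lra|]. apply Rinv_le_contravar; lra.
    - apply Rle_trans with (s1 / (s1 ^ 2 * t0)).
      + apply Rmult_le_compat_l; [lra|]. apply Rinv_le_contravar; lra.
      + replace s0 with (/ s1) by (apply Rmult_eq_reg_r with s1; [rewrite Rinv_l|]; lra).
        right. field. lra. }
  eapply Rle_trans; [|exact K].
  assert (0 < f1 * p0) by (apply Rmult_lt_0_compat; lra).
  apply Rle_trans with (f1 * p0 * s1 / (f1 * p0 * (t1 + s1 ^ 2 * t0))).
  - apply Rmult_le_compat_r; [|exact B]. left. apply Rinv_0_lt_compat, Rmult_lt_0_compat; lra.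
  - right. field. repeat split; lra.
Qed.

(** * Low-temperature asymptotics *)

(** The inequality 1 - exp(-u) <= u, with the larger exponential factored out and bounded through
    m. *)
Lemma exp_difference (beta m x y : R) : 0 <= beta -> m <= x -> m <= y ->
  Rabs (exp (- beta * x) - exp (- beta * y)) <= beta * Rabs (x - y) * exp (- beta * m).
Proof.
  intros Hb.
  assert (K : forall x y, m <= x -> x <= y ->
    0 <= exp (- beta * x) - exp (- beta * y) <= beta * (y - x) * exp (- beta * m)).
  { clear x y. intros x y Mx Lxy.
    replace (- beta * y) with (- beta * x + - (beta * (y - x))) by ring. rewrite exp_plus.
    pose proof (exp_ineq1_le (- (beta * (y - x)))) as I.
    assert (0 <= beta * (y - x)) by (apply Rmult_le_pos; lra).
    assert (exp (- (beta * (y - x))) <= 1)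
      by (rewrite <- exp_0; apply exp_le_compat; lra).
    assert (exp (- beta * x) <= exp (- beta * m)) by (apply exp_le_compat; nra).
    pose proof (exp_pos (- beta * x)). pose proof (exp_pos (- (beta * (y - x)))).
    set (E := exp (- (beta * (y - x)))) in *. set (A := exp (- beta * x)) in *.
    replace (A - A * E) with (A * (1 - E)) by ring. split; [apply Rmult_le_pos; lra|].
    rewrite (Rmult_comm _ (exp (- beta * m))).
    apply Rmult_le_compat; lra. }
  intros Mx My. destruct (Rle_dec x y) as [L|L].
  - specialize (K x y Mx L). rewrite (Rabs_minus_sym x y).
    rewrite (Rabs_pos_eq (y - x)), Rabs_pos_eq by lra. apply K.
  - specialize (K y x My ltac:(lra)). rewrite (Rabs_minus_sym (exp _)).
    rewrite (Rabs_pos_eq (x - y)), Rabs_pos_eq by lra. apply K.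
Qed.

(** The error does not involve the sum G, which blows up as s tends to 1, but only the supremum c of
    the factors: 1 for s^n, and 1 / (1 - s) for n s^n. *)
Lemma weighted_sum_error (g L d : nat -> R) (beta Linf m D c S G : R) :
  0 <= beta -> 0 <= c -> (forall n, (1 <= n)%nat -> 0 <= g n <= c) ->
  (forall n, (1 <= n)%nat -> m <= L n) -> m <= Linf ->
  (forall n, (1 <= n)%nat -> Rabs (L n - Linf) <= d n) -> (forall N, psum d N <= D) ->
  hassum g G -> hassum (fun n => exp (- beta * L n) * g n) S ->
  Rabs (S - exp (- beta * Linf) * G) <= c * (beta * D * exp (- beta * m)).
Proof.
  intros Hb Hc Hg Lm Hm Hd HD HG HS.
  apply (hassum_dist _ _ (fun n => c * beta * exp (- beta * m) * d n) _ _ _ HS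
    (hassum_scal (exp (- beta * Linf)) _ _ HG)).
  - intros n Ln. rewrite <- Rmult_minus_distr_r, Rabs_mult.
    pose proof (exp_difference beta m (L n) Linf Hb (Lm n Ln) Hm) as E.
    specialize (Hg n Ln). rewrite (Rabs_pos_eq (g n)) by lra.
    pose proof (exp_pos (- beta * m)).
    assert (beta * Rabs (L n - Linf) * exp (- beta * m) <= beta * d n * exp (- beta * m)).
    { apply Rmult_le_compat_r; [lra|]. apply Rmult_le_compat_l; [lra|]. apply Hd, Ln. }
    apply Rle_trans with (beta * d n * exp (- beta * m) * c); [|right; ring].
    apply Rmult_le_compat; try lra. apply Rabs_pos.
  - intros N. rewrite psum_scal. pose proof (exp_pos (- beta * m)).
    replace (c * (beta * D * exp (- beta * m))) with (c * beta * exp (- beta * m) * D) by ring.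
    apply Rmult_le_compat_l; [|apply HD]. apply Rmult_le_pos; [apply Rmult_le_pos|]; lra.
Qed.

Definition lsum (l : list nat) (f : nat -> R) : R := fold_right (fun n acc => f n + acc) 0 l.

Lemma hassum_list (l : list nat) (f : nat -> R) :
  NoDup l -> (forall n, In n l -> (1 <= n)%nat) ->
  hassum (fun n => if in_dec Nat.eq_dec n l then f n else 0) (lsum l f).
Proof.
  induction l as [|k l IH]; intros ND Pos; [exact hassum_zero|].
  inversion ND as [|? ? NI ND']; subst.
  assert (One : hassum (fun n => if Nat.eq_dec n k then f k else 0) (f k)).
  { assert (Lk : (1 <= k)%nat) by (apply Pos; left; reflexivity).
    assert (E : forall N, psum (fun n => if Nat.eq_dec n k then f k else 0) N
                  = if le_dec k N then f k else 0).
    { induction N as [|N IHN]; cbn [psum].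
      - destruct (le_dec k 0); [lia|reflexivity].
      - rewrite IHN. destruct (le_dec k N), (Nat.eq_dec (S N) k), (le_dec k (S N));
          try lia; ring. }
    apply is_lim_seq_ext_loc with (fun _ => f k); [|apply is_lim_seq_const].
    exists k. intros N LN. rewrite E. destruct (le_dec k N); [reflexivity|lia]. }
  eapply hassum_ext; [|apply (hassum_plus _ _ _ _ One (IH ND' (fun n I => Pos n (or_intror I))))].
  intros n _. cbv beta.
  destruct (Nat.eq_dec n k) as [->|NE], (in_dec Nat.eq_dec _ l) as [I|I];
    destruct (in_dec Nat.eq_dec _ (k :: l)) as [J|J]; simpl in J; try tauto; try ring;
    exfalso; intuition congruence.
Qed.

Lemma lim_near (u v e : nat -> R) (l : R) :
  (forall n, Rabs (u n - v n) <= e n) -> is_lim_seq e 0 -> is_lim_seq v l -> is_lim_seq u l.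
Proof.
  intros B E V. apply is_lim_seq_le_le with (fun n => v n - e n) (fun n => v n + e n).
  - intros n. specialize (B n). apply Rabs_le_between in B. lra.
  - replace (Finite l) with (Finite (l - 0)) by (f_equal; ring).
    apply is_lim_seq_minus'; assumption.
  - replace (Finite l) with (Finite (l + 0)) by (f_equal; ring).
    apply is_lim_seq_plus'; assumption.
Qed.

Lemma lim_lsum (l : list nat) (f : nat -> nat -> R) (c : nat -> R) :
  (forall n, is_lim_seq (fun k => f k n) (c n)) ->
  is_lim_seq (fun k => lsum l (f k)) (lsum l c).
Proof.
  intros A. induction l as [|n l IH]; simpl; [apply is_lim_seq_const|].
  apply is_lim_seq_plus'; auto.
Qed.

Lemma lsum_one (l : list nat) : lsum l (fun _ => 1) = INR (length l).
Proof.
  induction l as [|n l IH]; [reflexivity|].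
  change (length (n :: l)) with (S (length l)). rewrite S_INR, <- IH. simpl. ring.
Qed.

Lemma beta_exp_lim (beta : nat -> R) (c : R) : is_lim_seq beta p_infty -> 0 < c ->
  is_lim_seq (fun k => beta k * exp (- beta k * c)) 0.
Proof.
  intros B Hc.
  assert (Neg : is_lim_seq (fun k => - c * beta k) m_infty).
  { apply is_lim_seq_ext with (fun k => - (c * beta k)); [intros; ring|].
    apply (is_lim_seq_opp _ p_infty).
    replace p_infty with (Rbar_mult c p_infty)
      by (simpl; destruct (Rle_dec 0 c) as [r|]; [destruct (Rle_lt_or_eq_dec 0 c r)|]; auto; lra).
    apply is_lim_seq_scal_l, B. }
  apply is_lim_seq_ext with (fun k => - / c * ((- c * beta k) * exp (- c * beta k))).
  { intros k. replace (- beta k * c) with (- c * beta k) by ring. field. lra. }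
  replace (Finite 0) with (Rbar_mult (- / c) 0) by (simpl; f_equal; ring).
  apply is_lim_seq_scal_l.
  apply (is_lim_comp_seq (fun y => y * exp y) _ m_infty); [apply is_lim_mul_exp_m| |exact Neg].
  exists 0%nat. intros n _ E. discriminate E.
Qed.

Lemma exp_lim (beta : nat -> R) (c : R) : is_lim_seq beta p_infty -> 0 < c ->
  is_lim_seq (fun k => exp (- beta k * c)) 0.
Proof.
  intros B Hc. pose proof (beta_exp_lim beta c B Hc) as L.
  apply is_lim_seq_le_le_loc with (fun _ => 0) (fun k => beta k * exp (- beta k * c));
    [|apply is_lim_seq_const|exact L].
  apply is_lim_seq_spec in B. destruct (B 1) as [N HN]. exists N. intros n Ln.
  specialize (HN n Ln). pose proof (exp_pos (- beta n * c)). simpl in *. nra.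
Qed.

(* After multiplying S0 by exp(-beta m) and S1 by exp(beta m), the equation S0 * S1 = 1 becomes
   X^2 = kappa X + theta in the limit, for X the rescaled S1: kappa counts the levels equal to m
   and theta is the limit of exp(-beta (H1 - H0 - 2 m)). *)
Lemma mass_limit (L0 L1 d0 d1 : nat -> R) (H0 H1 m0 m m' D0 D1 theta : R) (l : list nat) :
  (forall n, (1 <= n)%nat -> m0 <= L0 n) -> m0 <= H0 ->
  (forall n, (1 <= n)%nat -> Rabs (L0 n - H0) <= d0 n) -> (forall N, psum d0 N <= D0) ->
  NoDup l -> (forall n, In n l -> (1 <= n)%nat /\ L1 n = m) ->
  (forall n, (1 <= n)%nat -> ~ In n l -> m' <= L1 n) -> m < m' -> m' <= H1 ->
  (forall n, (1 <= n)%nat -> Rabs (L1 n - H1) <= d1 n) -> (forall N, psum d1 N <= D1) ->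
  0 < m0 + m ->
  (H1 - H0 - 2 * m = 0 /\ theta = 1 \/
   0 < H1 - H0 - 2 * m /\ theta = 0 /\ (1 <= length l)%nat) ->
  forall delta, 0 < delta -> exists B, forall beta s S0 S1 T0 T1, B < beta -> 0 < s < 1 ->
    hassum (fun n => exp (- beta * L0 n) * s ^ n) S0 ->
    hassum (fun n => exp (- beta * L1 n) * s ^ n) S1 ->
    hassum (fun n => INR n * (exp (- beta * L0 n) * s ^ n)) T0 ->
    hassum (fun n => INR n * (exp (- beta * L1 n) * s ^ n)) T1 ->
    0 < S0 -> 0 < S1 -> 0 < T0 -> 0 < T1 -> S0 * S1 = 1 ->
    Rabs (T1 / (T1 + S1 ^ 2 * T0)
          - theta / (theta + ((INR (length l) + sqrt (INR (length l) ^ 2 + 4 * theta)) / 2) ^ 2))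
      < delta /\ S0 / T0 < delta.
Proof.
  intros HL0 Hm0 Hd0 HD0 ND Hl HL1 Hmm' Hm' Hd1 HD1 Hpos Hth delta Hdelta.
  set (kap := INR (length l)). set (W := (kap + sqrt (kap ^ 2 + 4 * theta)) / 2).
  apply NNPP. intros No.
  (* If the claim failed, there would be counterexamples with beta beyond every integer; along such
     a sequence all estimates become limits. *)
  assert (Bad : forall k : nat, exists z : R * R * (R * R) * (R * R),
    let '(beta, s, (S0, S1), (T0, T1)) := z in
    INR k < beta /\ 0 < s < 1 /\
    hassum (fun n => exp (- beta * L0 n) * s ^ n) S0 /\
    hassum (fun n => exp (- beta * L1 n) * s ^ n) S1 /\
    hassum (fun n => INR n * (exp (- beta * L0 n) * s ^ n)) T0 /\
    hassum (fun n => INR n * (exp (- beta * L1 n) * s ^ n)) T1 /\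
    0 < S0 /\ 0 < S1 /\ 0 < T0 /\ 0 < T1 /\ S0 * S1 = 1 /\
    ~ (Rabs (T1 / (T1 + S1 ^ 2 * T0) - theta / (theta + W ^ 2)) < delta /\ S0 / T0 < delta)).
  { intros k. apply NNPP. intros C. apply No. exists (INR k).
    intros beta s S0 S1 T0 T1 A1 A2 A3 A4 A5 A6 A7 A8 A9 A10 A11. apply NNPP. intros C'.
    apply C. exists (beta, s, (S0, S1), (T0, T1)).
    do 11 (split; [assumption|]). exact C'. }
  apply choice in Bad. destruct Bad as [z Hz].
  set (beta := fun k => fst (fst (fst (z k)))). set (s := fun k => snd (fst (fst (z k)))).
  set (S0 := fun k => fst (snd (fst (z k)))). set (S1 := fun k => snd (snd (fst (z k)))).
  set (T0 := fun k => fst (snd (z k))). set (T1 := fun k => snd (snd (z k))).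
  assert (Hz' : forall k, INR k < beta k /\ 0 < s k < 1 /\
    hassum (fun n => exp (- beta k * L0 n) * s k ^ n) (S0 k) /\
    hassum (fun n => exp (- beta k * L1 n) * s k ^ n) (S1 k) /\
    hassum (fun n => INR n * (exp (- beta k * L0 n) * s k ^ n)) (T0 k) /\
    hassum (fun n => INR n * (exp (- beta k * L1 n) * s k ^ n)) (T1 k) /\
    0 < S0 k /\ 0 < S1 k /\ 0 < T0 k /\ 0 < T1 k /\ S0 k * S1 k = 1 /\
    ~ (Rabs (T1 k / (T1 k + S1 k ^ 2 * T0 k) - theta / (theta + W ^ 2)) < delta
       /\ S0 k / T0 k < delta)).
  { intros k. specialize (Hz k). unfold beta, s, S0, S1, T0, T1.
    destruct (z k) as [[[? ?] [? ?]] [? ?]]. exact Hz. }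
  clearbody beta s S0 S1 T0 T1. clear z Hz No.
  assert (Hb : forall k, 0 < beta k).
  { intros k. pose proof (pos_INR k). destruct (Hz' k). lra. }
  assert (Hs : forall k, 0 < s k < 1) by (intros k; apply (Hz' k)).
  assert (Lb : is_lim_seq beta p_infty).
  { apply is_lim_seq_le_p_loc with INR; [|apply is_lim_seq_INR].
    exists 0%nat. intros n _. left. apply (Hz' n). }
  assert (Gk : forall k, hassum (fun n => s k ^ n) (s k / (1 - s k)))
    by (intros; apply hassum_geom, Hs).
  assert (Gn : forall k, hassum (fun n => INR n * s k ^ n) (s k / (1 - s k) / (1 - s k)))
    by (intros; apply hassum_n_geom, Hs).
  set (tau := fun k => 1 - s k).
  assert (Ht : forall k, 0 < tau k) by (intros k; specialize (Hs k); unfold tau; lra).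
  assert (Gb : forall k n, (1 <= n)%nat -> 0 <= s k ^ n <= 1).
  { intros k n _. pose proof (pow_unit (s k) n (Hs k)). lra. }
  assert (Gnb : forall k n, (1 <= n)%nat -> 0 <= INR n * s k ^ n <= / tau k).
  { intros k n _. pose proof (pow_unit (s k) n (Hs k)). pose proof (pos_INR n).
    pose proof (n_pow_bound (s k) n (Hs k)). specialize (Ht k). split; [apply Rmult_le_pos; lra|].
    apply Rmult_le_reg_r with (tau k); [exact Ht|]. rewrite Rinv_l by lra. unfold tau. lra. }
  (* [X0] and [X1] are the rescaled S_0 and S_1; [A0] and [A1] are the rescaled T_0 and T_1 with an
     extra factor 1 - s, as a sum of n s^n exceeds one of s^n by 1 / (1 - s). Up to the errors [e0]
     and [e1], [X0] and [A0] both equal [Y], and the geometric parts of [X1] and [A1] both equal th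
     Y. *)
  set (X0 := fun k => exp (- beta k * m) * S0 k). set (X1 := fun k => exp (beta k * m) * S1 k).
  set (A0 := fun k => tau k * (exp (- beta k * m) * T0 k)).
  set (A1 := fun k => tau k * (exp (beta k * m) * T1 k)).
  set (Y := fun k => exp (- beta k * (H0 + m)) * (s k / (1 - s k))).
  set (th := fun k => exp (- beta k * (H1 - H0 - 2 * m))).
  set (c1 := fun k => 1 - exp (- beta k * (H1 - m))).
  set (e0 := fun k => D0 * (beta k * exp (- beta k * (m0 + m)))).
  set (e1 := fun k => D1 * (beta k * exp (- beta k * (m' - m)))).
  assert (ex : forall u v w, u + v = w -> exp u * exp v = exp w)
    by (intros u v w <-; symmetry; apply exp_plus).
  assert (B0 : forall k, Rabs (X0 k - Y k) <= e0 k).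
  { intros k. destruct (Hz' k) as [_ [_ [Hsum _]]].
    pose proof (weighted_sum_error (fun n => s k ^ n) L0 d0 (beta k) H0 m0 D0 1 (S0 k) _
      (Rlt_le _ _ (Hb k)) Rle_0_1 (Gb k) HL0 Hm0 Hd0 HD0 (Gk k) Hsum) as E.
    replace (X0 k - Y k) with (exp (- beta k * m) * (S0 k - exp (- beta k * H0) * (s k / (1 - s k)))).
    - rewrite Rabs_mult, Rabs_pos_eq by (left; apply exp_pos).
      unfold e0. rewrite <- (ex (- beta k * m) (- beta k * m0) (- beta k * (m0 + m))) by ring.
      pose proof (exp_pos (- beta k * m)). nra.
    - unfold X0, Y. rewrite <- (ex (- beta k * m) (- beta k * H0) (- beta k * (H0 + m))) by ring. ring. }
  assert (B0' : forall k, Rabs (A0 k - Y k) <= e0 k).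
  { intros k. destruct (Hz' k) as [_ [_ [_ [_ [Hsum _]]]]].
    assert (Hsum' : hassum (fun n => exp (- beta k * L0 n) * (INR n * s k ^ n)) (T0 k))
      by (eapply hassum_ext; [|exact Hsum]; intros; simpl; ring).
    pose proof (weighted_sum_error (fun n => INR n * s k ^ n) L0 d0 (beta k) H0 m0 D0 (/ tau k) (T0 k) _
      (Rlt_le _ _ (Hb k)) (Rlt_le _ _ (Rinv_0_lt_compat _ (Ht k))) (Gnb k) HL0 Hm0 Hd0 HD0
      (Gn k) Hsum') as E.
    replace (A0 k - Y k) with (exp (- beta k * m) * tau k *
      (T0 k - exp (- beta k * H0) * (s k / (1 - s k) / (1 - s k)))).
    - rewrite Rabs_mult, Rabs_pos_eq
        by (apply Rmult_le_pos; [left; apply exp_pos|left; apply Ht]).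
      unfold e0. rewrite <- (ex (- beta k * m) (- beta k * m0) (- beta k * (m0 + m))) by ring.
      pose proof (exp_pos (- beta k * m)). pose proof (Ht k).
      apply Rle_trans with (exp (- beta k * m) * tau k *
        (/ tau k * (beta k * D0 * exp (- beta k * m0)))).
      + apply Rmult_le_compat_l; [apply Rmult_le_pos; lra|exact E].
      + right. field. lra.
    - unfold A0, Y. rewrite <- (ex (- beta k * m) (- beta k * H0) (- beta k * (H0 + m))) by ring. unfold tau.
      specialize (Hs k). field. lra. }
  (* The minimal levels are moved up to H1. All levels then stay above m' > m, which makes [e1]
     decay, at the price of an explicit finite sum over l with the factor [c1]. *)
  set (L1' := fun n => if in_dec Nat.eq_dec n l then H1 else L1 n).
  assert (HL1' : forall n, (1 <= n)%nat -> m' <= L1' n).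
  { intros n Ln. unfold L1'. destruct in_dec; auto. }
  assert (Hd1' : forall n, (1 <= n)%nat -> Rabs (L1' n - H1) <= d1 n).
  { intros n Ln. unfold L1'. destruct in_dec; [|auto].
    rewrite Rminus_diag, Rabs_R0. eapply Rle_trans; [apply Rabs_pos|apply (Hd1 n Ln)]. }
  assert (Spl : forall k g U, hassum (fun n => exp (- beta k * L1 n) * g n) U ->
    hassum (fun n => exp (- beta k * L1' n) * g n)
      (U - (exp (- beta k * m) - exp (- beta k * H1)) * lsum l g)).
  { intros k g U HU.
    eapply hassum_ext; [|apply (hassum_minus _ _ _ _ HU
      (hassum_scal (exp (- beta k * m) - exp (- beta k * H1)) _ _
         (hassum_list l g ND (fun n I => proj1 (Hl n I)))))].
    intros n Ln. simpl. unfold L1'. destruct in_dec as [I|I]; [|ring].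
    rewrite (proj2 (Hl n I)). ring. }
  assert (c1E : forall k, exp (beta k * m) * (exp (- beta k * m) - exp (- beta k * H1)) = c1 k).
  { intros k. rewrite Rmult_minus_distr_l. unfold c1. f_equal.
    - rewrite (ex _ _ 0) by ring. apply exp_0.
    - rewrite (ex _ _ (- beta k * (H1 - m))) by ring. reflexivity. }
  assert (thY : forall k, th k * Y k = exp (beta k * m) * (exp (- beta k * H1) * (s k / (1 - s k)))).
  { intros k. unfold th, Y. rewrite <- !Rmult_assoc, !(ex _ _ (beta k * m + - beta k * H1)) by ring.
    reflexivity. }
  assert (B1 : forall k, Rabs (X1 k - (c1 k * lsum l (fun n => s k ^ n) + th k * Y k)) <= e1 k).
  { intros k. destruct (Hz' k) as [_ [_ [_ [Hsum _]]]].
    pose proof (weighted_sum_error (fun n => s k ^ n) L1' d1 (beta k) H1 m' D1 1 _ _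
      (Rlt_le _ _ (Hb k)) Rle_0_1 (Gb k) HL1' Hm' Hd1' HD1 (Gk k) (Spl k (fun n => s k ^ n) _ Hsum)) as E.
    match type of E with Rabs ?e <= _ =>
      replace (X1 k - (c1 k * lsum l (fun n => s k ^ n) + th k * Y k))
        with (exp (beta k * m) * e) end.
    - rewrite Rabs_mult, Rabs_pos_eq by (left; apply exp_pos).
      unfold e1. rewrite <- (ex (beta k * m) (- beta k * m') (- beta k * (m' - m))) by ring.
      pose proof (exp_pos (beta k * m)). nra.
    - unfold X1. rewrite thY, <- (c1E k). ring. }
  assert (B1' : forall k, Rabs (A1 k - (tau k * (c1 k * lsum l (fun n => INR n * s k ^ n))
                                        + th k * Y k)) <= e1 k).
  { intros k. destruct (Hz' k) as [_ [_ [_ [_ [_ [Hsum _]]]]]].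
    assert (Hsum' : hassum (fun n => exp (- beta k * L1 n) * (INR n * s k ^ n)) (T1 k))
      by (eapply hassum_ext; [|exact Hsum]; intros; simpl; ring).
    pose proof (weighted_sum_error (fun n => INR n * s k ^ n) L1' d1 (beta k) H1 m' D1 (/ tau k) _ _
      (Rlt_le _ _ (Hb k)) (Rlt_le _ _ (Rinv_0_lt_compat _ (Ht k))) (Gnb k) HL1' Hm' Hd1' HD1
      (Gn k) (Spl k (fun n => INR n * s k ^ n) _ Hsum')) as E.
    match type of E with Rabs ?e <= _ =>
      replace (A1 k - _) with (exp (beta k * m) * tau k * e) end.
    - rewrite Rabs_mult, Rabs_pos_eq
        by (apply Rmult_le_pos; [left; apply exp_pos|left; apply Ht]).
      unfold e1. rewrite <- (ex (beta k * m) (- beta k * m') (- beta k * (m' - m))) by ring.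
      pose proof (exp_pos (beta k * m)). pose proof (Ht k).
      apply Rle_trans with (exp (beta k * m) * tau k *
        (/ tau k * (beta k * D1 * exp (- beta k * m')))).
      + apply Rmult_le_compat_l; [apply Rmult_le_pos; lra|exact E].
      + right. field. lra.
    - unfold A1. rewrite thY, <- c1E. unfold tau. specialize (Hs k). field. lra. }
  assert (XX : forall k, X0 k * X1 k = 1).
  { intros k. unfold X0, X1.
    replace (exp (- beta k * m) * S0 k * (exp (beta k * m) * S1 k))
      with ((exp (- beta k * m) * exp (beta k * m)) * (S0 k * S1 k)) by ring.
    rewrite (ex _ _ 0), exp_0 by ring.
    replace (S0 k * S1 k) with 1 by (symmetry; apply (Hz' k)). ring. }
  assert (X0p : forall k, 0 < X0 k)
    by (intros k; apply Rmult_lt_0_compat; [apply exp_pos|apply (Hz' k)]).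
  assert (X1p : forall k, 0 < X1 k)
    by (intros k; apply Rmult_lt_0_compat; [apply exp_pos|apply (Hz' k)]).
  assert (Le0 : is_lim_seq e0 0).
  { replace 0 with (D0 * 0) by ring. apply (is_lim_seq_scal_l _ D0 0), beta_exp_lim; auto. }
  assert (Le1 : is_lim_seq e1 0).
  { replace 0 with (D1 * 0) by ring. apply (is_lim_seq_scal_l _ D1 0), beta_exp_lim; auto; lra. }
  assert (Lth : is_lim_seq th theta).
  { destruct Hth as [[E ->]|[G [-> _]]].
    - apply is_lim_seq_ext with (fun _ => 1); [|apply is_lim_seq_const].
      intros k. unfold th. rewrite E, Rmult_0_r, exp_0. reflexivity.
    - apply exp_lim; assumption. }
  assert (Lc1 : is_lim_seq c1 1).
  { replace 1 with (1 - 0) by ring. apply is_lim_seq_minus'; [apply is_lim_seq_const|].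
    apply exp_lim; auto; lra. }
  assert (HL1m : forall n, (1 <= n)%nat -> m <= L1 n).
  { intros n Ln. destruct (in_dec Nat.eq_dec n l) as [I|I].
    - rewrite (proj2 (Hl n I)). lra.
    - specialize (HL1 n Ln I). lra. }
  (* Since (1 - s) S_0 <= exp(-beta m0) and (1 - s) S_1 <= exp(-beta m), the equation S_0 S_1 = 1
     yields (1 - s)^2 <= exp(-beta (m0 + m)). *)
  assert (Bt : forall k, tau k <= exp (- beta k * ((m0 + m) / 2))).
  { intros k. destruct (Hz' k) as [_ [_ [Hs0 [Hs1 [_ [_ [P0 [P1 [_ [_ [E _]]]]]]]]]]].
    assert (U : forall L mm S, (forall n, (1 <= n)%nat -> mm <= L n) ->
      hassum (fun n => exp (- beta k * L n) * s k ^ n) S -> tau k * S <= exp (- beta k * mm)).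
    { intros L mm S HL HS.
      assert (S <= exp (- beta k * mm) * (s k / (1 - s k))).
      { apply (hassum_le _ _ _ _ ) with (2 := HS) (3 := hassum_scal (exp (- beta k * mm)) _ _ (Gk k)).
        intros n Ln. apply Rmult_le_compat_r; [apply Gb, Ln|]. apply exp_le_compat.
        specialize (HL n Ln). specialize (Hb k). nra. }
      apply Rle_trans with (tau k * (exp (- beta k * mm) * (s k / (1 - s k)))).
      - apply Rmult_le_compat_l; [left; apply Ht|assumption].
      - replace (tau k * (exp (- beta k * mm) * (s k / (1 - s k))))
          with (exp (- beta k * mm) * s k)
          by (unfold tau; specialize (Hs k); field; lra).
        specialize (Hs k). pose proof (exp_pos (- beta k * mm)). nra. }
    pose proof (U L0 m0 (S0 k) HL0 Hs0) as U0. pose proof (U L1 m (S1 k) HL1m Hs1) as U1.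
    specialize (Ht k). set (E2 := exp (- beta k * ((m0 + m) / 2))).
    assert (EE : E2 * E2 = exp (- beta k * m0) * exp (- beta k * m)).
    { unfold E2. rewrite <- !exp_plus. f_equal. field. }
    assert (tau k * S0 k * (tau k * S1 k) <= E2 * E2).
    { rewrite EE. apply Rmult_le_compat; auto; apply Rmult_le_pos; lra. }
    replace (tau k * S0 k * (tau k * S1 k)) with (tau k * tau k * (S0 k * S1 k)) in * by ring.
    rewrite E in *. assert (0 < E2) by apply exp_pos. nra. }
  assert (Lt : is_lim_seq tau 0).
  { apply is_lim_seq_le_le with (fun _ => 0) (fun k => exp (- beta k * ((m0 + m) / 2))).
    - intros k. specialize (Ht k). specialize (Bt k). lra.
    - apply is_lim_seq_const.
    - apply exp_lim; auto; lra. }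
  assert (Ls : forall n, is_lim_seq (fun k => s k ^ n) 1).
  { assert (Ls1 : is_lim_seq s 1).
    { apply is_lim_seq_ext with (fun k => 1 - tau k); [intros; unfold tau; ring|].
      replace (Finite 1) with (Finite (1 - 0)) by (f_equal; ring).
      apply is_lim_seq_minus'; [apply is_lim_seq_const|exact Lt]. }
    induction n as [|n IH]; simpl; [apply is_lim_seq_const|].
    replace 1 with (1 * 1) by ring. apply is_lim_seq_mult'; assumption. }
  (* Subtracting th [X0] removes the geometric part of [X1], whose size is not yet known; what is
     left is the finite sum, which tends to the number of minimal levels. *)
  set (k' := fun k => X1 k - th k * X0 k).
  assert (Lk' : is_lim_seq k' kap).
  { apply lim_near with (v := fun k => c1 k * lsum l (fun n => s k ^ n)) (e := fun k => e1 k + th k * e0 k).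
    - intros k. unfold k'. specialize (B0 k). specialize (B1 k).
      replace (X1 k - th k * X0 k - c1 k * lsum l (fun n => s k ^ n))
        with ((X1 k - (c1 k * lsum l (fun n => s k ^ n) + th k * Y k)) - th k * (X0 k - Y k)) by ring.
      assert (0 < th k) by apply exp_pos.
      eapply Rle_trans; [apply Rabs_triang|]. rewrite Rabs_Ropp, Rabs_mult, (Rabs_pos_eq (th k)) by lra.
      apply Rplus_le_compat; [exact B1|]. apply Rmult_le_compat_l; [lra|exact B0].
    - replace 0 with (0 + theta * 0) by ring. apply is_lim_seq_plus'; auto.
      apply is_lim_seq_mult'; auto.
    - replace kap with (1 * lsum l (fun _ => 1)) by (rewrite lsum_one; unfold kap; ring).
      apply is_lim_seq_mult'; [exact Lc1|]. apply (lim_lsum l (fun k n => s k ^ n)). exact Ls. }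
  (* From X0 X1 = 1, [X1] solves X^2 = k' X + th, and it is the positive root because k'^2 + 4 th =
     (X1 + th X0)^2. *)
  assert (X1E : forall k, X1 k = (k' k + sqrt (k' k ^ 2 + 4 * th k)) / 2).
  { intros k. specialize (XX k). specialize (X0p k). specialize (X1p k).
    assert (Tp : 0 < th k) by apply exp_pos.
    assert (Tx : 0 < th k * X0 k) by (apply Rmult_lt_0_compat; lra).
    replace (k' k ^ 2 + 4 * th k) with ((X1 k + th k * X0 k) ^ 2).
    - rewrite sqrt_pow2 by lra. unfold k'. field.
    - replace (4 * th k) with (4 * th k * (X0 k * X1 k)) by (rewrite XX; ring).
      unfold k'. ring. }
  assert (Hth0 : 0 <= theta) by (destruct Hth as [[_ ->]|[_ [-> _]]]; lra).
  assert (LX1 : is_lim_seq X1 W).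
  { apply is_lim_seq_ext with (fun k => (k' k + sqrt (k' k ^ 2 + 4 * th k)) / 2);
      [intros; symmetry; apply X1E|].
    unfold W. apply is_lim_seq_div'; [|apply is_lim_seq_const|lra].
    apply is_lim_seq_plus'; [exact Lk'|].
    apply (is_lim_seq_continuous sqrt).
    - apply continuity_pt_sqrt. pose proof (pow2_ge_0 kap). lra.
    - apply is_lim_seq_plus'.
      + apply is_lim_seq_ext with (fun k => k' k * k' k); [intros; ring|].
        replace (kap ^ 2) with (kap * kap) by ring. apply is_lim_seq_mult'; exact Lk'.
      + apply (is_lim_seq_scal_l _ 4 theta), Lth. }
  assert (Wp : 0 < W).
  { unfold W. assert (0 <= kap) by apply pos_INR.
    pose proof (sqrt_pos (kap ^ 2 + 4 * theta)).
    destruct Hth as [[_ ->]|[_ [_ Lk]]].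
    - assert (0 < sqrt (kap ^ 2 + 4 * 1)) by (apply sqrt_lt_R0; nra). lra.
    - assert (1 <= kap) by (apply (le_INR 1), Lk). lra. }
  clearbody W.
  assert (LX0 : is_lim_seq X0 (/ W)).
  { apply is_lim_seq_ext with (fun k => 1 / X1 k).
    - intros k. specialize (XX k). specialize (X1p k).
      apply Rmult_eq_reg_r with (X1 k); [|lra]. rewrite XX. field. lra.
    - replace (/ W) with (1 / W) by (field; lra).
      apply is_lim_seq_div'; [apply is_lim_seq_const|exact LX1|lra]. }
  assert (LY : is_lim_seq Y (/ W)).
  { apply lim_near with (v := X0) (e := e0); auto. intros k. rewrite Rabs_minus_sym. apply B0. }
  assert (LA0 : is_lim_seq A0 (/ W)) by (apply lim_near with (v := Y) (e := e0); auto).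
  (* In T_1 the finitely many minimal levels carry no factor 1 / (1 - s), so tau removes them and
     only the geometric part th Y survives. *)
  assert (LA1 : is_lim_seq A1 (theta * / W)).
  { apply lim_near with (1 := B1') (2 := Le1).
    replace (theta * / W) with (0 * (1 * lsum l (fun n => INR n * 1)) + theta * / W) by ring.
    apply is_lim_seq_plus'; [|apply is_lim_seq_mult'; assumption].
    apply is_lim_seq_mult'; [exact Lt|]. apply is_lim_seq_mult'; [exact Lc1|].
    apply (lim_lsum l (fun k n => INR n * s k ^ n)). intros n.
    apply (is_lim_seq_scal_l _ (INR n) 1), Ls. }
  assert (iW : 0 < / W) by (apply Rinv_0_lt_compat; exact Wp).
  assert (Lim1 : is_lim_seq (fun k => T1 k / (T1 k + S1 k ^ 2 * T0 k)) (theta / (theta + W ^ 2))).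
  { apply is_lim_seq_ext with (fun k => A1 k / (A1 k + X1 k * X1 k * A0 k)).
    - intros k. destruct (Hz' k) as [_ [_ [_ [_ [_ [_ [P0 [P1 [Q0 [Q1 _]]]]]]]]]].
      unfold A1, X1, A0. set (E := exp (beta k * m)).
      replace (exp (- beta k * m)) with (/ E)
        by (unfold E; rewrite <- exp_Ropp; f_equal; ring).
      assert (0 < E) by apply exp_pos. specialize (Ht k).
      assert (0 < S1 k ^ 2 * T0 k) by (apply Rmult_lt_0_compat; [apply pow_lt|]; lra).
      assert (0 < tau k * (E * T1 k)) by (repeat apply Rmult_lt_0_compat; lra).
      assert (0 < E * S1 k * (E * S1 k) * (tau k * (/ E * T0 k)))
        by (pose proof (Rinv_0_lt_compat E); repeat apply Rmult_lt_0_compat; auto; lra).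
      assert (0 < S1 k * (E * S1 k) * (tau k * T0 k)) by (repeat apply Rmult_lt_0_compat; lra).
      field. repeat split; lra.
    - replace (theta / (theta + W ^ 2)) with ((theta * / W) / (theta * / W + W * W * / W))
        by (assert (0 < W * W) by nra; field; simpl; repeat split; lra).
      assert (0 < W * W * / W) by (repeat apply Rmult_lt_0_compat; lra).
      assert (0 <= theta * / W) by (apply Rmult_le_pos; lra).
      apply is_lim_seq_div'; [exact LA1| |lra].
      apply is_lim_seq_plus'; [exact LA1|]. apply is_lim_seq_mult'; [|exact LA0].
      apply is_lim_seq_mult'; exact LX1. }
  assert (Lim2 : is_lim_seq (fun k => S0 k / T0 k) 0).
  { apply is_lim_seq_ext with (fun k => tau k * (X0 k / A0 k)).
    - intros k. destruct (Hz' k) as [_ [_ [_ [_ [_ [_ [P0 [P1 [Q0 [Q1 _]]]]]]]]]].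
      unfold X0, A0. specialize (Ht k). pose proof (exp_pos (- beta k * m)). field.
      repeat split; lra.
    - replace 0 with (0 * (/ W / / W)) by ring. apply is_lim_seq_mult'; [exact Lt|].
      apply is_lim_seq_div'; auto. lra. }
  apply is_lim_seq_spec in Lim1, Lim2.
  destruct (Lim1 (mkposreal delta Hdelta)) as [N1 HN1].
  destruct (Lim2 (mkposreal delta Hdelta)) as [N2 HN2].
  set (N := (N1 + N2)%nat). specialize (HN1 N ltac:(unfold N; lia)).
  specialize (HN2 N ltac:(unfold N; lia)). simpl in HN1, HN2.
  destruct (Hz' N) as [_ [_ [_ [_ [_ [_ [_ [_ [_ [_ [_ C]]]]]]]]]]]. apply C.
  split; [exact HN1|]. apply Rabs_def2 in HN2. lra.
Qed.

(** * Selection for double-well potentials *)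

Lemma summable_to_zero (d : nat -> R) (D eps : R) :
  (forall n, (1 <= n)%nat -> 0 <= d n) -> (forall N, psum d N <= D) -> 0 < eps ->
  exists N, forall n, (N <= n)%nat -> (1 <= n)%nat -> d n < eps.
Proof.
  intros Pos B He. destruct (hassum_exists d D Pos B) as [l HS].
  apply is_lim_seq_spec in HS. destruct (HS (mkposreal (eps / 2) ltac:(lra))) as [N HN].
  exists (S N). intros n L _. destruct n as [|n]; [lia|].
  pose proof (HN n ltac:(lia)) as A. pose proof (HN (S n) ltac:(lia)) as A'.
  simpl in A, A'. apply Rabs_def2 in A, A'. lra.
Qed.

(* The n-th level is off its limit by the n-th tail of [a], and summing these tails counts
   each [a k] exactly k times. *)
Lemma level_error (b a : nat -> R) (h : R) :
  (forall n, (1 <= n)%nat -> 0 <= a n) -> summable (fun n => INR n * a n) ->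
  tail_summable b -> is_Hinf b a h ->
  exists d D, (forall n, (1 <= n)%nat -> Rabs (Hn b a n - h) <= d n) /\ forall N, psum d N <= D.
Proof.
  intros Pos [_ [M HM]] [w [[_ [Mw HMw]] Hw]] [lb [sa [Lb [Sa ->]]]].
  apply is_lim_seq_Reals in Lb, Sa.
  exists (fun n => w n + (sa - psum a (n - 1))), (Mw + M). split.
  - intros n L. unfold Hn.
    assert (A : Rabs (b n - lb) <= w n).
    { assert (Lim : is_lim_seq (fun k => Rabs (b n - b (n + k)%nat)) (Rabs (b n - lb))).
      { apply (is_lim_seq_abs _ (b n - lb)). apply is_lim_seq_minus'; [apply is_lim_seq_const|].
        apply is_lim_seq_ext with (fun k => b (k + n)%nat); [intros; f_equal; lia|].
        apply (is_lim_seq_incr_n b n), Lb. }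
      apply (lim_le_const _ _ _ Lim). intros k. apply Hw, L. }
    pose proof (psum_le_sum a sa (n - 1) Pos Sa).
    replace (b n + psum a (n - 1) - (lb + sa)) with ((b n - lb) + - (sa - psum a (n - 1))) by ring.
    eapply Rle_trans; [apply Rabs_triang|]. rewrite Rabs_Ropp, (Rabs_pos_eq (sa - _)); lra.
  - intros N. rewrite psum_plus. apply Rplus_le_compat; [apply HMw|].
    assert (E : psum (fun n => sa - psum a (n - 1)) N
                = psum (fun n => INR n * a n) N + INR N * (sa - psum a N)).
    { induction N as [|N IH]; [simpl; ring|]. cbn [psum]. rewrite IH.
      replace (S N - 1)%nat with N by lia. rewrite S_INR. ring. }
    rewrite E.
    (* The tail of a beyond N is approached by finite pieces, in which N a_k <= k a_k; the whole is
       then a partial sum of k a_k. *)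
    assert (Lim : is_lim_seq (fun k => psum (fun n => INR n * a n) N
                                       + INR N * (psum a (k + N)%nat - psum a N))
                    (psum (fun n => INR n * a n) N + INR N * (sa - psum a N))).
    { apply is_lim_seq_plus'; [apply is_lim_seq_const|].
      apply (is_lim_seq_scal_l _ (INR N) (sa - psum a N)).
      apply is_lim_seq_minus'; [|apply is_lim_seq_const].
      apply (is_lim_seq_incr_n (psum a) N), Sa. }
    apply (lim_le_const _ _ _ Lim). intros k.
    apply Rle_trans with (psum (fun n => INR n * a n) (k + N)); [|apply HM].
    induction k as [|k IH]; [simpl; lra|]. change (S k + N)%nat with (S (k + N)). cbn [psum].
    assert (INR N * a (S (k + N)) <= INR (S (k + N)) * a (S (k + N))).
    { apply Rmult_le_compat_r; [apply Pos; lia|apply le_INR; lia]. }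
    lra.
Qed.

(** The values converge to h > m, so only finitely many indices lie below (m + h) / 2. Among these
    the value m is attained on a finite list, and the others leave a positive gap. *)
Lemma level_set (u d : nat -> R) (m h D : R) :
  (forall n, (1 <= n)%nat -> Rabs (u n - h) <= d n) -> (forall N, psum d N <= D) ->
  (forall n, (1 <= n)%nat -> m <= u n) -> m < h ->
  exists l m', NoDup l /\ (forall n, In n l <-> (1 <= n)%nat /\ u n = m) /\ m < m' <= h /\
    forall n, (1 <= n)%nat -> ~ In n l -> m' <= u n.
Proof.
  intros Hd HD Hm Hh.
  destruct (summable_to_zero d D ((h - m) / 2)) as [N HN]; [|exact HD|lra|].
  { intros n L. eapply Rle_trans; [apply Rabs_pos|apply (Hd n L)]. }
  assert (Far : forall n, (N <= n)%nat -> (1 <= n)%nat -> (m + h) / 2 <= u n).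
  { intros n L1 L2. specialize (HN n L1 L2). specialize (Hd n L2).
    apply Rabs_le_between in Hd. lra. }
  assert (Near : forall K, exists m', m < m' <= (m + h) / 2 /\
    forall n, (1 <= n < K)%nat -> u n <> m -> m' <= u n).
  { induction K as [|K [m1 [B1 IH]]].
    - exists ((m + h) / 2). split; [lra|]. intros; lia.
    - destruct (Req_EM_T (u K) m) as [E|E].
      + exists m1. split; [exact B1|]. intros n L Ne. apply IH; [|exact Ne].
        assert (n <> K) by congruence. lia.
      + destruct (le_dec 1 K) as [LK|LK].
        * exists (Rmin m1 (u K)). specialize (Hm K LK). split.
          { split; [apply Rmin_glb_lt; lra|]. eapply Rle_trans; [apply Rmin_l|lra]. }
          intros n L Ne. destruct (Nat.eq_dec n K) as [->|NK]; [apply Rmin_r|].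
          eapply Rle_trans; [apply Rmin_l|]. apply IH; [lia|exact Ne].
        * exists m1. split; [exact B1|]. intros; lia. }
  destruct (Near N) as [m' [B Hm']].
  exists (filter (fun n => if Req_EM_T (u n) m then true else false) (seq 1 N)), m'.
  assert (I : forall n, In n (filter (fun n => if Req_EM_T (u n) m then true else false) (seq 1 N))
                        <-> (1 <= n)%nat /\ u n = m).
  { intros n. rewrite filter_In, in_seq. destruct (Req_EM_T (u n) m) as [E|E].
    - split; [intros; split; [lia|exact E]|]. intros [L _]. split; [|reflexivity].
      split; [exact L|]. destruct (le_lt_dec N n) as [L'|L']; [|lia].
      specialize (Far n L' L). lra.
    - split; [intros [_ C]; discriminate C|tauto]. }
  split; [apply NoDup_filter, seq_NoDup|]. split; [exact I|]. split; [lra|].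
  intros n L NI. destruct (le_lt_dec N n) as [L'|L'].
  - specialize (Far n L' L). lra.
  - apply Hm'; [lia|]. intros E. apply NI, I. auto.
Qed.

Lemma double_well_block (H : Sigma -> R) (a0 a1 b0 b1 : nat -> R) :
  double_well H a0 a1 b0 b1 ->
  block_potential H (fun i : bool => if i then a1 else a0) (fun i : bool => if i then b1 else b0).
Proof.
  intros [CH [Pos [_ [Sgn [E1 [E2 [E3 [E4 [S0 [S1 _]]]]]]]]]].
  assert (HA : forall (i : bool) n x, (1 <= n)%nat -> run i n x = true ->
            H (scons i x) = (if i then a1 else a0) n).
  { intros i n x L A. apply run_spec in A. destruct A as [A1 A2].
    destruct i; [apply E2|apply E1]; auto; (split; [|exact A2]); intros [|j] J; simpl; auto;
      apply A1; lia. }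
  assert (HB : forall (i : bool) n x, (1 <= n)%nat -> run (negb i) n x = true ->
            H (scons i x) = (if i then b1 else b0) n).
  { intros i n x L A. apply run_spec in A. destruct A as [A1 A2].
    destruct i; [apply E4|apply E3]; auto; (split; [reflexivity|]); (split; [|exact A2]);
      intros [|j] J; try lia; apply A1; lia. }
  split; [exact CH|]. split; [exact Pos|]. split; [|split; [|split; [exact HA|exact HB]]].
  (* The fixed point is approximated by i^(n+1) followed by the other letter, where the potential is
     a_n <= n a_n, which is small for large n. *)
  - intros i. apply cond_eq. intros eps He. rewrite Rminus_0_r.
    assert (Sa : exists M, forall N, psum (fun n => INR n * (if i then a1 else a0) n) N <= M).
    { destruct i; [apply S1|apply S0]. }
    destruct Sa as [M HM].
    assert (Ap : forall n, (1 <= n)%nat -> 0 <= (if i then a1 else a0) n).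
    { intros n L. destruct i; apply (Sgn n L). }
    destruct (summable_to_zero (fun n => INR n * (if i then a1 else a0) n) M (eps / 2))
      as [N HN]; [|exact HM|lra|].
    { intros n L. apply Rmult_le_pos; [apply pos_INR|apply Ap, L]. }
    destruct (CH (const_pt i) (eps / 2)) as [K HK]; [lra|].
    set (n := (N + K + 1)%nat).
    specialize (HN n ltac:(unfold n; lia) ltac:(unfold n; lia)).
    specialize (HK (scons i (run_pt i n))).
    rewrite (HA i n (run_pt i n)) in HK by (unfold n in *; try lia; apply run_run_pt).
    specialize (Ap n ltac:(unfold n; lia)).
    assert (1 <= INR n) by (apply (le_INR 1); unfold n; lia).
    assert (Ag : agree K (const_pt i) (scons i (run_pt i n))).
    { intros [|j] J; simpl; [reflexivity|]. unfold run_pt, const_pt.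
      destruct (Nat.ltb_spec j n); [reflexivity|]. unfold n in *. lia. }
    specialize (HK Ag). apply Rabs_def2 in HK. apply Rabs_def1; nra.
  - intros i n L. specialize (Sgn n L). destruct i; lra.
Qed.

Lemma level_lim_ge (u d : nat -> R) (m h D : R) :
  (forall n, (1 <= n)%nat -> Rabs (u n - h) <= d n) -> (forall N, psum d N <= D) ->
  (forall n, (1 <= n)%nat -> m <= u n) -> m <= h.
Proof.
  intros Hd HD Hm. apply Rnot_lt_le. intros L.
  destruct (summable_to_zero d D (m - h)) as [N HN]; [|exact HD|lra|].
  { intros n Ln. eapply Rle_trans; [apply Rabs_pos|apply (Hd n Ln)]. }
  specialize (HN (S N) ltac:(lia) ltac:(lia)). specialize (Hd (S N) ltac:(lia)).
  specialize (Hm (S N) ltac:(lia)). apply Rabs_le_between in Hd. lra.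
Qed.

(** Combines the asymptotics of the sums with the concentration at the two fixed points; the same
    delta controls the mass of [0] and the masses of all runs. *)
Lemma gibbs_limit (H : Sigma -> R) (a0 a1 b0 b1 : nat -> R) (Hinf0 Hinf1 m0 m m' theta : R)
    (l : list nat) :
  double_well H a0 a1 b0 b1 -> is_Hinf b0 a1 Hinf0 -> is_Hinf b1 a0 Hinf1 ->
  (forall n, (1 <= n)%nat -> m0 <= Hn b0 a1 n) ->
  NoDup l -> (forall n, In n l -> (1 <= n)%nat /\ Hn b1 a0 n = m) ->
  (forall n, (1 <= n)%nat -> ~ In n l -> m' <= Hn b1 a0 n) -> m < m' <= Hinf1 ->
  0 < m0 + m ->
  (Hinf1 - Hinf0 - 2 * m = 0 /\ theta = 1 \/
   0 < Hinf1 - Hinf0 - 2 * m /\ theta = 0 /\ (1 <= length l)%nat) ->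
  let w := theta / (theta + ((INR (length l) + sqrt (INR (length l) ^ 2 + 4 * theta)) / 2) ^ 2) in
  gibbs_converges H (fun f => w * f zero_inf + (1 - w) * f one_inf).
Proof.
  intros DW I0 I1 Hm0 ND Hl HL Hm' Hpos Hth w f Cf eps He.
  destruct (close_to_fixed_points f w eps Cf He) as [delta [Hd Close]].
  pose proof DW as [_ [_ [_ [Sgn [_ [_ [_ [_ [Sa0 [Sa1 [Tb0 Tb1]]]]]]]]]]].
  destruct (level_error b0 a1 Hinf0 (fun n L => proj1 (proj2 (Sgn n L))) Sa1 Tb0 I0)
    as [d0 [D0 [E0 B0]]].
  destruct (level_error b1 a0 Hinf1 (fun n L => proj1 (Sgn n L)) Sa0 Tb1 I1) as [d1 [D1 [E1 B1]]].
  destruct (mass_limit (Hn b0 a1) (Hn b1 a0) d0 d1 Hinf0 Hinf1 m0 m m' D0 D1 theta l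
    Hm0 (level_lim_ge _ _ _ _ _ E0 B0 Hm0) E0 B0 ND Hl HL (proj1 Hm') (proj2 Hm') E1 B1 Hpos Hth
    delta Hd) as [B HB].
  exists (Rmax B 0). intros beta mu Lb G.
  assert (B < beta) by (eapply Rle_lt_trans; [apply Rmax_l|exact Lb]).
  assert (0 < beta) by (eapply Rle_lt_trans; [apply Rmax_r|exact Lb]).
  destruct (gibbs_masses H _ _ beta mu (double_well_block _ _ _ _ _ DW) ltac:(assumption) G)
    as [P [s [S [T [Hs [Sums [ST [Mass Runs]]]]]]]].
  destruct (Sums false) as [SF [TF [PSF PTF]]]. destruct (Sums true) as [ST' [TT [PST PTT]]].
  destruct (HB beta s (S false) (S true) (T false) (T true)) as [C1 C2]; auto.
  apply (Close mu P).
  - rewrite Mass. exact C1.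
  - intros i n L. eapply Rle_lt_trans; [apply (Runs i n L false)|exact C2].
Qed.

Lemma gibbs_converges_ext (H : Sigma -> R) (t t' : (Sigma -> R) -> R) :
  (forall f, t f = t' f) -> gibbs_converges H t -> gibbs_converges H t'.
Proof.
  intros E G f Cf eps He. destruct (G f Cf eps He) as [B HB]. exists B.
  intros beta mu L I. rewrite <- E. exact (HB beta mu L I).
Qed.

Lemma levels_pos (H : Sigma -> R) (a0 a1 b0 b1 : nat -> R) (n : nat) :
  double_well H a0 a1 b0 b1 -> (1 <= n)%nat -> 0 < Hn b0 a1 n /\ 0 < Hn b1 a0 n.
Proof.
  intros [_ [_ [_ [Sgn _]]]] L. unfold Hn. pose proof (Sgn n L).
  pose proof (psum_nonneg a0 (n - 1) (fun k Lk => proj1 (Sgn k Lk))).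
  pose proof (psum_nonneg a1 (n - 1) (fun k Lk => proj1 (proj2 (Sgn k Lk)))). lra.
Qed.

(** Here m = Hmin_1, and the assumption says Hinf_1 - Hinf_0 - 2 m > 0, so theta = 0. As Hmin_1 <
    Hinf_1 the infimum is attained, otherwise [level_set] would leave a gap above it; being a level
    it is positive, and m0 = 0 will do. *)
Lemma selection_of_one (H : Sigma -> R) (a0 a1 b0 b1 : nat -> R) (Hinf0 Hinf1 Hmin1 : R) :
  double_well H a0 a1 b0 b1 -> is_Hinf b0 a1 Hinf0 -> is_Hinf b1 a0 Hinf1 ->
  is_inf_n1 (Hn b1 a0) Hmin1 -> / 2 * (Hinf1 + Hinf0) > Hmin1 + Hinf0 ->
  gibbs_converges H (fun f => f one_inf).
Proof.
  intros DW I0 I1 [Hmin Hglb] Gap.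
  pose proof DW as [_ [_ [_ [Sgn [_ [_ [_ [_ [Sa0 [Sa1 [Tb0 Tb1]]]]]]]]]]].
  destruct (level_error b0 a1 Hinf0 (fun n L => proj1 (proj2 (Sgn n L))) Sa1 Tb0 I0)
    as [d0 [D0 [E0 B0]]].
  destruct (level_error b1 a0 Hinf1 (fun n L => proj1 (Sgn n L)) Sa0 Tb1 I1) as [d1 [D1 [E1 B1]]].
  assert (P0 : forall n, (1 <= n)%nat -> 0 <= Hn b0 a1 n)
    by (intros n L; left; apply (levels_pos H a0 a1 b0 b1 n DW L)).
  pose proof (level_lim_ge _ _ _ _ _ E0 B0 P0).
  assert (0 <= Hmin1) by (apply Hglb; intros n L; left; apply (levels_pos H a0 a1 b0 b1 n DW L)).
  destruct (level_set _ _ Hmin1 Hinf1 _ E1 B1 Hmin) as [l [m' [ND [Hl [Hm' HL]]]]]; [lra|].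
  destruct l as [|n l].
  { exfalso. assert (m' <= Hmin1); [|lra].
    apply Hglb. intros n L. apply HL; [exact L|intros []]. }
  assert (Hmp : 0 < Hmin1).
  { destruct (proj1 (Hl n) (or_introl eq_refl)) as [L <-].
    apply (levels_pos H a0 a1 b0 b1 n DW L). }
  eapply gibbs_converges_ext;
    [|apply (gibbs_limit H a0 a1 b0 b1 Hinf0 Hinf1 0 Hmin1 m' 0 (n :: l) DW I0 I1 P0 ND)].
  - intros f. simpl. unfold Rdiv. rewrite !Rmult_0_l. ring.
  - intros k I. apply Hl, I.
  - exact HL.
  - exact Hm'.
  - lra.
  - right. simpl length. repeat split; [lra|lia].
Qed.

(** Here m = (Hinf_1 - Hinf_0) / 2, so theta = 1 and the levels equal to m are the coincidences
    counted by kappa. The list may be empty. *)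
Lemma selection_of_mixture (H : Sigma -> R) (a0 a1 b0 b1 : nat -> R) (Hinf0 Hinf1 Hmin1 : R)
    (kappa : nat) :
  double_well H a0 a1 b0 b1 -> is_Hinf b0 a1 Hinf0 -> is_Hinf b1 a0 Hinf1 ->
  is_inf_n1 (Hn b1 a0) Hmin1 -> Hinf0 <= Hinf1 ->
  has_card (fun n => (1 <= n)%nat /\ / 2 * (Hinf1 + Hinf0) = Hn b1 a0 n + Hinf0) kappa ->
  Hmin1 + Hinf0 >= / 2 * (Hinf1 + Hinf0) -> / 2 * (Hinf1 + Hinf0) > 0 ->
  gibbs_converges H (fun f => / (1 + c_of kappa ^ 2) * f zero_inf
                            + c_of kappa ^ 2 / (1 + c_of kappa ^ 2) * f one_inf).
Proof.
  intros DW I0 I1 [Hmin Hglb] Le [lk [NDk [Hk Lenk]]] Gap Hpos.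
  pose proof DW as [_ [_ [_ [Sgn [_ [_ [_ [_ [Sa0 [Sa1 [Tb0 Tb1]]]]]]]]]]].
  destruct (level_error b0 a1 Hinf0 (fun n L => proj1 (proj2 (Sgn n L))) Sa1 Tb0 I0)
    as [d0 [D0 [E0 B0]]].
  destruct (level_error b1 a0 Hinf1 (fun n L => proj1 (Sgn n L)) Sa0 Tb1 I1) as [d1 [D1 [E1 B1]]].
  assert (P0 : forall n, (1 <= n)%nat -> 0 <= Hn b0 a1 n)
    by (intros n L; left; apply (levels_pos H a0 a1 b0 b1 n DW L)).
  set (g := (Hinf1 - Hinf0) / 2).
  assert (Hg : forall n, (1 <= n)%nat -> g <= Hn b1 a0 n)
    by (intros n L; specialize (Hmin n L); unfold g; lra).
  destruct (level_set _ _ g Hinf1 _ E1 B1 Hg) as [l [m' [ND [Hl [Hm' HL]]]]]; [unfold g; lra|].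
  assert (Len : length l = kappa).
  { rewrite <- Lenk.
    assert (Eq : forall n, In n l <-> In n lk).
    { intros n. rewrite Hl, Hk. unfold g. split; intros [L E]; (split; [exact L|lra]). }
    apply Nat.le_antisymm; apply NoDup_incl_length; auto; intros n; apply Eq. }
  (* If g > 0, the bound 0 on the levels H_n^0 suffices. If g = 0, then Hinf_0 = Hinf_1 > 0, and
     levels that are positive with a positive limit are bounded away from 0. *)
  assert (M0 : exists m0, (forall n, (1 <= n)%nat -> m0 <= Hn b0 a1 n) /\ 0 < m0 + g).
  { destruct (Rlt_dec 0 g) as [Gp|Gn].
    - exists 0. split; [exact P0|lra].
    - assert (g = 0) by (unfold g in *; lra).
      destruct (level_set _ _ 0 Hinf0 _ E0 B0 P0) as [l0 [m0 [_ [Hl0 [Hm0 HL0]]]]];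
        [unfold g in *; lra|].
      exists m0. split; [|lra]. intros n L. apply HL0; [exact L|]. intros I.
      apply Hl0 in I. pose proof (levels_pos H a0 a1 b0 b1 n DW L). lra. }
  destruct M0 as [m0 [Hm0 Hm0g]].
  eapply gibbs_converges_ext;
    [|apply (gibbs_limit H a0 a1 b0 b1 Hinf0 Hinf1 m0 g m' 1 l DW I0 I1 Hm0 ND)].
  - intros f. cbv zeta. rewrite Len, Rmult_1_r. fold (c_of kappa).
    pose proof (pow2_ge_0 (c_of kappa)). field. lra.
  - intros n I. apply Hl, I.
  - exact HL.
  - exact Hm'.
  - exact Hm0g.
  - left. split; [unfold g; field|reflexivity].
Qed.

(** * Existence of the Gibbs measure *)

(** If the supremum M were not attained, M - f would be positive, hence bounded below by some c > 0,
    and M - c would be a smaller upper bound. *)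
Lemma continuous_S_max (f : Sigma -> R) : continuous_S f -> exists x, forall y, f y <= f x.
Proof.
  intros Cf. destruct (continuous_S_bounded f Cf) as [F [_ HF]].
  destruct (completeness (fun r => exists x, r = f x)) as [M [Ub Lub]].
  - exists F. intros r [x ->]. specialize (HF x). apply Rabs_le_between in HF. lra.
  - exists (f zero_inf), zero_inf. reflexivity.
  - apply NNPP. intros No.
    assert (Lt : forall x, 0 < M + (-1) * f x).
    { intros x. assert (f x <= M) by (apply Ub; exists x; reflexivity).
      destruct (Req_dec (f x) M) as [E|E]; [|lra]. exfalso. apply No. exists x.
      intros y. rewrite E. apply Ub. exists y. reflexivity. }
    destruct (continuous_S_pos (fun x => M + (-1) * f x)) as [c [Hc Bc]]; auto with cont.
    assert (M <= M - c); [|lra]. apply Lub. intros r [x ->]. specialize (Bc x). simpl in Bc. lra.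
Qed.

Lemma power_sum_continuous (c : nat -> R) :
  (forall n, (1 <= n)%nat -> 0 <= c n <= 1) ->
  exists F : R -> R, (forall s, 0 < s < 1 -> hassum (fun n => c n * s ^ n) (F s)) /\
    forall s, 0 < s < 1 -> continuity_pt F s.
Proof.
  (* [PSeries] starts at index 0 and [psum] at 1; a zero coefficient aligns them. *)
  intros Hc. set (a := fun n => match n with O => 0 | _ => c n end).
  exists (PSeries a).
  assert (Hex : forall s, 0 < s < 1 -> hassum (fun n => c n * s ^ n) (PSeries a s)).
  { intros s Hs. destruct (hassum_compare (fun n => c n * s ^ n) (fun n => s ^ n) (s / (1 - s)))
      as [l Hl].
    - intros n L. pose proof (pow_unit s n Hs). specialize (Hc n L). split; [apply Rmult_le_pos; lra|nra].
    - apply hassum_geom, Hs.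
    - replace (PSeries a s) with l; [exact Hl|]. symmetry. apply is_pseries_unique, is_pseries_R.
      change (is_lim_seq (sum_n (fun n => a n * s ^ n)) l).
      apply is_lim_seq_ext with (2 := Hl). intros N.
      induction N as [|N IH]; [rewrite sum_O; simpl; ring|].
      rewrite sum_Sn, <- IH. reflexivity. }
  split; [exact Hex|].
  intros s Hs. apply PSeries_continuity.
  apply Rbar_lt_le_trans with 1; [simpl; rewrite Rabs_pos_eq; lra|].
  apply (proj1 (CV_radius_bounded a)). exists 1. intros [|n]; simpl.
  - rewrite Rmult_0_l, Rabs_R0. lra.
  - specialize (Hc (S n) ltac:(lia)). rewrite pow1, !Rmult_1_r, Rabs_pos_eq; lra.
Qed.

(** Intermediate values for the product of the two power series: comparison with geometric series
    puts it below 1 for small s and at least at 1 once eta s / (1 - s) reaches 1. *)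
Lemma characteristic_root (c : bool -> nat -> R) (eta : R) :
  0 < eta -> (forall i n, (1 <= n)%nat -> eta <= c i n <= 1) ->
  exists s S0 S1, 0 < s < 1 /\ hassum (fun n => c false n * s ^ n) S0 /\
    hassum (fun n => c true n * s ^ n) S1 /\ S0 * S1 = 1.
Proof.
  intros He Hc.
  assert (He1 : eta <= 1) by (specialize (Hc true 1%nat ltac:(lia)); lra).
  destruct (power_sum_continuous (c false)) as [F0 [H0 C0]];
    [intros n L; specialize (Hc false n L); lra|].
  destruct (power_sum_continuous (c true)) as [F1 [H1 C1]];
    [intros n L; specialize (Hc true n L); lra|].
  assert (Bd : forall i F s, 0 < s < 1 -> hassum (fun n => c i n * s ^ n) F ->
    eta * (s / (1 - s)) <= F <= s / (1 - s)).
  { intros i F s Hs HF. split.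
    - apply (hassum_le (fun n => eta * s ^ n) (fun n => c i n * s ^ n)); auto.
      + intros n L. apply Rmult_le_compat_r; [|apply Hc, L]. left. apply pow_unit, Hs.
      + apply hassum_scal, hassum_geom, Hs.
    - apply (hassum_le (fun n => c i n * s ^ n) (fun n => s ^ n)); auto.
      + intros n L. pose proof (pow_unit s n Hs). specialize (Hc i n L). nra.
      + apply hassum_geom, Hs. }
  (* At 1/3 both sums are at most 1/2; at 1 / (1 + eta) both are at least 1. *)
  set (s1 := / 3). set (s2 := / (1 + eta)).
  assert (B1 : 0 < s1 < 1) by (unfold s1; lra).
  assert (B12 : s1 < s2) by (unfold s1, s2; apply Rinv_lt_contravar; lra).
  assert (B2 : s2 < 1) by (unfold s2; rewrite <- Rinv_1 at 2; apply Rinv_lt_contravar; lra).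
  assert (Q2 : eta * (s2 / (1 - s2)) = 1) by (unfold s2; field; lra).
  destruct (Bd false _ s1 B1 (H0 s1 B1)) as [U1 U2].
  destruct (Bd true _ s1 B1 (H1 s1 B1)) as [U3 U4].
  destruct (Bd false _ s2 ltac:(lra) (H0 s2 ltac:(lra))) as [V1 V2].
  destruct (Bd true _ s2 ltac:(lra) (H1 s2 ltac:(lra))) as [V3 V4].
  assert (Q1 : s1 / (1 - s1) = / 2) by (unfold s1; field).
  rewrite Q1 in *. rewrite Q2 in V1, V3.
  assert (F0 s1 * F1 s1 < 1) by nra.
  (* The intermediate value theorem is applied with strict signs, so a root at the right end is
     treated separately. *)
  destruct (Req_dec (F0 s2 * F1 s2) 1) as [E|NE].
  - exists s2, (F0 s2), (F1 s2). repeat split; auto; try lra; [apply H0|apply H1]; lra.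
  - assert (1 < F0 s2 * F1 s2) by nra.
    destruct (IVT_interv (fun s => F0 s * F1 s - 1) s1 s2) as [s [Bs Es]]; [| lra | lra | lra |].
    + intros s Is. apply (continuity_pt_minus (fun s => F0 s * F1 s) (fun _ => 1)).
      * apply (continuity_pt_mult F0 F1); [apply C0|apply C1]; lra.
      * apply continuity_pt_const. intros x y. reflexivity.
    + exists s, (F0 s), (F1 s). repeat split; try lra; [apply H0|apply H1]; lra.
Qed.

Lemma hassum_drop (u : nat -> R) (l : R) (N : nat) :
  hassum u l -> hassum (fun n => u (n + N)%nat) (l - psum u N).
Proof.
  intros Hu. induction N as [|N IH].
  - replace (l - psum u 0) with l by (simpl; ring).
    apply hassum_ext with (2 := Hu). intros n _. f_equal. lia.
  - apply hassum_shift in IH. simpl in IH.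
    replace (l - psum u (S N)) with (l - psum u N - u (S N)) by (simpl; ring).
    apply hassum_ext with (2 := IH). intros n _. f_equal. lia.
Qed.

(* 0 stands for an infinite run. *)
Definition run_len (x : Sigma) : nat :=
  epsilon (inhabits O) (fun n => ((1 <= n)%nat /\ run (x O) n x = true) \/
    (n = O /\ forall m, (1 <= m)%nat -> run (x O) m x = false)).

Lemma run_len_spec (x : Sigma) :
  ((1 <= run_len x)%nat /\ run (x O) (run_len x) x = true) \/
  (run_len x = O /\ x = const_pt (x O)).
Proof.
  assert (E : ((1 <= run_len x)%nat /\ run (x O) (run_len x) x = true) \/
    (run_len x = O /\ forall m, (1 <= m)%nat -> run (x O) m x = false)).
  { unfold run_len. apply epsilon_spec.
    destruct (classic (exists n, (1 <= n)%nat /\ run (x O) n x = true)) as [[n E]|No].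
    - exists n. left. exact E.
    - exists O. right. split; [reflexivity|]. intros m L.
      destruct (run (x O) m x) eqn:R; [|reflexivity]. exfalso. apply No. exists m. auto. }
  destruct E as [E|[E F]]; [left; exact E|right]. split; [exact E|].
  assert (C : forall n, const_word (x O) n x = true).
  { induction n as [|n IH]; [reflexivity|].
    pose proof (const_word_S (x O) n x) as Sp. rewrite IH in Sp.
    destruct n as [|n]; [simpl; rewrite Bool.eqb_reflx; reflexivity|].
    rewrite (F (S n)) in Sp by lia. destruct (const_word (x O) (S (S n)) x); [reflexivity|].
    simpl in Sp. lra. }
  apply functional_extensionality. intros n. symmetry.
  apply (proj1 (const_word_spec (x O) (S n) x) (C (S n))). lia.
Qed.

Lemma run_unique (i j : bool) (n m : nat) (x : Sigma) : (1 <= n)%nat -> (1 <= m)%nat ->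
  run i n x = true -> run j m x = true -> n = m.
Proof.
  intros Ln Lm A B. pose proof (run_first i n x Ln A). pose proof (run_first j m x Lm B). subst.
  apply run_spec in A, B. destruct A as [A A'], B as [B B'].
  destruct (lt_eq_lt_dec n m) as [[L|E]|L]; [|exact E|]; exfalso.
  - rewrite (B n L) in A'. subst. destruct (x O); discriminate A'.
  - rewrite (A m L) in B'. subst. destruct (x O); discriminate B'.
Qed.

Lemma run_len_run (i : bool) (n : nat) (x : Sigma) : (1 <= n)%nat -> run i n x = true ->
  run_len x = n.
Proof.
  intros L R. destruct (run_len_spec x) as [[L' R']|[_ C]].
  - exact (run_unique _ _ _ _ x L' L R' R).
  - exfalso. apply run_spec in R. destruct R as [R R'].
    rewrite C in R, R'. unfold const_pt in *. specialize (R O ltac:(lia)).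
    rewrite R in R'. destruct i; discriminate R'.
Qed.

Lemma run_len_const (i : bool) : run_len (const_pt i) = O.
Proof.
  destruct (run_len_spec (const_pt i)) as [[L R]|[E _]]; [|exact E].
  exfalso. apply run_spec in R. destruct R as [_ R]. unfold const_pt in R.
  destruct i; discriminate R.
Qed.

Lemma scons_const (i : bool) : scons i (const_pt i) = const_pt i.
Proof. apply functional_extensionality. intros [|n]; reflexivity. Qed.

(** The atomic functional below only needs bounded arguments, which spares a continuity proof for
    [class_rep]. *)
Definition bounded_S (g : Sigma -> R) : Prop := exists C, forall x, Rabs (g x) <= C.

Lemma bounded_S_lin (c : R) (f g : Sigma -> R) :
  bounded_S f -> bounded_S g -> bounded_S (fun x => f x + c * g x).
Proof.
  intros [C HC] [D HD]. exists (C + Rabs c * D). intros x.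
  eapply Rle_trans; [apply Rabs_triang|]. apply Rplus_le_compat; [apply HC|].
  rewrite Rabs_mult. apply Rmult_le_compat_l; [apply Rabs_pos|apply HD].
Qed.

Lemma continuous_S_bdd (f : Sigma -> R) : continuous_S f -> bounded_S f.
Proof. intros C. destruct (continuous_S_bounded f C) as [F [_ B]]. exists F. exact B. Qed.

(** * Eigenfunction and eigenmeasure when a = 0 and s solves S_0 S_1 = 1 *)

Section Existence.
Context (H : Sigma -> R) (b : bool -> nat -> R) (beta s : R) (Sf : bool -> R).
Context (HP : block_potential H (fun _ _ => 0) b)
  (Hx : forall i, H (scons i (const_pt (negb i))) = 0)
  (Hbeta : 0 < beta) (Hbn : forall i n, (1 <= n)%nat -> b i n <= (/ 2) ^ n)
  (Hs : 0 < s < 1)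
  (HS : forall i, hassum (fun n => exp (- beta * b i n) * s ^ n) (Sf i))
  (HSS : Sf false * Sf true = 1).

Let CH : continuous_S H := proj1 HP.
Let HA := proj1 (proj2 (proj2 (proj2 (proj2 HP)))).
Let HB := proj2 (proj2 (proj2 (proj2 (proj2 HP)))).
Let w (i : bool) (n : nat) : R := exp (- beta * b i n) * s ^ n.
Let N := norm_transfer H beta s.

Lemma w_pos (i : bool) (n : nat) : 0 < w i n.
Proof. apply Rmult_lt_0_compat; [apply exp_pos|apply pow_lt; lra]. Qed.

Lemma Sf_pos (i : bool) : 0 < Sf i.
Proof.
  apply Rlt_le_trans with (w i 1); [apply w_pos|].
  apply (term_le_sum (w i)); [|apply HS|lia]. intros n _. left. apply w_pos.
Qed.

Let K (i : bool) : R := if i then Sf true else 1.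

(** For n >= 1 this is the tail of S_i from index n on, divided by s^(n-1): the recursion of the
    eigenfunction along a run, unrolled. Index 0 stands for an infinite run and gets the limit for n
    to infinity, where the wells vanish and the tail is geometric. *)
Definition run_tail (i : bool) (n : nat) : R :=
  match n with O => s / (1 - s) | S k => (Sf i - psum (w i) k) / s ^ k end.

Definition eigen (x : Sigma) : R := K (x O) * run_tail (negb (x O)) (run_len x).

Lemma run_tail_step (i : bool) (n : nat) : (1 <= n)%nat ->
  run_tail i n = s * (exp (- beta * b i n) + run_tail i (S n)).
Proof.
  intros L. destruct n as [|k]; [lia|]. unfold run_tail. cbn [psum]. unfold w at 3. simpl pow.
  pose proof (pow_unit s k Hs). field. split; lra.
Qed.

Lemma run_tail_step_0 (i : bool) : run_tail i 0 = s * (1 + run_tail i 0).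
Proof. simpl. field. lra. Qed.

(** The eigenvalue equation passes from a run of one letter to a run of length 1 of the other. That
    these two chains fit together is the equation S_0 S_1 = 1. *)
Lemma run_tail_1 (i : bool) : K (negb i) * run_tail i 1 = K i.
Proof.
  unfold K, run_tail. destruct i; simpl; [field|].
  transitivity (Sf false * Sf true); [field|exact HSS].
Qed.

(** From index n on, each weight differs from the power of s by at most the fraction beta b <= beta
    2^-n, so the rescaled tail is close to the geometric one. *)
Lemma run_tail_near (i : bool) (n : nat) : (1 <= n)%nat ->
  0 < run_tail i n /\
  Rabs (run_tail i n - run_tail i 0) <= beta * (/ 2) ^ n * (s / (1 - s)).
Proof.
  intros L. destruct n as [|k]; [lia|]. clear L. simpl run_tail.
  pose proof (pow_unit s k Hs) as Pk.
  pose proof (hassum_drop (w i) (Sf i) k (HS i)) as D.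
  split.
  - apply Rdiv_lt_0_compat; [|lra]. apply Rlt_le_trans with (w i (1 + k)); [apply w_pos|].
    apply (term_le_sum (fun n => w i (n + k))) with (2 := D); [|lia]. intros. left. apply w_pos.
  - pose proof (hassum_scal (s ^ k) _ _ (hassum_geom s Hs)) as G.
    assert (A : Rabs (Sf i - psum (w i) k - s ^ k * (s / (1 - s)))
                <= beta * (/ 2) ^ S k * s ^ k * (s / (1 - s))).
    { apply (hassum_dist _ _ (fun n => beta * (/ 2) ^ S k * s ^ k * s ^ n) _ _ _ D G).
      - intros n L. unfold w. rewrite pow_add.
        pose proof (proj2 (proj1 (proj2 (proj2 (proj2 HP))) i (n + k)%nat ltac:(lia))) as Bp.
        pose proof (Hbn i (n + k)%nat ltac:(lia)) as Bq.
        pose proof (exp_ineq1_le (- beta * b i (n + k)%nat)) as I.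
        assert (I' : exp (- beta * b i (n + k)%nat) <= 1).
        { rewrite <- exp_0. apply exp_le_compat. nra. }
        assert (Hp : (/ 2) ^ (n + k) <= (/ 2) ^ S k).
        { destruct n as [|n]; [lia|]. replace (S n + k)%nat with (n + S k)%nat by lia.
          rewrite pow_add. pose proof (pow_unit (/ 2) n ltac:(lra)).
          pose proof (pow_unit (/ 2) (S k) ltac:(lra)). nra. }
        pose proof (pow_unit s n Hs).
        replace (exp (- beta * b i (n + k)%nat) * (s ^ n * s ^ k) - s ^ k * s ^ n)
          with (- ((1 - exp (- beta * b i (n + k)%nat)) * (s ^ k * s ^ n))) by ring.
        assert (0 < s ^ k * s ^ n) by (apply Rmult_lt_0_compat; lra).
        rewrite Rabs_Ropp, Rabs_pos_eq by (apply Rmult_le_pos; lra).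
        replace (beta * (/ 2) ^ S k * s ^ k * s ^ n)
          with (beta * (/ 2) ^ S k * (s ^ k * s ^ n)) by ring.
        apply Rmult_le_compat_r; [lra|].
        apply Rle_trans with (beta * b i (n + k)%nat); [lra|].
        apply Rmult_le_compat_l; lra.
      - intros M. rewrite psum_scal. apply Rmult_le_compat_l.
        + pose proof (pow_unit (/ 2) (S k) ltac:(lra)).
          apply Rmult_le_pos; [apply Rmult_le_pos|]; lra.
        + apply psum_le_sum; [|apply hassum_geom, Hs]. intros. left. apply pow_unit, Hs. }
    replace ((Sf i - psum (w i) k) / s ^ k - s / (1 - s))
      with ((Sf i - psum (w i) k - s ^ k * (s / (1 - s))) / s ^ k) by (field; lra).
    unfold Rdiv at 1. rewrite Rabs_mult, (Rabs_pos_eq (/ s ^ k))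
      by (left; apply Rinv_0_lt_compat; lra).
    apply Rmult_le_reg_r with (s ^ k); [lra|]. rewrite Rmult_assoc, Rinv_l by lra.
    change (/ 2 * (/ 2) ^ k) with ((/ 2) ^ S k). lra.
Qed.

Lemma K_pos (i : bool) : 0 < K i.
Proof. pose proof (Sf_pos true). destruct i; simpl; lra. Qed.

Lemma run_tail_pos (i : bool) (n : nat) : 0 < run_tail i n.
Proof.
  destruct n as [|n]; [simpl; apply Rdiv_lt_0_compat; lra|]. apply run_tail_near. lia.
Qed.

Lemma eigen_pos (x : Sigma) : 0 < eigen x.
Proof. apply Rmult_lt_0_compat; [apply K_pos|apply run_tail_pos]. Qed.

Lemma eigen_run (i : bool) (n : nat) (x : Sigma) : (1 <= n)%nat -> run i n x = true ->
  eigen x = K i * run_tail (negb i) n.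
Proof.
  intros L R. unfold eigen. rewrite (run_len_run i n x L R), (run_first i n x L R). reflexivity.
Qed.

Lemma eigen_const (i : bool) : eigen (const_pt i) = K i * run_tail (negb i) 0.
Proof. unfold eigen. rewrite run_len_const. reflexivity. Qed.

Lemma eigen_equation (x : Sigma) : N eigen x = eigen x.
Proof.
  unfold N, norm_transfer.
  destruct (run_len_spec x) as [[L R]|[_ C]].
  - set (i := x O) in *. set (n := run_len x) in *.
    rewrite (transfer_split _ _ _ _ i), (HA i n x L R).
    rewrite (HB (negb i) n x L) by (rewrite Bool.negb_involutive; exact R).
    rewrite (eigen_run i (S n) (scons i x)) by (try lia; rewrite run_scons; exact R).
    rewrite (eigen_run (negb i) 1 (scons (negb i) x)) by (try lia; apply (run_neg_1 i n); auto).
    rewrite (eigen_run i n x L R), Bool.negb_involutive, run_tail_1.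
    rewrite (run_tail_step (negb i) n L), Rmult_0_r, exp_0. ring.
  - set (i := x O) in C. clearbody i. subst x.
    rewrite (transfer_split _ _ _ _ i), scons_const, (proj1 (proj2 (proj2 HP))).
    pose proof (Hx (negb i)) as E. rewrite Bool.negb_involutive in E. rewrite E.
    rewrite (eigen_run (negb i) 1 (scons (negb i) (const_pt i)));
      [|lia|destruct i; reflexivity].
    rewrite Bool.negb_involutive, run_tail_1, eigen_const.
    rewrite (run_tail_step_0 (negb i)) at 2. rewrite Rmult_0_r, exp_0. ring.
Qed.

(** Around a point whose first run is finite the function is locally constant. Points near a fixed
    point have a long or infinite first run, and [run_tail_near] applies. *)
Lemma eigen_continuous : continuous_S eigen.
Proof.
  intros x eps He. destruct (run_len_spec x) as [[L R]|[_ C]].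
  - exists (S (run_len x)). intros y A. rewrite (eigen_run _ _ x L R).
    rewrite (eigen_run (x O) (run_len x) y L)
      by (rewrite <- (run_agree _ _ x y A); exact R).
    rewrite Rminus_diag, Rabs_R0. exact He.
  - set (i := x O) in C. clearbody i. subst x.
    set (c := K i * (beta * (s / (1 - s)))).
    assert (Hc : 0 < c).
    { unfold c. pose proof (K_pos i). assert (0 < s / (1 - s)) by (apply Rdiv_lt_0_compat; lra).
      apply Rmult_lt_0_compat; [|apply Rmult_lt_0_compat]; lra. }
    destruct (pow_lt_1_zero (/ 2)) with (y := eps / c) as [M HM];
      [rewrite Rabs_pos_eq; lra|apply Rdiv_lt_0_compat; lra|].
    exists (S M). intros y A. rewrite eigen_const.
    assert (y0 : y O = i) by (symmetry; apply (A O); lia).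
    destruct (run_len_spec y) as [[L R]|[_ C]].
    + rewrite y0 in R. rewrite (eigen_run i _ y L R).
      assert (LM : (M <= run_len y)%nat).
      { apply Nat.nlt_ge. intros LM. apply run_spec in R. destruct R as [_ R].
        rewrite <- (A (run_len y)) in R by lia. unfold const_pt in R. destruct i; discriminate R. }
      rewrite Rabs_minus_sym, <- Rmult_minus_distr_l, Rabs_mult, (Rabs_pos_eq (K i))
        by (left; apply K_pos).
      pose proof (proj2 (run_tail_near (negb i) (run_len y) L)) as B.
      specialize (HM (run_len y) LM).
      rewrite Rabs_pos_eq in HM by (left; apply pow_lt; lra).
      apply Rle_lt_trans with (K i * (beta * (/ 2) ^ run_len y * (s / (1 - s)))).
      * apply Rmult_le_compat_l; [left; apply K_pos|exact B].
      * replace (K i * (beta * (/ 2) ^ run_len y * (s / (1 - s))))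
          with (c * (/ 2) ^ run_len y) by (unfold c; ring).
        replace eps with (c * (eps / c)) by (field; lra). apply Rmult_lt_compat_l; assumption.
    + rewrite y0 in C. rewrite C, eigen_const, Rminus_diag, Rabs_R0. exact He.
Qed.

(** * Iterates of the normalized operator and an atomic functional *)

Lemma N_plus (f g : Sigma -> R) : N (fun x => f x + g x) = fun x => N f x + N g x.
Proof. apply functional_extensionality. intros x. unfold N, norm_transfer, transfer. ring. Qed.

Lemma N_scal (r : R) (f : Sigma -> R) : N (fun x => r * f x) = fun x => r * N f x.
Proof. apply functional_extensionality. intros x. unfold N, norm_transfer, transfer. ring. Qed.

Lemma iter_N_plus (n : nat) (f g : Sigma -> R) :
  Nat.iter n N (fun x => f x + g x) = fun x => Nat.iter n N f x + Nat.iter n N g x.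
Proof. induction n as [|n IH]; [reflexivity|]. simpl. rewrite IH. apply N_plus. Qed.

Lemma iter_N_scal (n : nat) (r : R) (f : Sigma -> R) :
  Nat.iter n N (fun x => r * f x) = fun x => r * Nat.iter n N f x.
Proof. induction n as [|n IH]; [reflexivity|]. simpl. rewrite IH. apply N_scal. Qed.

Lemma N_mono (f g : Sigma -> R) : (forall x, f x <= g x) -> forall x, N f x <= N g x.
Proof.
  intros E x. unfold N, norm_transfer, transfer. apply Rmult_le_compat_l; [lra|].
  apply Rplus_le_compat; apply Rmult_le_compat_l; auto; left; apply exp_pos.
Qed.

Lemma iter_N_mono (n : nat) (f g : Sigma -> R) :
  (forall x, f x <= g x) -> forall x, Nat.iter n N f x <= Nat.iter n N g x.
Proof. induction n as [|n IH]; intros E; [exact E|]. simpl. apply N_mono, IH, E. Qed.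

Lemma iter_N_continuous (n : nat) (f : Sigma -> R) : continuous_S f -> continuous_S (Nat.iter n N f).
Proof.
  intros C. induction n as [|n IH]; [exact C|]. simpl. unfold N at 1, norm_transfer.
  auto with cont.
Qed.

Lemma iter_N_eigen (n : nat) (c : R) : Nat.iter n N (fun x => c * eigen x) = fun x => c * eigen x.
Proof.
  rewrite iter_N_scal. apply functional_extensionality. intros x. f_equal.
  revert x. induction n as [|n IH]; intros x; [reflexivity|]. simpl.
  transitivity (N eigen x); [|apply eigen_equation].
  f_equal. apply functional_extensionality, IH.
Qed.

Lemma N_bounded (g : Sigma -> R) : bounded_S g -> bounded_S (N g).
Proof.
  intros [C HC]. exists (s * (1 * C + 1 * C)). intros x. unfold N, norm_transfer, transfer.
  rewrite Rabs_mult, (Rabs_pos_eq s) by lra. apply Rmult_le_compat_l; [lra|].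
  assert (E : forall y, 0 < exp (- beta * H y) <= 1).
  { intros y. split; [apply exp_pos|]. rewrite <- exp_0. apply exp_le_compat.
    pose proof (proj1 (proj2 HP) y). nra. }
  eapply Rle_trans; [apply Rabs_triang|].
  apply Rplus_le_compat; rewrite Rabs_mult;
    (apply Rmult_le_compat; [apply Rabs_pos|apply Rabs_pos| |apply HC]);
    rewrite Rabs_pos_eq; first [apply E|left; apply E].
Qed.

Lemma iter_N_bounded (n : nat) (g : Sigma -> R) : bounded_S g -> bounded_S (Nat.iter n N g).
Proof. intros B. induction n as [|n IH]; [exact B|]. apply N_bounded, IH. Qed.

(** With a = 0 the mass of a run is multiplied by s at each lengthening, so it is pm i s^n. The
    ratio of the two constants is S_1, as the relation between the masses demands, and the second
    factor makes the total mass 1. *)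
Let pm (i : bool) : R := (if i then Sf true else 1) * ((1 - s) / (s * (1 + Sf true))).

Definition atom_term (g : Sigma -> R) (n : nat) : R :=
  s ^ n * (pm false * g (run_pt false n) + pm true * g (run_pt true n)).

(* A purely atomic probability giving every cylinder i^n(not i) the mass an eigenmeasure must
   give it; its images under the dual of the normalised operator converge. *)
Definition atomic (g : Sigma -> R) : R := real (Lim_seq (psum (atom_term g))).

Lemma pm_pos (i : bool) : 0 < pm i.
Proof.
  pose proof (Sf_pos true). unfold pm. apply Rmult_lt_0_compat; [destruct i; lra|].
  apply Rdiv_lt_0_compat; [lra|apply Rmult_lt_0_compat; lra].
Qed.

Lemma pm_relation (i : bool) : pm i * Sf (negb i) = pm (negb i).
Proof.
  unfold pm. destruct i; simpl.
  - replace (Sf true * ((1 - s) / (s * (1 + Sf true))) * Sf false)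
      with (Sf false * Sf true * ((1 - s) / (s * (1 + Sf true)))) by ring.
    rewrite HSS. reflexivity.
  - ring.
Qed.

Lemma atomic_sum (g : Sigma -> R) : bounded_S g -> hassum (atom_term g) (atomic g).
Proof.
  intros [C HC].
  destruct (hassum_abs_exists (atom_term g) (fun n => (C * (pm false + pm true)) * s ^ n)
    (C * (pm false + pm true) * (s / (1 - s)))) as [l Hl].
  - intros n _. unfold atom_term. rewrite Rabs_mult, (Rabs_pos_eq (s ^ n)), Rmult_comm
      by (left; apply pow_lt; lra).
    apply Rmult_le_compat_r; [left; apply pow_lt; lra|].
    eapply Rle_trans; [apply Rabs_triang|]. rewrite !Rabs_mult.
    pose proof (pm_pos false). pose proof (pm_pos true).
    rewrite !(Rabs_pos_eq (pm _)) by lra.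
    pose proof (HC (run_pt false n)). pose proof (HC (run_pt true n)). nra.
  - apply hassum_scal, hassum_geom, Hs.
  - unfold atomic. rewrite (is_lim_seq_unique _ _ Hl). exact Hl.
Qed.

Lemma atomic_lin (c : R) (f g : Sigma -> R) : bounded_S f -> bounded_S g ->
  atomic (fun x => f x + c * g x) = atomic f + c * atomic g.
Proof.
  intros F G. apply hassum_unique with (1 := atomic_sum _ (bounded_S_lin c f g F G)).
  eapply hassum_ext; [|apply hassum_plus; [apply atomic_sum, F|apply hassum_scal, atomic_sum, G]].
  intros n _. unfold atom_term. ring.
Qed.

Lemma atomic_mono (f g : Sigma -> R) : bounded_S f -> bounded_S g ->
  (forall x, f x <= g x) -> atomic f <= atomic g.
Proof.
  intros F G L. apply (hassum_le (atom_term f) (atom_term g)); try (apply atomic_sum; assumption).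
  intros n _. unfold atom_term. apply Rmult_le_compat_l; [left; apply pow_lt; lra|].
  pose proof (pm_pos false). pose proof (pm_pos true).
  apply Rplus_le_compat; apply Rmult_le_compat_l; auto; lra.
Qed.

Lemma atomic_const (c : R) : atomic (fun _ => c) = c.
Proof.
  assert (B : bounded_S (fun _ => c)) by (exists (Rabs c); intros; lra).
  apply hassum_unique with (1 := atomic_sum _ B).
  pose proof (hassum_scal (c * (pm false + pm true)) _ _ (hassum_geom s Hs)) as G.
  pose proof (Sf_pos true).
  replace (c * (pm false + pm true) * (s / (1 - s))) with c in G
    by (unfold pm; field; repeat split; lra).
  apply hassum_ext with (2 := G). intros n _. unfold atom_term. ring.
Qed.

Definition class_const (g : Sigma -> R) : Prop :=
  forall i n x, (1 <= n)%nat -> run i n x = true -> g x = g (run_pt i n).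

Lemma N_run (g : Sigma -> R) (i : bool) (n : nat) (x : Sigma) : class_const g ->
  (1 <= n)%nat -> run i n x = true ->
  N g x = s * (g (run_pt i (S n)) + exp (- beta * b (negb i) n) * g (run_pt (negb i) 1)).
Proof.
  intros G L R. unfold N, norm_transfer.
  rewrite (transfer_split _ _ _ _ i), (HA i n x L R).
  rewrite (HB (negb i) n x L) by (rewrite Bool.negb_involutive; exact R).
  rewrite (G i (S n) (scons i x)) by (try lia; rewrite run_scons; exact R).
  rewrite (G (negb i) 1%nat (scons (negb i) x)) by (try lia; apply (run_neg_1 i n); auto).
  rewrite Rmult_0_r, exp_0. ring.
Qed.

Lemma N_class_const (g : Sigma -> R) : class_const g -> class_const (N g).
Proof.
  intros G i n x L R. rewrite (N_run g i n x G L R).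
  rewrite (N_run g i n (run_pt i n) G L (run_run_pt i n)). reflexivity.
Qed.

(** Lengthening a run shifts the series by one and loses its first term. The terms that close a run
    sum to multiples of S_0 and S_1, and [pm_relation] identifies them with the lost term. *)
Lemma atomic_invariant (g : Sigma -> R) : bounded_S g -> class_const g ->
  atomic (N g) = atomic g.
Proof.
  intros B G. apply hassum_unique with (1 := atomic_sum _ (N_bounded g B)).
  pose proof (hassum_shift _ _ (atomic_sum g B)) as Sh.
  set (g0 := g (run_pt false 1)) in *. set (g1 := g (run_pt true 1)) in *.
  pose proof (hassum_plus _ _ _ _
    (hassum_plus _ _ _ _ Sh (hassum_scal (s * (pm false * g1)) _ _ (HS true)))
    (hassum_scal (s * (pm true * g0)) _ _ (HS false))) as T.
  match type of T with hassum _ ?l => replace l with (atomic g) in T end.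
  - apply hassum_ext with (2 := T). intros n L. unfold atom_term.
    rewrite !(N_run g _ n _ G L (run_run_pt _ n)). simpl negb. fold g0 g1. simpl pow. ring.
  - unfold atom_term. fold g0 g1.
    pose proof (pm_relation true) as R1. pose proof (pm_relation false) as R0.
    simpl negb in R0, R1.
    transitivity (atomic g - s * (pm false * g0 + pm true * g1)
      + s * g1 * (pm false * Sf true) + s * g0 * (pm true * Sf false)).
    + rewrite R0, R1. ring.
    + ring.
Qed.

Lemma atomic_iter_invariant (n : nat) (g : Sigma -> R) : bounded_S g -> class_const g ->
  atomic (Nat.iter n N g) = atomic g /\ class_const (Nat.iter n N g).
Proof.
  intros B G. induction n as [|n [IH1 IH2]]; [split; [reflexivity|exact G]|].
  simpl. split; [|apply N_class_const, IH2].
  rewrite atomic_invariant; auto. apply iter_N_bounded, B.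
Qed.

(** At a point with infinite first run g itself is kept, so that nothing has to be estimated
    there. *)
Definition class_rep (g : Sigma -> R) (x : Sigma) : R :=
  match run_len x with O => g x | n => g (run_pt (x O) n) end.

Lemma class_rep_run (g : Sigma -> R) (i : bool) (n : nat) (x : Sigma) : (1 <= n)%nat ->
  run i n x = true -> class_rep g x = g (run_pt i n).
Proof.
  intros L R. unfold class_rep. rewrite (run_len_run i n x L R), (run_first i n x L R).
  destruct n; [lia|reflexivity].
Qed.

(** After M steps an iterate g of f is nearly constant on run cylinders. Replaced by its
    representative h there, it has a value that further steps leave unchanged; the error is at most
    d [eigen], which the operator fixes. Hence all later terms lie within eps/4 of [atomic h]. *)
Lemma atomic_cauchy (f : Sigma -> R) : continuous_S f ->
  ex_finite_lim_seq (fun n => atomic (Nat.iter n N f)).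
Proof.
  intros Cf. apply ex_lim_seq_cauchy_corr. intros eps.
  destruct (continuous_S_pos eigen eigen_continuous eigen_pos) as [c [Hc Bc]].
  destruct (continuous_S_bounded eigen eigen_continuous) as [C [HC BC]].
  (* C bounds [eigen], so the total error [atomic] (d [eigen]) is at most eps/4. *)
  set (d := eps / (4 * C)).
  assert (Hd : 0 < d) by (apply Rdiv_lt_0_compat; [apply cond_pos|lra]).
  destruct (continuous_S_uniform f (d * c) Cf) as [M HM]; [apply Rmult_lt_0_compat; lra|].
  set (g := Nat.iter M N f).
  assert (Bg : bounded_S g) by (apply continuous_S_bdd, iter_N_continuous, Cf).
  assert (Osc : forall x y i n, (1 <= n)%nat -> run i n x = true -> run i n y = true ->
            Rabs (g x - g y) <= d * eigen x).
  { intros x y i n L X Y.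
    apply (iterate_oscillation H (fun _ _ => 0) b beta s d eigen f M HP (proj1 Hs) eigen_equation)
      with (i := i) (n := n); auto.
    - intros u v A. apply HM in A. specialize (Bc u). nra.
    - intros j J. lia. }
  set (h := class_rep g).
  assert (Near : forall x, Rabs (g x - h x) <= d * eigen x).
  { intros x. destruct (run_len_spec x) as [[L R]|[E _]].
    - unfold h. rewrite (class_rep_run g _ _ x L R).
      apply (Osc x _ (x O) (run_len x)); auto. apply run_run_pt.
    - unfold h, class_rep. rewrite E, Rminus_diag, Rabs_R0. pose proof (eigen_pos x).
      apply Rmult_le_pos; lra. }
  assert (Bh : bounded_S h).
  { destruct Bg as [D HD]. exists D. intros x. unfold h, class_rep. destruct run_len; apply HD. }
  assert (Gh : class_const h).
  { intros i n x L R. unfold h. rewrite (class_rep_run g i n x L R).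
    rewrite (class_rep_run g i n _ L (run_run_pt i n)). reflexivity. }
  assert (Be : bounded_S (fun x => d * eigen x)).
  { exists (d * C). intros x. rewrite Rabs_mult, (Rabs_pos_eq d) by lra.
    apply Rmult_le_compat_l; [lra|apply BC]. }
  assert (Ae : atomic (fun x => d * eigen x) <= eps / 4).
  { rewrite <- (atomic_const (eps / 4)). apply atomic_mono; auto.
    - exists (Rabs (eps / 4)). intros; lra.
    - intros x. specialize (BC x). apply Rabs_le_between in BC.
      replace (eps / 4) with (d * C) by (unfold d; field; lra). apply Rmult_le_compat_l; lra. }
  assert (Close : forall m, Rabs (atomic (Nat.iter m N g) - atomic h) <= eps / 4).
  { intros m. rewrite <- (proj1 (atomic_iter_invariant m h Bh Gh)).
    assert (Hlin : forall u v, bounded_S u -> bounded_S v ->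
      (forall x, u x <= v x + d * eigen x) ->
      atomic (Nat.iter m N u) - atomic (Nat.iter m N v) <= eps / 4).
    { intros u v Bu Bv L.
      assert (A : atomic (Nat.iter m N u)
                  <= atomic (fun x => Nat.iter m N v x + 1 * (d * eigen x))).
      { apply atomic_mono; [apply iter_N_bounded, Bu| |].
        - apply bounded_S_lin; [apply iter_N_bounded, Bv|exact Be].
        - intros x. eapply Rle_trans; [apply (iter_N_mono m u _ L)|].
          rewrite iter_N_plus, iter_N_eigen. lra. }
      rewrite atomic_lin in A by (auto using iter_N_bounded). lra. }
    apply Rabs_le. split.
    - assert (atomic (Nat.iter m N h) - atomic (Nat.iter m N g) <= eps / 4); [|lra].
      apply Hlin; auto. intros x. specialize (Near x). apply Rabs_le_between in Near. lra.
    - apply Hlin; auto. intros x. specialize (Near x). apply Rabs_le_between in Near. lra. }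
  exists M. intros n m Ln Lm.
  pose proof (Close (n - M)%nat) as Dn. pose proof (Close (m - M)%nat) as Dm. unfold g in Dn, Dm.
  rewrite <- Nat.iter_add in Dn, Dm.
  replace (n - M + M)%nat with n in Dn by lia. replace (m - M + M)%nat with m in Dm by lia.
  pose proof (cond_pos eps). apply Rabs_le_between in Dn. apply Rabs_le_between in Dm.
  apply Rabs_def1; lra.
Qed.

Definition eigenmeasure (f : Sigma -> R) : R := real (Lim_seq (fun n => atomic (Nat.iter n N f))).

Lemma eigenmeasure_lim (f : Sigma -> R) : continuous_S f ->
  is_lim_seq (fun n => atomic (Nat.iter n N f)) (eigenmeasure f).
Proof.
  intros C. destruct (atomic_cauchy f C) as [l Hl]. unfold eigenmeasure.
  rewrite (is_lim_seq_unique _ _ Hl). exact Hl.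
Qed.

(** Applying the operator once more only shifts the sequence of iterates, so the limit is invariant.
    It keeps total mass 1 because constants are constant on run cylinders, where [atomic] is already
    invariant. *)
Lemma eigenmeasure_correct : is_eigenmeasure H beta (/ s) eigenmeasure.
Proof.
  assert (Bd : forall n f, continuous_S f -> bounded_S (Nat.iter n N f))
    by (intros; apply continuous_S_bdd, iter_N_continuous; assumption).
  assert (B0 : bounded_S (fun _ => 0)) by (exists 0; intros; rewrite Rabs_R0; lra).
  assert (Sc : forall r f, continuous_S f -> eigenmeasure (fun x => r * f x) = r * eigenmeasure f).
  { intros r f F. apply lim_unique with (1 := eigenmeasure_lim _ (continuous_S_scal r f F)).
    apply is_lim_seq_ext with (fun n => r * atomic (Nat.iter n N f)).
    - intros n. rewrite iter_N_scal.
      replace (fun x => r * Nat.iter n N f x) with (fun x => 0 + r * Nat.iter n N f x)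
        by (apply functional_extensionality; intros; lra).
      rewrite atomic_lin, atomic_const by auto. ring.
    - apply (is_lim_seq_scal_l _ r (eigenmeasure f)), eigenmeasure_lim, F. }
  split; [split; [|split; [exact Sc|split]]|].
  - intros f g F G. apply lim_unique with (1 := eigenmeasure_lim _ (continuous_S_plus f g F G)).
    apply is_lim_seq_ext with (fun n => atomic (Nat.iter n N f) + atomic (Nat.iter n N g)).
    + intros n. rewrite iter_N_plus.
      replace (fun x => Nat.iter n N f x + Nat.iter n N g x)
        with (fun x => Nat.iter n N f x + 1 * Nat.iter n N g x)
        by (apply functional_extensionality; intros; lra).
      rewrite atomic_lin by auto. ring.
    + apply is_lim_seq_plus'; apply eigenmeasure_lim; assumption.
  - intros f F P. apply (lim_ge_const _ _ 0 (eigenmeasure_lim f F)). intros n.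
    rewrite <- (atomic_const 0). apply atomic_mono; auto.
    intros x. replace 0 with (Nat.iter n N (fun _ => 0) x); [apply iter_N_mono, P|].
    clear. revert x. induction n as [|n IH]; intros x; [reflexivity|]. simpl.
    transitivity (N (fun _ => 0) x).
    + f_equal. apply functional_extensionality, IH.
    + unfold N, norm_transfer, transfer. ring.
  - apply lim_unique with (1 := eigenmeasure_lim _ (continuous_S_const 1)).
    apply is_lim_seq_ext with (fun _ => 1); [|apply is_lim_seq_const].
    intros n. symmetry.
    rewrite (proj1 (atomic_iter_invariant n (fun _ => 1) ltac:(exists 1; intros; rewrite Rabs_R1; lra)
      ltac:(intros i k x _ _; reflexivity))).
    apply atomic_const.
  - intros f F.
    assert (CN : continuous_S (N f)) by (apply (iter_N_continuous 1), F).
    replace (transfer H beta f) with (fun x => / s * N f x)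
      by (apply functional_extensionality; intros; unfold N, norm_transfer; field; lra).
    rewrite Sc by exact CN. f_equal.
    apply lim_unique with (1 := eigenmeasure_lim _ CN).
    apply is_lim_seq_ext with (fun n => atomic (Nat.iter (S n) N f)).
    + intros n. rewrite Nat.iter_succ_r. reflexivity.
    + apply (is_lim_seq_incr_1 (fun n => atomic (Nat.iter n N f))), eigenmeasure_lim, F.
Qed.
End Existence.

(** The root s makes the explicit eigenfunction and the limit functional available; dividing by the
    maximum of the eigenfunction gives the required normalization. *)
Lemma gibbs_exists (H : Sigma -> R) (b : bool -> nat -> R) (beta : R) :
  block_potential H (fun _ _ => 0) b -> (forall i, H (scons i (const_pt (negb i))) = 0) ->
  0 < beta -> (forall i n, (1 <= n)%nat -> b i n <= (/ 2) ^ n) ->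
  exists mu, is_gibbs H beta mu.
Proof.
  intros HP Hx Hb Hbn.
  (* The wells are at most 1, so exp(-beta) is a uniform lower bound of the coefficients. *)
  destruct (characteristic_root (fun i n => exp (- beta * b i n)) (exp (- beta)))
    as [s [S0 [S1 [Hs [H0 [H1 E]]]]]]; [apply exp_pos| |].
  { intros i n L. pose proof (Hbn i n L). pose proof (pow_unit (/ 2) n ltac:(lra)).
    pose proof (proj2 (proj1 (proj2 (proj2 (proj2 HP))) i n L)).
    split; [|rewrite <- exp_0]; apply exp_le_compat; nra. }
  set (Sf := fun i : bool => if i then S1 else S0).
  assert (HS : forall i, hassum (fun n => exp (- beta * b i n) * s ^ n) (Sf i))
    by (intros []; assumption).
  set (e := eigen b beta s Sf).
  pose proof (eigen_continuous H b beta s Sf HP Hb Hbn Hs HS) as Ce. fold e in Ce.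
  pose proof (eigen_pos H b beta s Sf HP Hb Hbn Hs HS) as Pe. fold e in Pe.
  destruct (continuous_S_max e Ce) as [z Hz]. pose proof (Pe z) as Pz.
  set (Phi := fun x => / e z * e x).
  assert (CP : continuous_S Phi) by (unfold Phi; auto with cont).
  assert (iz : 0 < / e z) by (apply Rinv_0_lt_compat; exact Pz).
  exists (fun f => eigenmeasure H beta s Sf (fun x => Phi x * f x)
                   / eigenmeasure H beta s Sf Phi).
  exists Phi, (/ s), (eigenmeasure H beta s Sf). split; [|split].
  - split; [exact CP|]. split; [|split; [|split; [|split]]].
    + intros x. apply Rmult_lt_0_compat; [exact iz|apply Pe].
    + intros x. unfold Phi. apply Rmult_le_reg_l with (e z); [exact Pz|].
      rewrite <- Rmult_assoc, Rinv_r by lra. specialize (Hz x). lra.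
    + exists z. unfold Phi. apply Rinv_l. lra.
    + apply Rinv_0_lt_compat. lra.
    + intros x. unfold Phi.
      pose proof (eigen_equation H b beta s Sf HP Hx Hs E x) as Eq. fold e in Eq.
      unfold norm_transfer in Eq. rewrite <- Eq. unfold transfer. field. lra.
  - apply (eigenmeasure_correct H b beta s Sf HP Hx Hb Hbn Hs HS E).
  - reflexivity.
Qed.

(** * A potential without selection *)

(** One factor: exp(2t) >= 1 + 2t and (1 - t)(1 + 2t) >= 1 for t <= 1/2. *)
Lemma pow_one_minus_ge (t : R) (N : nat) : 0 <= t <= / 2 -> exp (- (2 * t * INR N)) <= (1 - t) ^ N.
Proof.
  intros Ht.
  assert (E : exp (- (2 * t)) <= 1 - t).
  { rewrite exp_Ropp. pose proof (exp_ineq1_le (2 * t)).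
    apply Rmult_le_reg_r with (exp (2 * t)); [apply exp_pos|].
    rewrite Rinv_l by (pose proof (exp_pos (2 * t)); lra). nra. }
  induction N as [|N IH].
  - simpl. rewrite Rmult_0_r, Ropp_0, exp_0. lra.
  - rewrite S_INR. replace (- (2 * t * (INR N + 1))) with (- (2 * t) + - (2 * t * INR N)) by ring.
    rewrite exp_plus. simpl. apply Rmult_le_compat; auto; left; apply exp_pos.
Qed.

Lemma cut_sum_lower (c : nat -> R) (s S : R) (K : nat) : 0 < s < 1 ->
  (forall n, (1 <= n)%nat -> 0 <= c n) -> (forall n, (K < n)%nat -> exp (-1) <= c n) ->
  hassum (fun n => c n * s ^ n) S -> exp (-1) * s ^ (Datatypes.S K) / (1 - s) <= S.
Proof.
  intros Hs Hc HK HS.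
  pose proof (hassum_drop _ _ K HS) as D.
  assert (P : 0 <= psum (fun n => c n * s ^ n) K).
  { apply psum_nonneg. intros n L. apply Rmult_le_pos; [apply Hc, L|]. left. apply pow_unit, Hs. }
  pose proof (hassum_scal (exp (-1) * s ^ K) _ _ (hassum_geom s Hs)) as G.
  assert (A : exp (-1) * s ^ K * (s / (1 - s)) <= S - psum (fun n => c n * s ^ n) K).
  { refine (hassum_le _ _ _ _ _ G D). intros n L. cbv beta. rewrite pow_add.
    replace (exp (-1) * s ^ K * s ^ n) with (exp (-1) * (s ^ n * s ^ K)) by ring.
    apply Rmult_le_compat_r; [|apply HK; lia].
    apply Rmult_le_pos; left; apply pow_unit, Hs. }
  replace (exp (-1) * s ^ Datatypes.S K / (1 - s)) with (exp (-1) * s ^ K * (s / (1 - s)))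
    by (simpl; field; lra). lra.
Qed.

(* If the coefficients c are negligible below N and those of c' are of order one from N' << N on,
   the equation S S' = 1 forces 1 - s >> 1/N, so the mean T/S of the first law is of order N
   while that of the second is at most N' + O(1/(1-s)). *)
Lemma unbalanced_ratio (c c' : nat -> R) (s S S' T T' A eps : R) (N N' : nat) :
  0 < s < 1 -> 1 <= A -> (1 <= N')%nat ->
  (forall n, (1 <= n)%nat -> 0 <= c n <= 1) -> (forall n, (1 <= n)%nat -> 0 <= c' n <= 1) ->
  (forall n, (1 <= n < N)%nat -> c n <= eps) -> 2 * INR N ^ 2 * eps <= 1 ->
  (forall n, (N <= n)%nat -> exp (-1) <= c n) -> (forall n, (N' <= n)%nat -> exp (-1) <= c' n) ->
  A * INR N' <= INR N -> A * exp (1 + 2 * A) <= INR N ->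
  hassum (fun n => c n * s ^ n) S -> hassum (fun n => c' n * s ^ n) S' ->
  hassum (fun n => INR n * (c n * s ^ n)) T -> hassum (fun n => INR n * (c' n * s ^ n)) T' ->
  S * S' = 1 ->
  0 < S /\ 0 < S' /\ 0 < T /\ INR N * S <= 2 * T /\ T' * S * A <= 8 * (S' * T).
Proof.
  intros Hs HA LN' Hc Hc' Hsmall Heps Hbig Hbig' HAN' HAN HS HS' HT HT' SS.
  set (t := 1 - s). assert (Ht : 0 < t < 1) by (unfold t; lra).
  assert (L2 : (N' <= N)%nat).
  { apply INR_le. assert (0 <= INR N') by apply pos_INR. nra. }
  assert (N1 : 1 <= INR N) by (apply (le_INR 1); lia).
  destruct N as [|K]; [lia|]. destruct N' as [|K']; [lia|].
  set (n := INR (Datatypes.S K)) in *. set (n' := INR (Datatypes.S K')) in *.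
  pose proof (cut_sum_lower c s S K Hs (fun k L => proj1 (Hc k L)) (fun k L => Hbig k L) HS) as B.
  pose proof (cut_sum_lower c' s S' K' Hs (fun k L => proj1 (Hc' k L)) (fun k L => Hbig' k L) HS')
    as B'.
  pose proof (cut_sum_lower c' s S' K Hs (fun k L => proj1 (Hc' k L))
    (fun k L => Hbig' k ltac:(lia)) HS') as B2.
  fold t in B, B', B2.
  assert (Pw : forall k, 0 < exp (-1) * s ^ k / t).
  { intros k. apply Rdiv_lt_0_compat; [|lra].
    apply Rmult_lt_0_compat; [apply exp_pos|apply pow_lt; lra]. }
  pose proof (Pw (Datatypes.S K)) as P1. pose proof (Pw (Datatypes.S K')) as P2.
  assert (SP : 0 < S) by lra. assert (SP' : 0 < S') by lra.
  (* Both S and S' are at least exp(-1) s^n / t, because the cut of c' comes before that of c; their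
     product is 1, so this number is at most 1. *)
  assert (tlow : exp (-1) * s ^ Datatypes.S K <= t).
  { set (X := exp (-1) * s ^ Datatypes.S K) in *.
    assert (XX : X / t * (X / t) <= 1) by (rewrite <- SS; apply Rmult_le_compat; lra).
    assert (X / t <= 1) by nra.
    apply Rmult_le_reg_r with (/ t); [apply Rinv_0_lt_compat; lra|].
    rewrite Rinv_r by lra. exact H. }
  assert (eA : 1 + (1 + 2 * A) <= exp (1 + 2 * A)) by apply exp_ineq1_le.
  (* If t n < A, then s^n >= exp(-2A), so [tlow] gives t >= exp(-(1+2A)), and n >= A exp(1+2A)
     yields t n >= A after all. *)
  assert (tn : A <= t * n).
  { apply Rnot_lt_le. intros C.
    assert (t <= / 2).
    { assert (2 * A <= n) by nra. nra. }
    pose proof (pow_one_minus_ge t (Datatypes.S K) ltac:(lra)) as Q. fold n in Q.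
    replace (1 - t) with s in Q by (unfold t; ring).
    assert (exp (- (1 + 2 * A)) <= t).
    { eapply Rle_trans; [|exact tlow].
      replace (- (1 + 2 * A)) with (-1 + - (2 * A)) by ring. rewrite exp_plus.
      apply Rmult_le_compat_l; [left; apply exp_pos|].
      eapply Rle_trans; [|exact Q]. apply exp_le_compat. lra. }
    rewrite exp_Ropp in *.
    assert (A <= t * n); [|lra].
    apply Rle_trans with (/ exp (1 + 2 * A) * (A * exp (1 + 2 * A))).
    - right. field. pose proof (exp_pos (1 + 2 * A)). lra.
    - pose proof (exp_pos (1 + 2 * A)). apply Rmult_le_compat; try lra; [|nra].
      left. apply Rinv_0_lt_compat. lra. }
  assert (St : t <= S).
  { assert (S' <= s / (1 - s)).
    { refine (hassum_le _ _ _ _ _ HS' (hassum_geom s Hs)). intros k L.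
      pose proof (pow_unit s k Hs). specialize (Hc' k L). nra. }
    fold t in H. assert (S' * t <= 1).
    { apply Rle_trans with (s / t * t); [apply Rmult_le_compat_r; lra|].
      replace (s / t * t) with s by (field; lra). lra. }
    assert (t * (S * S') <= S * 1) by nra. rewrite SS in *. lra. }
  set (pK := psum (fun k => c k * s ^ k) K).
  (* The terms before the cut sum to at most n eps, which is at most t/2 since 2 n^2 eps <= 1 <= t
     n, and t <= S. So at least half of S sits at indices from n on, whence T >= n S / 2. *)
  assert (HpK : pK <= S / 2).
  { assert (E0 : pK <= INR K * eps).
    { assert (forall k, (k <= K)%nat -> psum (fun k => c k * s ^ k) k <= INR k * eps).
      { induction k as [|k IH]; intros Lk; [simpl; lra|].
        cbn [psum]. rewrite S_INR. specialize (IH ltac:(lia)).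
        pose proof (pow_unit s (Datatypes.S k) Hs) as U.
        pose proof (Hc (Datatypes.S k) ltac:(lia)). pose proof (Hsmall (Datatypes.S k) ltac:(lia)).
        assert (c (Datatypes.S k) * s ^ Datatypes.S k <= c (Datatypes.S k) * 1)
          by (apply Rmult_le_compat_l; lra). lra. }
      apply H. lia. }
    destruct K as [|K]; [unfold pK; simpl; lra|].
    assert (0 <= eps).
    { specialize (Hc 1%nat ltac:(lia)). specialize (Hsmall 1%nat ltac:(lia)). lra. }
    assert (INR (Datatypes.S K) <= n) by (apply le_INR; lia).
    assert (INR (Datatypes.S K) * eps <= n * eps) by (apply Rmult_le_compat_r; lra).
    assert (2 * (n * eps) <= t); [|lra].
    apply Rmult_le_reg_r with n; [lra|]. nra. }
  assert (TB : n * S <= 2 * T).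
  { pose proof (hassum_drop _ _ K HT) as D. pose proof (hassum_drop _ _ K HS) as D2.
    assert (0 <= psum (fun k => INR k * (c k * s ^ k)) K).
    { apply psum_nonneg. intros k L. pose proof (pow_unit s k Hs). specialize (Hc k L).
      apply Rmult_le_pos; [apply pos_INR|]. apply Rmult_le_pos; lra. }
    assert (n * (S - pK) <= T - psum (fun k => INR k * (c k * s ^ k)) K).
    { refine (hassum_le _ _ _ _ _ (hassum_scal n _ _ D2) D). intros k L. cbv beta.
      pose proof (pow_unit s (k + K) Hs). pose proof (Hc (k + K)%nat ltac:(lia)).
      apply Rmult_le_compat_r; [apply Rmult_le_pos; lra|]. apply le_INR. lia. }
    nra. }
  assert (TP : 0 < T) by nra.
  (* In T' - n' S' the terms up to n' are not positive, and those beyond it sum to at most s^n' s /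
     t^2. The lower bound exp(-1) s^n' / t of S' absorbs this; the 3 comes from exp(1) <= 3. *)
  assert (T'B : T' <= S' * (n' + 3 / t)).
  { pose proof (hassum_minus _ _ _ _ HT' (hassum_scal n' _ _ HS')) as D.
    pose proof (hassum_drop _ _ (Datatypes.S K') D) as D2.
    assert (Neg : psum (fun k => INR k * (c' k * s ^ k) - n' * (c' k * s ^ k)) (Datatypes.S K') <= 0).
    { assert (Aux : forall k, (k <= Datatypes.S K')%nat ->
        psum (fun k => INR k * (c' k * s ^ k) - n' * (c' k * s ^ k)) k <= 0).
      { induction k as [|k IH]; intros Lk; [simpl; lra|].
        cbn [psum]. specialize (IH ltac:(lia)).
        pose proof (pow_unit s (Datatypes.S k) Hs). pose proof (Hc' (Datatypes.S k) ltac:(lia)).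
        assert (INR (Datatypes.S k) <= n') by (apply le_INR; lia).
        assert (0 <= c' (Datatypes.S k) * s ^ Datatypes.S k) by (apply Rmult_le_pos; lra). nra. }
      apply Aux. lia. }
    pose proof (hassum_scal (s ^ Datatypes.S K') _ _ (hassum_n_geom s Hs)) as G.
    assert (U : T' - n' * S' - psum (fun k => INR k * (c' k * s ^ k) - n' * (c' k * s ^ k)) (Datatypes.S K')
                <= s ^ Datatypes.S K' * (s / (1 - s) / (1 - s))).
    { refine (hassum_le _ _ _ _ _ D2 G). intros k L. cbv beta. rewrite plus_INR. fold n'.
      rewrite pow_add. pose proof (Hc' (k + Datatypes.S K')%nat ltac:(lia)).
      pose proof (pow_unit s k Hs). pose proof (pow_unit s (Datatypes.S K') Hs).
      pose proof (pos_INR k).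
      replace ((INR k + n') * (c' (k + Datatypes.S K')%nat * (s ^ k * s ^ Datatypes.S K')) -
        n' * (c' (k + Datatypes.S K')%nat * (s ^ k * s ^ Datatypes.S K')))
        with (c' (k + Datatypes.S K')%nat * (s ^ Datatypes.S K' * (INR k * s ^ k))) by ring.
      assert (0 <= s ^ Datatypes.S K' * (INR k * s ^ k))
        by (apply Rmult_le_pos; [|apply Rmult_le_pos]; lra). nra. }
    fold t in U.
    assert (V : s ^ Datatypes.S K' * (s / t / t) <= S' * (3 / t)).
    { set (Q := s ^ Datatypes.S K') in *. assert (0 < Q) by (apply pow_lt; lra).
      assert (e3 : 1 <= exp (-1) * 3).
      { pose proof exp_le_3. replace (-1) with (- (1)) by ring. rewrite exp_Ropp.
        pose proof (exp_pos 1). apply Rmult_le_reg_l with (exp 1); [lra|].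
        rewrite <- Rmult_assoc, Rinv_r; lra. }
      apply Rle_trans with (exp (-1) * Q / t * (3 / t)).
      - replace (exp (-1) * Q / t * (3 / t)) with (Q * ((exp (-1) * 3) / t / t)) by (field; lra).
        apply Rmult_le_compat_l; [lra|].
        assert (0 < / t) by (apply Rinv_0_lt_compat; lra).
        apply Rmult_le_compat_r; [lra|]. apply Rmult_le_compat_r; lra.
      - apply Rmult_le_compat_r; [|exact B'].
        apply Rlt_le, Rdiv_lt_0_compat; lra. }
    lra. }
  repeat (split; [assumption|]).
  assert (It : A / t <= n).
  { apply Rmult_le_reg_r with t; [lra|]. replace (A / t * t) with A by (field; lra). lra. }
  assert (A * (n' + 3 / t) <= 4 * n).
  { replace (A * (n' + 3 / t)) with (A * n' + 3 * (A / t)) by (field; lra). lra. }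
  apply Rle_trans with (S' * (n' + 3 / t) * S * A).
  - apply Rmult_le_compat_r; [lra|]. apply Rmult_le_compat_r; lra.
  - apply Rle_trans with (S' * S * (4 * n)).
    + replace (S' * (n' + 3 / t) * S * A) with (S' * S * (A * (n' + 3 / t))) by ring.
      apply Rmult_le_compat_l; [apply Rmult_le_pos; lra|assumption].
    + replace (S' * S * (4 * n)) with (4 * S' * (n * S)) by ring.
      replace (8 * (S' * T)) with (4 * S' * (2 * T)) by ring.
      apply Rmult_le_compat_l; lra.
Qed.

(* The wells of the example are b i n = 2^-M_j, where M_j > n is the next switching point whose
   index j has parity i: the two sequences drop at alternate, rapidly growing, places. *)
Definition switch (k : nat) : nat := fact (k + 2).

Fixpoint next_switch (i : bool) (n : nat) : nat :=
  match n with
  | O => if i then 1%nat else 0%nat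
  | S m => let j := next_switch i m in if Nat.leb (switch j) (S m) then (j + 2)%nat else j
  end.

(** The value at 0 is the one read on an infinite run, whose [run_len] is 0; it is the limit of the
    wells. *)
Definition well (i : bool) (n : nat) : R :=
  match n with O => 0 | _ => (/ 2) ^ switch (next_switch i n) end.

Definition alternating (x : Sigma) : R :=
  if Bool.eqb (x 0%nat) (x 1%nat) then 0 else well (x 0%nat) (run_len (shift x)).

Lemma switch_S (k : nat) : switch (S k) = ((k + 3) * switch k)%nat.
Proof.
  unfold switch. replace (S k + 2)%nat with (S (k + 2)) by lia.
  change (fact (S (k + 2))) with (S (k + 2) * fact (k + 2))%nat. f_equal. lia.
Qed.

Lemma switch_pos (k : nat) : (1 <= switch k)%nat.
Proof. apply lt_O_fact. Qed.

Lemma switch_lt (k : nat) : (switch k < switch (S k))%nat.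
Proof. rewrite switch_S. pose proof (switch_pos k). nia. Qed.

Lemma switch_mono (j k : nat) : (j <= k)%nat -> (switch j <= switch k)%nat.
Proof.
  intros L. induction L as [|k L IH]; [lia|]. pose proof (switch_lt k). lia.
Qed.

Lemma switch_ge (k : nat) : (k < switch k)%nat.
Proof. induction k as [|k IH]; [apply switch_pos|]. pose proof (switch_lt k). lia. Qed.

Lemma odd_add_2 (j : nat) : Nat.odd (j + 2) = Nat.odd j.
Proof. rewrite Nat.odd_add. simpl. destruct (Nat.odd j); reflexivity. Qed.

Lemma next_switch_spec (i : bool) (n : nat) :
  Nat.odd (next_switch i n) = i /\ (n < switch (next_switch i n))%nat /\
  forall j, Nat.odd j = i -> (n < switch j)%nat -> (next_switch i n <= j)%nat.
Proof.
  induction n as [|n [O [L Min]]].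
  - split; [destruct i; reflexivity|]. split; [apply switch_pos|].
    intros j Oj _. destruct i; simpl; [|lia]. destruct j; [discriminate Oj|lia].
  - simpl. set (j0 := next_switch i n) in *. destruct (Nat.leb_spec (switch j0) (S n)) as [E|E].
    + split; [rewrite odd_add_2; exact O|]. split.
      * pose proof (switch_lt j0). pose proof (switch_lt (S j0)).
        replace (j0 + 2)%nat with (S (S j0)) by lia. lia.
      * intros j Oj Lj. pose proof (Min j Oj ltac:(lia)) as M.
        assert (j <> j0) by (intros ->; lia).
        assert (j <> S j0).
        { intros ->. rewrite Nat.odd_succ, <- Nat.negb_odd, O in Oj. destruct i; discriminate Oj. }
        lia.
    + split; [exact O|]. split; [exact E|]. intros j Oj Lj. apply Min; [exact Oj|lia].
Qed.

Lemma half_pow_anti (n m : nat) : (n <= m)%nat -> (/ 2) ^ m <= (/ 2) ^ n.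
Proof.
  intros L. replace m with (m - n + n)%nat by lia. rewrite pow_add.
  pose proof (pow_unit (/ 2) (m - n) ltac:(lra)). pose proof (pow_unit (/ 2) n ltac:(lra)). nra.
Qed.

Lemma well_pos (i : bool) (n : nat) : (1 <= n)%nat -> 0 < well i n.
Proof. intros L. destruct n; [lia|]. apply pow_lt. lra. Qed.

Lemma well_le (i : bool) (n : nat) : 0 <= well i n <= (/ 2) ^ n.
Proof.
  destruct n as [|n]; [simpl; lra|]. split; [left; apply well_pos; lia|].
  apply half_pow_anti. pose proof (next_switch_spec i (S n)). lia.
Qed.

Lemma well_anti (i : bool) (n m : nat) : (m <= n)%nat -> well i n <= (/ 2) ^ m.
Proof.
  intros L. eapply Rle_trans; [apply well_le|]. apply half_pow_anti, L.
Qed.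

Lemma alternating_scons (i : bool) (n : nat) (x : Sigma) : (1 <= n)%nat ->
  (run i n x = true -> alternating (scons i x) = 0) /\
  (run (negb i) n x = true -> alternating (scons i x) = well i n).
Proof.
  intros L. unfold alternating. change (shift (scons i x)) with x. simpl. split; intros R.
  - rewrite (run_first _ _ _ L R), Bool.eqb_reflx. reflexivity.
  - rewrite (run_len_run _ _ _ L R), (run_first _ _ _ L R). destruct i; reflexivity.
Qed.

Lemma alternating_const (i j : bool) : alternating (scons i (const_pt j)) = 0.
Proof.
  unfold alternating. change (shift (scons i (const_pt j))) with (const_pt j).
  rewrite run_len_const. destruct Bool.eqb; reflexivity.
Qed.

Lemma alternating_nonneg (x : Sigma) : 0 <= alternating x <= 1.
Proof.
  unfold alternating. destruct Bool.eqb; [lra|].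
  pose proof (well_le (x O) (run_len (shift x))).
  pose proof (pow_unit (/ 2) (run_len (shift x)) ltac:(lra)). lra.
Qed.

(** Points that agree on n + 2 letters give the same run length, unless both runs are infinite or
    longer than n; then both values are at most 2^-(n+1). This one estimate serves continuity,
    summable variation and the Lipschitz condition. *)
Lemma alternating_variation (n : nat) (x y : Sigma) : agree n x y ->
  Rabs (alternating x - alternating y) <= 4 * (/ 2) ^ n.
Proof.
  intros A. pose proof (alternating_nonneg x) as Bx. pose proof (alternating_nonneg y) as By.
  destruct n as [|[|n]]; [apply Rabs_le; simpl; lra|apply Rabs_le; simpl; lra|].
  assert (Bd : forall u, (run_len (shift u) = O \/ (S n <= run_len (shift u))%nat) ->
            alternating u <= (/ 2) ^ S n).
  { intros u E. unfold alternating. pose proof (pow_lt (/ 2) (S n) ltac:(lra)).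
    destruct Bool.eqb; [lra|]. destruct E as [->|L]; [simpl well; lra|].
    apply well_anti, L. }
  assert (Eq : forall u v, agree (S (S n)) u v -> (1 <= run_len (shift u) < S n)%nat ->
            run_len (shift v) = run_len (shift u)).
  { intros u v Au L. destruct (run_len_spec (shift u)) as [[_ R]|[Z _]]; [|lia].
    apply (run_len_run (shift u O)); [lia|].
    rewrite <- (run_agree _ _ (shift u) (shift v)); [exact R|].
    apply (agree_le _ (S n)); [lia|]. apply agree_shift, Au. }
  assert (E0 : x 0%nat = y 0%nat) by (apply A; lia).
  assert (E1 : x 1%nat = y 1%nat) by (apply A; lia).
  pose proof (pow_lt (/ 2) (S (S n)) ltac:(lra)).
  assert (Same : run_len (shift x) = run_len (shift y) -> alternating x = alternating y).
  { intros E. unfold alternating. rewrite E0, E1, E. reflexivity. }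
  assert (D : forall u, (1 <= run_len (shift u) < S n)%nat \/
            (run_len (shift u) = O \/ (S n <= run_len (shift u))%nat)) by (intros; lia).
  destruct (D x) as [Dx|Dx].
  { rewrite Same by (symmetry; apply (Eq x y A Dx)). rewrite Rminus_diag, Rabs_R0. lra. }
  destruct (D y) as [Dy|Dy].
  { rewrite Same by (apply (Eq y x (agree_sym _ _ _ A) Dy)). rewrite Rminus_diag, Rabs_R0. lra. }
  apply Bd in Dx, Dy. simpl pow in *. apply Rabs_le. lra.
Qed.

Lemma alternating_continuous : continuous_S alternating.
Proof.
  intros x eps He.
  destruct (pow_lt_1_zero (/ 2)) with (y := eps / 4) as [M HM];
    [rewrite Rabs_pos_eq; lra|lra|].
  exists M. intros y A. eapply Rle_lt_trans; [apply (alternating_variation M x y A)|].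
  specialize (HM M (Nat.le_refl M)). rewrite Rabs_pos_eq in HM by (left; apply pow_lt; lra). lra.
Qed.

Lemma psum_half (N : nat) : psum (fun n => (/ 2) ^ n) N <= 1.
Proof.
  replace 1 with (/ 2 / (1 - / 2)) by field.
  apply psum_le_sum; [|apply hassum_geom; lra]. intros. left. apply pow_lt. lra.
Qed.

Lemma alternating_block : block_potential alternating (fun _ _ => 0) well.
Proof.
  split; [apply alternating_continuous|]. split; [apply alternating_nonneg|].
  split; [intros i; rewrite <- (scons_const i); apply alternating_const|].
  split; [intros i n L; pose proof (well_pos i n L); lra|].
  split; intros i n x L R; apply (alternating_scons i n x L); exact R.
Qed.

Lemma alternating_double_well :
  double_well alternating (fun _ => 0) (fun _ => 0) (well false) (well true).
Proof.
  assert (Z : summable (fun n => INR n * 0)).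
  { split; [intros; lra|]. exists 0. intros N.
    rewrite (psum_ext _ (fun _ => 0)), psum_zero; [lra|intros; ring]. }
  assert (TS : forall i, tail_summable (well i)).
  { intros i. exists (fun n => (/ 2) ^ n). split.
    - split; [intros; left; apply pow_lt; lra|]. exists 1. apply psum_half.
    - intros k n L. pose proof (well_le i k).
      pose proof (well_le i (k + n)). pose proof (well_anti i (k + n) k ltac:(lia)).
      apply Rabs_le. lra. }
  assert (W : forall i n x, (1 <= n)%nat -> x O = i -> (forall j, (1 <= j <= n)%nat -> x j = negb i) ->
            x (S n) = i -> alternating x = well i n).
  { intros i n x L X0 X1 X2. unfold alternating. rewrite X0, (X1 1%nat) by lia.
    rewrite (run_len_run (negb i) n (shift x) L).
    - destruct i; reflexivity.
    - apply run_spec. unfold shift. rewrite Bool.negb_involutive. split; [|exact X2].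
      intros j J. apply X1. lia. }
  assert (V : forall i n x, (1 <= n)%nat -> (forall j, (j <= n)%nat -> x j = i) ->
            alternating x = 0).
  { intros i n x L X. unfold alternating. rewrite !X, Bool.eqb_reflx by lia. reflexivity. }
  split; [apply alternating_continuous|]. split; [apply alternating_nonneg|].
  split.
  { exists (fun n => 4 * (/ 2) ^ n). split.
    - split; [intros n _; pose proof (pow_lt (/ 2) n ltac:(lra)); lra|].
      exists 4. intros N. rewrite (psum_scal 4 (fun n => (/ 2) ^ n)). pose proof (psum_half N). lra.
    - intros n x y _ A. apply alternating_variation, A. }
  split; [intros n L; pose proof (well_pos false n L); pose proof (well_pos true n L); lra|].
  split; [intros n x L [X _]; exact (V false n x L X)|].
  split; [intros n x L [X _]; exact (V true n x L X)|].
  split; [intros n x L [X0 [X1 X2]]; exact (W false n x L X0 X1 X2)|].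
  split; [intros n x L [X0 [X1 X2]]; exact (W true n x L X0 X1 X2)|].
  repeat split; try apply Z; try apply TS.
Qed.

Lemma well_Hinf (i : bool) : is_Hinf (well i) (fun _ => 0) 0.
Proof.
  exists 0, 0. split; [|split; [|ring]]; apply is_lim_seq_Reals.
  - apply is_lim_seq_le_le with (fun _ => 0) (fun n => (/ 2) ^ n);
      [apply well_le|apply is_lim_seq_const|].
    apply is_lim_seq_geom. rewrite Rabs_pos_eq; lra.
  - exact hassum_zero.
Qed.

(** At this temperature 2^-M with M = [switch (S k)] is still a high barrier, as beta 2^-M = 8^M.
    The wells with the next exponent are already negligible: that exponent is at least 4M, and 16 =
    2^4. *)
Definition switch_beta (k : nat) : R := 16 ^ switch (S k).

(** The wells with the parity of k + 1 are cut at [switch (S k)], and the others already at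
    [switch k]; beyond its cut, the next switching index of either family is at least k + 2. *)
Lemma switch_beta_cut (i : bool) (k n : nat) : (1 <= n)%nat ->
  (Nat.odd (S k) = i -> (n < switch (S k))%nat ->
     exp (- switch_beta k * well i n) <= exp (- 8 ^ switch (S k))) /\
  (Nat.odd (S k) = i -> (switch (S k) <= n)%nat -> exp (-1) <= exp (- switch_beta k * well i n)) /\
  (Nat.odd k = i -> (switch k <= n)%nat -> exp (-1) <= exp (- switch_beta k * well i n)).
Proof.
  intros L. destruct (next_switch_spec i n) as [Oj [Lj Min]].
  set (j := next_switch i n) in *.
  assert (W : well i n = (/ 2) ^ switch j) by (unfold well; destruct n; [lia|reflexivity]).
  rewrite W. unfold switch_beta.
  assert (Big : (S (S k) <= j)%nat -> exp (-1) <= exp (- 16 ^ switch (S k) * (/ 2) ^ switch j)).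
  { intros Lk. apply exp_le_compat.
    assert ((/ 2) ^ switch j <= (/ 2) ^ (4 * switch (S k))).
    { apply half_pow_anti. apply switch_mono in Lk. rewrite (switch_S (S k)) in Lk.
      eapply Nat.le_trans; [|exact Lk]. apply Nat.mul_le_mono_r. lia. }
    assert (E : 16 ^ switch (S k) * (/ 2) ^ (4 * switch (S k)) = 1).
    { rewrite pow_mult, <- Rpow_mult_distr. replace (16 * (/ 2) ^ 4) with 1 by (simpl; field).
      apply pow1. }
    pose proof (pow_lt 16 (switch (S k)) ltac:(lra)). nra. }
  split; [|split].
  - intros E Ln. apply exp_le_compat. pose proof (Min (S k) E Ln) as M.
    apply switch_mono, half_pow_anti in M.
    assert (E8 : 16 ^ switch (S k) * (/ 2) ^ switch (S k) = 8 ^ switch (S k)).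
    { rewrite <- Rpow_mult_distr. apply (f_equal (fun u => u ^ _)). field. }
    pose proof (pow_lt 16 (switch (S k)) ltac:(lra)). nra.
  - intros E Ln. apply Big. apply Nat.nlt_ge. intros C.
    assert (M : (switch j <= switch (S k))%nat) by (apply switch_mono; lia). lia.
  - intros E Ln. apply Big.
    assert (k < j)%nat.
    { apply Nat.nle_gt. intros C. apply switch_mono in C. lia. }
    assert (j <> S k).
    { intros C. rewrite C, Nat.odd_succ, <- Nat.negb_odd, E in Oj. destruct i; discriminate Oj. }
    lia.
Qed.

(** From N + 1 <= 2^N one gets 2 N^2 <= 8^N, and 8^N is below its exponential. This is the smallness
    before the cut that [unbalanced_ratio] asks for. *)
Lemma exp_pow8 (N : nat) : (1 <= N)%nat -> 2 * INR N ^ 2 * exp (- 8 ^ N) <= 1.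
Proof.
  intros L.
  assert (B : INR N + 1 <= 2 ^ N).
  { clear L. induction N as [|N IH]; [simpl; lra|]. rewrite S_INR. simpl. pose proof (pos_INR N). lra. }
  pose proof (pos_INR N).
  assert (E : 8 ^ N = 2 ^ N * (2 ^ N * 2 ^ N)).
  { rewrite <- !Rpow_mult_distr. apply (f_equal (fun u => u ^ N)). ring. }
  assert (1 <= INR N) by (apply (le_INR 1), L).
  assert (2 * INR N ^ 2 <= 8 ^ N).
  { rewrite E. assert (INR N * INR N <= 2 ^ N * 2 ^ N) by (apply Rmult_le_compat; lra).
    assert (2 * (INR N * INR N) <= 2 ^ N * (2 ^ N * 2 ^ N))
      by (apply Rmult_le_compat; nra). simpl. lra. }
  pose proof (exp_ineq1_le (8 ^ N)). rewrite exp_Ropp.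
  pose proof (exp_pos (8 ^ N)). apply Rmult_le_reg_r with (exp (8 ^ N)); [assumption|].
  rewrite Rmult_assoc, Rinv_l by lra. lra.
Qed.

Lemma alternating_mass (delta : R) : 0 < delta -> exists K, forall k mu, (K <= k)%nat ->
  is_gibbs alternating (switch_beta k) mu ->
  is_prob_functional mu /\
  Rabs (mu (fun x => indic (Bool.eqb (x O) false)) - (if Nat.odd k then 0 else 1)) < delta /\
  forall i n, (1 <= n)%nat -> mu (fun x => indic (run i n x)) < delta.
Proof.
  intros Hd.
  (* Chosen so that A delta exceeds the constant 8 of [unbalanced_ratio]. *)
  set (A := 1 + 9 / delta).
  assert (Q : 0 < 9 / delta) by (apply Rdiv_lt_0_compat; lra).
  assert (AD : 8 < A * delta).
  { unfold A. replace ((1 + 9 / delta) * delta) with (delta + 9) by (field; lra). lra. }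
  assert (HA : 1 <= A) by (unfold A; lra).
  (* A single K serves two conditions: [switch (S k)] exceeds k, and the ratio k + 3 of consecutive
     switches exceeds A. *)
  destruct (INR_unbounded (A * exp (1 + 2 * A))) as [K HK].
  exists K. intros k mu Lk G.
  assert (Hb : 0 < switch_beta k) by (apply pow_lt; lra).
  destruct (gibbs_masses _ _ _ _ _ alternating_block Hb G)
    as [P [s [S [T [Hs [Sums [SS [Mass Runs]]]]]]]].
  split; [exact P|].
  set (c := fun i n => exp (- switch_beta k * well i n)).
  assert (We : forall i n, weight (fun _ _ => 0) well (switch_beta k) s i n = c i n * s ^ n).
  { intros i n. unfold weight, level, Hn, c. rewrite psum_zero, Rplus_0_r. reflexivity. }
  assert (HS : forall i, hassum (fun n => c i n * s ^ n) (S i)).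
  { intros i. apply hassum_ext with (2 := proj1 (Sums i)). intros n _. apply We. }
  assert (HT : forall i, hassum (fun n => INR n * (c i n * s ^ n)) (T i)).
  { intros i. apply hassum_ext with (2 := proj1 (proj2 (Sums i))). intros n _. rewrite We.
    reflexivity. }
  assert (Hc : forall i n, (1 <= n)%nat -> 0 <= c i n <= 1).
  { intros i n L. split; [left; apply exp_pos|]. unfold c. rewrite <- exp_0.
    apply exp_le_compat. pose proof (well_pos i n L). nra. }
  (* The letter with the later cut; the mass goes to the fixed point of the other letter, which is
     the parity of k. *)
  set (i := Nat.odd (Datatypes.S k)).
  assert (Oi : Nat.odd k = negb i).
  { unfold i. rewrite Nat.odd_succ, <- Nat.negb_odd, Bool.negb_involutive. reflexivity. }
  pose proof (switch_pos k) as Sp. pose proof (switch_pos (Datatypes.S k)) as Sp'.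
  assert (AexpN : A * exp (1 + 2 * A) <= INR (switch (Datatypes.S k))).
  { apply Rle_trans with (INR K); [lra|]. apply le_INR.
    pose proof (switch_ge (Datatypes.S k)). lia. }
  assert (AN : A * INR (switch k) <= INR (switch (Datatypes.S k))).
  { rewrite switch_S, mult_INR. apply Rmult_le_compat_r; [apply pos_INR|].
    assert (INR K <= INR (k + 3)) by (apply le_INR; lia).
    pose proof (exp_ineq1_le (1 + 2 * A)). nra. }
  assert (SS' : S i * S (negb i) = 1) by (destruct i; simpl; lra).
  destruct (unbalanced_ratio (c i) (c (negb i)) s (S i) (S (negb i)) (T i) (T (negb i)) A
    (exp (- 8 ^ switch (Datatypes.S k))) (switch (Datatypes.S k)) (switch k)
    Hs HA Sp (Hc i) (Hc (negb i))) as [PS [PS' [PT [B1 B2]]]]; auto.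
  - intros n L. exact (proj1 (switch_beta_cut i k n ltac:(lia)) eq_refl (proj2 L)).
  - apply exp_pow8, Sp'.
  - intros n L. exact (proj1 (proj2 (switch_beta_cut i k n ltac:(lia))) eq_refl L).
  - intros n L. exact (proj2 (proj2 (switch_beta_cut (negb i) k n ltac:(lia))) Oi L).
  - assert (PT' : forall j, 0 < T j) by (intros j; apply Sums).
    set (N := INR (switch (Datatypes.S k))) in *.
    assert (NA : A <= N).
    { apply Rle_trans with (A * exp (1 + 2 * A)); [|exact AexpN].
      pose proof (exp_ineq1_le (1 + 2 * A)). nra. }
    split.
    + set (r := S i * T (negb i)) in *. set (u := S (negb i) * T i) in *.
      assert (Pr : 0 < r) by (apply Rmult_lt_0_compat; auto).
      assert (Pu : 0 < u) by (apply Rmult_lt_0_compat; auto).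
      assert (RU : r / u < delta).
      { apply Rmult_lt_reg_r with (u * A); [apply Rmult_lt_0_compat; lra|].
        replace (r / u * (u * A)) with (r * A) by (field; lra).
        apply Rle_lt_trans with (8 * u); [unfold r; lra|].
        replace (delta * (u * A)) with (A * delta * u) by ring. apply Rmult_lt_compat_r; lra. }
      assert (RU' : r / (u + r) < delta).
      { apply Rle_lt_trans with (r / u); [|exact RU].
        apply Rmult_le_compat_l; [lra|]. apply Rinv_le_contravar; lra. }
      (* Writing T_1 as S_0 S_1 T_1 and cancelling S_1 gives a form symmetric in the two letters, so
         both parities reduce to r / (u + r). *)
      assert (M0 : mu (fun x => indic (Bool.eqb (x O) false)) = S false * T true /
                (S false * T true + S true * T false)).
      { rewrite Mass. pose proof (PT' true). pose proof (PT' false).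
        assert (PS0 : 0 < S false) by apply Sums. assert (PS1 : 0 < S true) by apply Sums.
        replace (T true) with (S false * S true * T true) at 1 2 by (rewrite SS; ring).
        assert (0 < S false * T true) by (apply Rmult_lt_0_compat; lra).
        assert (0 < S true * T false) by (apply Rmult_lt_0_compat; lra).
        field. repeat split; try lra.
        replace (S false * S true * T true + S true ^ 2 * T false)
          with (S true * (S false * T true + S true * T false)) by ring.
        apply Rmult_integral_contrapositive_currified; lra. }
      rewrite M0, Oi. unfold r, u in *. clearbody i. destruct i; simpl negb in *; cbv iota.
      * replace (S false * T true / (S false * T true + S true * T false) - 1)
          with (- (S true * T false / (S false * T true + S true * T false))) by (field; lra).
        rewrite Rabs_Ropp, Rabs_pos_eq; [exact RU'|]. apply Rlt_le, Rdiv_lt_0_compat; lra.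
      * rewrite Rminus_0_r, Rabs_pos_eq; [rewrite Rplus_comm; exact RU'|].
        apply Rlt_le, Rdiv_lt_0_compat; lra.
    + intros j n L. eapply Rle_lt_trans; [apply (Runs j n L i)|].
      apply Rmult_lt_reg_r with (T i); [exact PT|].
      unfold Rdiv. rewrite Rmult_assoc, Rinv_l by lra.
      (* The bound N S <= 2 T and A <= N give S / T <= 2 / A, which is below delta. *)
      assert (A * S i <= 2 * T i) by nra.
      apply Rmult_lt_reg_l with A; [lra|]. nra.
Qed.

Lemma alternating_selection (f : Sigma -> R) (eps : R) : continuous_S f -> 0 < eps ->
  exists K, forall k mu, (K <= k)%nat -> is_gibbs alternating (switch_beta k) mu ->
    Rabs (mu f - f (if Nat.odd k then one_inf else zero_inf)) < eps.
Proof.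
  intros Cf He.
  destruct (close_to_fixed_points f 0 eps Cf He) as [d0 [Hd0 C0]].
  destruct (close_to_fixed_points f 1 eps Cf He) as [d1 [Hd1 C1]].
  destruct (alternating_mass d0 Hd0) as [K0 M0]. destruct (alternating_mass d1 Hd1) as [K1 M1].
  exists (K0 + K1)%nat. intros k mu L G.
  destruct (M0 k mu ltac:(lia) G) as [P [A0 R0]]. destruct (M1 k mu ltac:(lia) G) as [_ [A1 R1]].
  destruct (Nat.odd k).
  - specialize (C0 mu P A0 R0).
    replace (f one_inf) with (0 * f zero_inf + (1 - 0) * f one_inf) by ring. exact C0.
  - specialize (C1 mu P A1 R1).
    replace (f zero_inf) with (1 * f zero_inf + (1 - 1) * f one_inf) by ring. exact C1.
Qed.

Theorem theorem1p2 :
  (forall (H : Sigma -> R) (a0 a1 b0 b1 : nat -> R) (Hinf0 Hinf1 Hmin1 : R),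
     double_well H a0 a1 b0 b1 ->
     is_Hinf b0 a1 Hinf0 ->
     is_Hinf b1 a0 Hinf1 ->
     is_inf_n1 (Hn b1 a0) Hmin1 ->
     Hinf0 <= Hinf1 ->
     ((/ 2 * (Hinf1 + Hinf0) > Hmin1 + Hinf0 ->
        gibbs_converges H (fun f => f one_inf)) /\
      (forall kappa : nat,
        has_card (fun n => (1 <= n)%nat /\ / 2 * (Hinf1 + Hinf0) = Hn b1 a0 n + Hinf0) kappa ->
        Hmin1 + Hinf0 >= / 2 * (Hinf1 + Hinf0) -> / 2 * (Hinf1 + Hinf0) > 0 ->
        gibbs_converges H (fun f =>
          / (1 + c_of kappa ^ 2) * f zero_inf
          + c_of kappa ^ 2 / (1 + c_of kappa ^ 2) * f one_inf)))) /\
  (exists (H : Sigma -> R) (a0 a1 b0 b1 : nat -> R) (beta : nat -> R),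
     double_well H a0 a1 b0 b1 /\
     (forall n, a0 n = 0 /\ a1 n = 0) /\
     is_Hinf b0 a1 0 /\ is_Hinf b1 a0 0 /\
     lipschitz_S H /\
     (forall k, 0 < beta k) /\
     (forall M, exists N, forall k, (N <= k)%nat -> M < beta k) /\
     (forall k, exists mu, is_gibbs H (beta k) mu) /\
     gibbs_seq_converges H beta (fun k => (2 * k)%nat) (fun f => f zero_inf) /\
     gibbs_seq_converges H beta (fun k => S (2 * k)) (fun f => f one_inf)).
Proof.
  split.
  - intros H a0 a1 b0 b1 Hinf0 Hinf1 Hmin1 DW I0 I1 Im Le. split.
    + apply (selection_of_one H a0 a1 b0 b1 Hinf0 Hinf1 Hmin1); assumption.
    + intros kappa Hk Gap Hpos.
      apply (selection_of_mixture H a0 a1 b0 b1 Hinf0 Hinf1 Hmin1); assumption.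
  - exists alternating, (fun _ => 0), (fun _ => 0), (well false), (well true), switch_beta.
    split; [apply alternating_double_well|].
    split; [split; reflexivity|].
    split; [apply well_Hinf|]. split; [apply well_Hinf|].
    split; [exists 4; intros x y m A _; apply alternating_variation, A|].
    split; [intros k; apply pow_lt; lra|].
    split.
    { intros M. destruct (INR_unbounded M) as [K HK]. exists K. intros k L.
      apply Rlt_le_trans with (INR K); [exact HK|].
      apply Rle_trans with (INR (switch (S k))).
      - apply le_INR. pose proof (switch_ge (S k)). lia.
      - unfold switch_beta. induction (switch (S k)) as [|n IH]; [simpl; lra|].
        rewrite S_INR. simpl. pose proof (pow_R1_Rle 16 n ltac:(lra)). lra. }
    split.
    { intros k. apply (gibbs_exists alternating well); [apply alternating_block| | |].
      - intros i. apply alternating_const.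
      - apply pow_lt. lra.
      - intros i n _. apply well_le. }
    split; intros f Cf eps He; destruct (alternating_selection f eps Cf He) as [K HK]; exists K;
      intros k mu L G.
    + specialize (HK (2 * k)%nat mu ltac:(lia) G). rewrite Nat.odd_mul in HK. exact HK.
    + specialize (HK (S (2 * k)) mu ltac:(lia) G).
      rewrite Nat.odd_succ, Nat.even_mul in HK. exact HK.
Qed.
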